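(* Suppose that $\lambda_n\to\lambda$, $\gamma_n\to\gamma$ and $\rho_n\to\rho$ with $\lambda,\gamma,\rho\in[0,1]$. Then in probability \[Q_n\to\begin{cases}h\big((1-\gamma)\log(1/\lambda),\,\gamma\log(1/\lambda)\big)(1-\lambda^\gamma)&\text{if }0<\lambda<1\text{ and }\gamma>0,\\ 0&\text{otherwise,}\end{cases}\] where for $a,b>0$, $h(a,b)=\mathbb E\big[\frac{Z}{(X_1+Z)(X_2+Z)}\,\big|\,Z>0\big]$ with independent $X_1,X_2\sim\mathrm{Poisson}(a)$, $Z\sim\mathrm{Poisson}(b)$, and for $a=0$, $h(0,b)=\mathbb E[Z^{-1}\mid Z>0]$.
   Context: Let $(\alpha_n)$ be a sequence in $(0,\infty)$ with $0<\liminf\alpha_n\le\limsup\alpha_n<\infty$, $q_n=\alpha_n\log n/n$, $(\rho_n)$ a sequence in $(0,1)$. Let $G^{(1)}_n\sim\mathcal G(n,q_n)$ on $\{1,\dots,n\}$ and obtain $G^{(2)}_n$ by independently, for each unordered vertex pair, with probability $1-\rho_n$ resampling its adjacency as a fresh Bernoulli$(q_n)$. Let $d_n^*=\min\{d\in\mathbb Z:(nq_n)^d\ge n/(\log\log n)^2\}$, $\lambda_n\in(0,1)$ with $\log(1/\lambda_n)=(nq_n)^{d_n^*}/n$, $\gamma_n=\rho_n^{d_n^*}$. For a graph $G$ and vertex $v\ne1$, $\mathsf{par}_G(v)$ is the set of neighbours $u$ of $v$ with $\mathsf d_G(1,u)+1=\mathsf d_G(1,v)$ (empty if $v$ is unreachable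 from $1$). Define \[Q_n=\frac1{n-1}\sum_{v\ne1}\frac{|\mathsf{par}_{G^{(1)}_n}(v)\cap\mathsf{par}_{G^{(2)}_n}(v)|}{|\mathsf{par}_{G^{(1)}_n}(v)|\cdot|\mathsf{par}_{G^{(2)}_n}(v)|}\] (summand $0$ if the numerator is $0$); this is the conditional expected fraction of vertices with a common parent when uniformly random shortest path trees from $1$ of the two graphs are sampled independently. *)

(* Defs.v *)
From HB Require Import structures.
From mathcomp Require Import all_boot all_order all_algebra.
From mathcomp Require Import all_classical all_reals all_analysis.

Set Implicit Arguments.
Unset Strict Implicit.
Unset Printing Implicit Defensive.

Import Order.TTheory GRing.Theory Num.Theory.
Import numFieldNormedType.Exports.

Local Open Scope classical_set_scope.
Local Open Scope ring_scope.

Definition walk (V : finType) (e : rel V) (k : nat) (x y : V) : bool :=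
  [exists p : k.-tuple V, path e x p && (last x p == y)].

(* A shortest walk has fewer than #|V| steps, so the value #|V| is returned
   exactly when y is unreachable from x. *)
Definition gdist (V : finType) (e : rel V) (x y : V) : nat :=
  find (fun k => walk e k x y) (iota 0 #|V|).

Definition par (V : finType) (e : rel V) (r v : V) : {set V} :=
  [set u | [&& connect e r v, e u v & (gdist e r u).+1 == gdist e r v]].

(* The vertex set {1, ..., n}, shifted to {0, ..., n - 1}: vertex 1 of the
   informal text is ord0. For n > 0 this is 'I_n; the form n.-1.+1 only makes
   ord0 available for every n, and the junk case n = 0 never matters. *)
Definition vertex (n : nat) : finType := 'I_n.-1.+1.

Definition vpair (n : nat) : finType := {s : {set vertex n} | #|s| == 2}.

Definition adj (n : nat) (G : vpair n -> bool) : rel (vertex n) :=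
  fun u v => if insub [set u; v]%SET is Some s then G s else false.

Definition overlap (R : realType) (n : nat) (G1 G2 : vpair n -> bool) : R :=
  (n%:R - 1)^-1 *
  \sum_(v : vertex n | v != ord0)
     #|par (adj G1) ord0 v :&: par (adj G2) ord0 v|%:R /
     (#|par (adj G1) ord0 v|%:R * #|par (adj G2) ord0 v|%:R).

(* Mutual independence of a finite family; the product rule for subfamilies is
   the case where some of the B i are setT. *)
Definition independent_RVs (R : realType) (d d' : measure_display)
    (T : measurableType d) (T' : measurableType d') (P : probability T R)
    (I : finType) (X : I -> {RV P >-> T'}) : Prop :=
  forall B : I -> set T', (forall i, measurable (B i)) ->
    P (\bigcap_i (X i @^-1` B i)) = (\prod_i P (X i @^-1` B i))%E.

Definition family3 (I : Type) (X : Type) (A B C : I -> X) (i : I + I + I) : X :=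
  match i with inl (inl s) => A s | inl (inr s) => B s | inr s => C s end.

(* G1 ~ G(n, q), and G2 is obtained from G1 by replacing the adjacency of the
   pair s by F s when S s holds; S s is the event that s is resampled. *)
Definition resampled_gnp (R : realType) (d : measure_display)
    (T : measurableType d) (P : probability T R) (n : nat) (q rho : R)
    (G1 G2 : vpair n -> {RV P >-> bool}) : Prop :=
  exists S F : vpair n -> {RV P >-> bool},
    [/\ independent_RVs (family3 G1 S F),
        forall s, distribution P (G1 s) =1 bernoulli_prob q,
        forall s, distribution P (S s) =1 bernoulli_prob (1 - rho),
        forall s, distribution P (F s) =1 bernoulli_prob q &
        forall s w, G2 s w = if S s w then F s w else G1 s w].

Definition edge_prob (R : realType) (alpha : nat -> R) (n : nat) : R :=
  alpha n * ln n%:R / n%:R.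

(* For n * q_n > 1, hence for all large n in the situation of interest, the
   minimum exists and is unique; otherwise the value is irrelevant. *)
Definition dstar (R : realType) (alpha : nat -> R) (n : nat) : int :=
  let ok (d : int) : bool :=
    n%:R / ln (ln n%:R) ^+ 2 <= (n%:R * edge_prob alpha n) ^ d in
  xget 0 [set d : int | ok d /\ forall d' : int, ok d' -> d <= d'].

Definition cond_expectation (R : realType) (d : measure_display)
    (T : measurableType d) (P : probability T R) (f : T -> R) (A : set T) : R :=
  (\int[P]_(x in A) f x) / fine (P A).

(* poisson_prob carries a nat argument that it ignores. *)
Definition poisson (R : realType) (a : R) : probability nat R :=
  poisson_prob a 0.

(* Sample points are ((x1, x2), z). *)
Definition poisson3 (R : realType) (a b : R) :
    probability (nat * nat * nat)%type R :=
  ((poisson a \x poisson a) \x poisson b)%E.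

Definition h (R : realType) (a b : R) : R :=
  if a == 0 then
    cond_expectation (poisson b) (fun z => z%:R^-1) [set z | (0 < z)%N]
  else
    cond_expectation (poisson3 a b)
      (fun w => w.2%:R / ((w.1.1 + w.2)%:R * (w.1.2 + w.2)%:R))
      [set w | (0 < w.2)%N].

Definition cvg_in_probability (R : realType) (d : nat -> measure_display)
    (T : forall n, measurableType (d n)) (P : forall n, probability (T n) R)
    (X : forall n, T n -> R) (c : R) : Prop :=
  forall eps : R, 0 < eps ->
    P n [set w | eps <= `|X n w - c|] @[n --> \oo] --> 0%E.

(* Main.v *)
Require Import Defs.
From HB Require Import structures.
From mathcomp Require Import all_boot all_order all_algebra.
From mathcomp Require Import ring lra.

(* The cavity method. Delete a vertex v: the edges at v are independent of the
   breadth-first layers of the rest, and v lies at distance k + 1 from the root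
   exactly when it is linked to layer k, but to no earlier layer, of the graph
   without v; its parents are then its neighbours in that layer. Deleting one or
   two vertices turns this into recursions for the first two moments of the layer
   sizes, uniformly in the deleted set, which show that layer k has about D^k
   vertices, D = n q, as long as D^k is much smaller than n. The common part of
   the layers of both graphs has about (rho + (1 - rho) q)^k D^k vertices: from
   above by the same recursion, from below by applying the one-graph estimate to
   the intersection graph.

   With k = d* - 1, conditionally on the layers the links of v into them are
   independent and rare, so that the numbers of common and private parents are
   nearly independent Poisson variables (Lindeberg replacement). Deleting two
   vertices v and w shows that the statistics of v and w are asymptotically
   uncorrelated, hence the average concentrates. Vertices at distance at least
   d* + 1 have a number of parents tending to infinity and do not contribute; this
   settles the cases lambda = 0 and lambda = 1 as well. *)

Set Implicit Arguments.
Unset Strict Implicit.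
Unset Printing Implicit Defensive.

Import Order.TTheory GRing.Theory Num.Theory.

(** * Breadth-first layers of a graph with deleted vertices *)

Section Balls.
Context {V : finType} (r : V).
Implicit Types (e : rel V) (X : {set V}) (u v w : V).

(** The pair of graphs is a function of independent labels on the vertex pairs, so every moment is a
    finite sum, and the given probability spaces matter only in the last step. Whatever is computed
    after deleting [Z] ignores the labels of pairs meeting [Z]; this exact independence takes the
    place of conditioning on an exploration.

    The common layers are the delicate point. A vertex in both layers need not descend from common
    vertices, and a vertex of the intersection graph may be nearer to the root in one of the graphs.
    Moreover, if gamma = 0, the intersection graph may be too sparse for the lower bound; the upper
    bound then suffices.

    The concentration result, applied to the indicator of having a link into layer d* - 1, shows
    that it is linear in n when 0 < lambda < 1; vertices further out then have order D parents.

    The left inequality makes the balls of radius d* - 1 negligible; the right one makes D^(d*+1) /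
    n diverge, because (log log n)^2 = o(D). *)

Fixpoint gball e X k : {set V} :=
  if k is j.+1 then
    gball e X j :|: [set w in ~: X | [exists u in gball e X j, e u w]]
  else [set r].

(** The ball of radius [k - 1], empty for [k = 0], so that layer 0 is the root alone. *)
Definition inner_ball e X k : {set V} :=
  if k is j.+1 then gball e X j else set0.

Definition layer e X k : {set V} := gball e X k :\: inner_ball e X k.

Definition link e v (L : {set V}) : {set V} := [set u in L | e u v].

Lemma in_ballS e X k w : (w \in gball e X k.+1) =
  (w \in gball e X k) || (w \notin X) && [exists u in gball e X k, e u w].
Proof. by rewrite /= !inE. Qed.

Lemma ballS_attach e X k u v :
  v \notin X -> u \in gball e X k -> e u v -> v \in gball e X k.+1.
Proof.
move=> vX uB euv; rewrite in_ballS vX /=; apply/orP; right.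
by apply/existsP; exists u; rewrite uB.
Qed.

Lemma sub_ballS e X k : gball e X k \subset gball e X k.+1.
Proof. exact: subsetUl. Qed.

Lemma sub_ball e X j k : j <= k -> gball e X j \subset gball e X k.
Proof.
move/subnK <-; elim: (k - j) => // i IH.
by rewrite addSn; apply: subset_trans IH (sub_ballS _ _ _).
Qed.

Lemma sub_inner_ball e X k : inner_ball e X k \subset gball e X k.
Proof. by case: k => [|k]; [exact: sub0set|exact: sub_ballS]. Qed.

Lemma ball_avoid e X k v : r \notin X -> v \in gball e X k -> v \notin X.
Proof.
move=> rX; elim: k => [|k IH]; first by rewrite inE => /eqP->.
by rewrite in_ballS => /orP[/IH//|/andP[]].
Qed.

Lemma root_ball e X k : r \in gball e X k.
Proof. by apply: (subsetP (sub_ball e X (leq0n k))); rewrite inE. Qed.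

Lemma layer_sub_ball e X k : layer e X k \subset gball e X k.
Proof. exact: subsetDl. Qed.

Lemma layer_avoid e X k v : r \notin X -> v \in layer e X k -> v \notin X.
Proof. by move=> rX /(subsetP (layer_sub_ball _ _ _)); exact: ball_avoid. Qed.

Lemma ball_subrel e e' X k :
  subrel e e' -> gball e X k \subset gball e' X k.
Proof.
move=> ee'; elim: k => [|k /subsetP IH]; first exact: subxx.
apply/subsetP => v; rewrite !in_ballS => /orP[/IH->//|/andP[-> /existsP[u]]].
move=> /andP[/IH uB /ee' euv]; apply/orP; right.
by apply/existsP; exists u; rewrite uB.
Qed.

Lemma ball_ext e e' X k : r \notin X ->
  (forall u w, u \notin X -> w \notin X -> e u w = e' u w) ->
  gball e X k = gball e' X k.
Proof.
move=> rX ee'; elim: k => // k IH; apply/setP => v; rewrite !in_ballS -IH.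
have [_|_ /=] := boolP (v \in gball e X k); first by [].
have [_|vX /=] := boolP (v \in X); first by [].
apply: eq_existsb => u; have [uB /=|//] := boolP (u \in gball e X k).
by rewrite ee' // (ball_avoid rX uB).
Qed.

Lemma layer_ext e e' X k : r \notin X ->
  (forall u w, u \notin X -> w \notin X -> e u w = e' u w) ->
  layer e X k = layer e' X k.
Proof.
move=> rX ee'; rewrite /layer (ball_ext k rX ee').
by case: k => //= k; rewrite (ball_ext k rX ee').
Qed.

(** Walks that stay within the ball never visit [w]. Hence a vertex may be deleted once it is known
    to lie outside the ball. *)
Lemma ball_add e X k w :
  w \notin gball e X k -> gball e (w |: X) k = gball e X k.
Proof.
elim: k => // k IH wB.
have wB' : w \notin gball e X k by apply: contra wB; apply: (subsetP (sub_ballS _ _ _)).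
apply/setP => v; rewrite !in_ballS (IH wB') !inE negb_or.
have [->|//] := eqVneq v w; rewrite (negbTE wB') /=.
by move: wB; rewrite in_ballS negb_or (negbTE wB') /= => /negbTE->.
Qed.

Lemma notin_ballW e X j k w : j <= k -> w \notin gball e X k -> w \notin gball e X j.
Proof. by move=> jk; apply: contra; apply: (subsetP (sub_ball _ _ jk)). Qed.

Lemma layer_add e X k w :
  w \notin gball e X k -> layer e (w |: X) k = layer e X k.
Proof.
move=> wB; rewrite /layer (ball_add wB).
by case: k wB => //= k wB; rewrite (ball_add (notin_ballW (leqnSn k) wB)).
Qed.

(** Until [v] is reached its deletion changes nothing, and a link to one ball is a link to all
    larger ones. The right-hand side separates the edges at [v] from a set that does not depend on
    them. *)
Lemma in_ball_link e X k v : v != r -> v \notin X ->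
  (v \in gball e X k) = (link e v (inner_ball e (v |: X) k) != set0).
Proof.
move=> vr vX; elim: k => [|k IH].
  rewrite inE (negbTE vr); apply/esym/negbTE; rewrite negbK.
  by apply/eqP/setP => u; rewrite !inE.
rewrite in_ballS vX /=; have [vB|vB] /= := boolP (v \in gball e X k).
  apply/esym; move: vB; rewrite IH => /set0Pn[u]; rewrite inE => /andP[uB euv].
  apply/set0Pn; exists u; rewrite inE euv andbT.
  exact: (subsetP (sub_inner_ball _ _ _)).
rewrite (ball_add vB); apply/existsP/set0Pn => -[u];
  by rewrite ?inE => uB; exists u; rewrite ?inE.
Qed.

Lemma layer_link e X k v : v \in layer e X k.+1 ->
  link e v (layer e (v |: X) k) != set0.
Proof.
rewrite in_setD in_ballS /= => /andP[vB]; rewrite (negbTE vB) /=.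
case/andP => vX /existsP[u /andP[uB euv]]; apply/set0Pn; exists u.
rewrite inE (layer_add vB) euv andbT in_setD uB andbT.
case: k vB uB => [|k] vB uB /=; first by rewrite inE.
by apply: contra vB => uB'; apply: ballS_attach uB' euv.
Qed.

Lemma notin_ball_link_layer e X k v : v \notin X -> v \notin gball e X k ->
  link e v (layer e (v |: X) k) != set0 -> v \in layer e X k.+1.
Proof.
move=> vX vB /set0Pn[u]; rewrite inE (layer_add vB) => /andP[uL euv].
rewrite in_setD vB; apply: ballS_attach euv => //.
exact: (subsetP (layer_sub_ball _ _ _)).
Qed.

Lemma link_layer e X k v : v != r -> v \notin X ->
  link e v (layer e (v |: X) k) != set0 ->
  link e v (inner_ball e (v |: X) k) = set0 -> v \in layer e X k.+1.
Proof.
move=> vr vX Ln N0; apply: notin_ball_link_layer => //.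
by rewrite in_ball_link // N0 eqxx.
Qed.

Lemma card_ballS e X k :
  #|gball e X k.+1| = #|gball e X k| + #|layer e X k.+1|.
Proof. by rewrite -(cardsID (gball e X k)) (setIidPr (sub_ballS _ _ _)). Qed.

Lemma layer0 e X : layer e X 0 = [set r].
Proof. by rewrite /layer /= setD0. Qed.

Lemma card_layer_inner e X k :
  #|layer e X k| <= #|gball e X k| /\ #|inner_ball e X k| <= #|gball e X k|.
Proof. by split; apply: subset_leq_card; [exact: layer_sub_ball|exact: sub_inner_ball]. Qed.

Lemma mem_ball_walk e k v :
  reflect (exists2 i, i <= k & walk e i r v) (v \in gball e set0 k).
Proof.
apply: (iffP idP) => [|[i ik]].
  elim: k v => [|k IH] v.
    rewrite inE => /eqP->; exists 0 => //; apply/existsP; exists [tuple].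
    by rewrite /= eqxx.
  rewrite in_ballS => /orP[/IH[i ik W]|]; first by exists i => //; apply: leqW.
  case/andP => _ /existsP[u /andP[/IH[i ik /existsP[p /andP[ep /eqP lp]]] euv]].
  exists i.+1 => //; apply/existsP; exists [tuple of rcons p v].
  by rewrite /= rcons_path ep lp euv last_rcons eqxx.
case/existsP => p /andP[ep /eqP <-].
apply: (subsetP (sub_ball e set0 ik)).
case: p ep => p /= /eqP <- {ik}; elim/last_ind: p => [|p x IH].
  by rewrite inE.
rewrite rcons_path last_rcons size_rcons => /andP[/IH pB exp].
by apply: ballS_attach exp; rewrite ?inE.
Qed.

(** Loop erasure; it shows that the range [iota 0 #|V|] searched by [gdist] misses no reachable
    vertex. *)
Lemma walk_short e i v : walk e i r v -> exists2 j, j < #|V| & walk e j r v.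
Proof.
case/existsP => p /andP[ep /eqP lp].
case: (shortenP ep) lp => p' ep' up' _ lp'.
exists (size p'); first by have := max_card (mem (r :: p')); rewrite (card_uniqP up').
by apply/existsP; exists (in_tuple p'); rewrite ep' /= lp' eqxx.
Qed.

Lemma mem_layer_walk e k v : v \in layer e set0 k ->
  walk e k r v /\ forall i, walk e i r v -> k <= i.
Proof.
rewrite in_setD => /andP[vI /mem_ball_walk[i ik Wi]].
have kmin j : walk e j r v -> k <= j.
  move=> Wj; rewrite leqNgt; apply: contra vI => jk.
  by case: k jk {ik} => // k jk /=; apply/mem_ball_walk; exists j.
by split=> //; have := kmin _ Wi; move=> ki; rewrite (_ : k = i) //; apply/eqP; rewrite eqn_leq ki.
Qed.

Lemma gdist_layer e k v : v \in layer e set0 k -> gdist e r v = k.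
Proof.
move=> /mem_layer_walk[Wk kmin].
have [j jV Wj] := walk_short Wk.
have kV : k < #|V| := leq_ltn_trans (kmin _ Wj) jV.
have hasW : has (fun k => walk e k r v) (iota 0 #|V|).
  by apply/hasP; exists k => //; rewrite mem_iota.
apply/eqP; rewrite eqn_leq; apply/andP; split.
  rewrite leqNgt; apply/negP => kd.
  by have := before_find 0 kd; rewrite nth_iota // add0n Wk.
have := nth_find 0 hasW; rewrite -/(gdist e r v) nth_iota ?add0n; first exact: kmin.
by rewrite /gdist -[X in _ < X](size_iota 0) -has_find.
Qed.

Lemma gdist_lt_layer e v :
  gdist e r v < #|V| -> v \in layer e set0 (gdist e r v).
Proof.
move=> dV; have hasW : has (fun k => walk e k r v) (iota 0 #|V|).
  by rewrite has_find size_iota.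
have := nth_find 0 hasW; rewrite -/(gdist e r v) nth_iota // add0n => W.
rewrite in_setD; apply/andP; split; last by apply/mem_ball_walk; exists (gdist e r v).
case E: (gdist e r v) => [|d]; first by rewrite inE.
apply/negP => /mem_ball_walk[i id Wi].
have iV : i < #|V| by apply: leq_ltn_trans id _; apply: ltn_trans (ltnSn d) _; rewrite -E.
have := @before_find _ 0 (fun k => walk e k r v) (iota 0 #|V|) i.
by rewrite -/(gdist e r v) E ltnS id nth_iota // add0n Wi => /(_ isT).
Qed.

Lemma par_layer e k v : v \notin gball e set0 k ->
  link e v (layer e [set v] k) != set0 -> par e r v = link e v (layer e [set v] k).
Proof.
rewrite -[[set v]]setU0 => vB Ln.
have vL : v \in layer e set0 k.+1 by apply: notin_ball_link_layer => //; rewrite inE.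
apply/setP => u; rewrite (layer_add vB) 2!inE (gdist_layer vL) eqSS.
have [Wv _] := mem_layer_walk vL.
have -> : connect e r v.
  by case/existsP: Wv => p /andP[ep /eqP lp]; apply/connectP; exists p.
rewrite /= andbC; congr (_ && _).
apply/eqP/idP => [dk|]; last exact: gdist_layer.
(* An unreachable [u] has the default distance [#|V|]. A short walk to [v] gives [k.+1 < #|V|], so a
   vertex [u] with [gdist] equal to [k] is really reached. *)
have [j jV Wj] := walk_short Wv.
have kV : k.+1 < #|V|.
  by apply: leq_ltn_trans jV; have [_] := mem_layer_walk vL; apply.
by rewrite -dk; apply: gdist_lt_layer; rewrite dk; apply: ltn_trans kV.
Qed.

End Balls.

Local Open Scope ring_scope.

(** * Expectations on a finite product space *)

Section ProductSpace.
Context {R : realFieldType} {I T : finType} (nu : T -> R).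

Definition is_pmf := (forall t, 0 <= nu t) /\ \sum_t nu t = 1.

Definition Ex1 (f : T -> R) : R := \sum_t nu t * f t.

Definition weight (g : {ffun I -> T}) : R := \prod_i nu (g i).

Definition Ex (F : {ffun I -> T} -> R) : R := \sum_g weight g * F g.

Definition mix (A : pred I) (g g' : {ffun I -> T}) : {ffun I -> T} :=
  [ffun i => if A i then g' i else g i].

(** Measurability with respect to the coordinates in [A], phrased by resampling: it then combines
    directly with [Ex_mix] and makes sense for set-valued [F]. *)
Definition depends_on (A : pred I) (S : Type) (F : {ffun I -> T} -> S) :=
  forall g g', F (mix A g g') = F g'.

Definition depends_off (A : pred I) (S : Type) (F : {ffun I -> T} -> S) :=
  forall g g', F (mix A g g') = F g.

Lemma eq_Ex F G : F =1 G -> Ex F = Ex G.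
Proof. by move=> FG; apply: eq_bigr => g _; rewrite FG. Qed.

Lemma ExD F G : Ex (fun g => F g + G g) = Ex F + Ex G.
Proof. by rewrite /Ex -big_split; apply: eq_bigr => g _; rewrite mulrDr. Qed.

Lemma ExZ c F : Ex (fun g => c * F g) = c * Ex F.
Proof. by rewrite /Ex mulr_sumr; apply: eq_bigr => g _; rewrite mulrCA. Qed.

Lemma ExB F G : Ex (fun g => F g - G g) = Ex F - Ex G.
Proof.
rewrite -[- Ex G]mulN1r -ExZ -ExD.
by apply: eq_Ex => g; rewrite mulN1r.
Qed.

Lemma Ex_sum (J : Type) (s : seq J) (P : pred J) (F : J -> {ffun I -> T} -> R) :
  Ex (fun g => \sum_(j <- s | P j) F j g) = \sum_(j <- s | P j) Ex (F j).
Proof.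
rewrite /Ex exchange_big /=; apply: eq_bigr => g _.
by rewrite mulr_sumr.
Qed.

Lemma Ex1_coord i (f : T -> R) : \sum_t nu t = 1 ->
  Ex (fun g => f (g i)) = Ex1 f.
Proof.
move=> nu1.
pose F j t := nu t * (if j == i then f t else 1).
transitivity (\sum_(g : {ffun I -> T}) \prod_j F j (g j)).
  apply: eq_bigr => g _; rewrite big_split /= -/(weight g); congr (_ * _).
  by rewrite -big_mkcond big_pred1_eq.
rewrite -bigA_distr_bigA (bigD1 i) //= [X in _ * X]big1 ?mulr1; last first.
  move=> j ji; rewrite -[RHS]nu1; apply: eq_bigr => t _.
  by rewrite /F (negbTE ji) mulr1.
by apply: eq_bigr => t _; rewrite /F eqxx.
Qed.

Hypothesis nuP : is_pmf.

Lemma weight_ge0 g : 0 <= weight g.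
Proof. by apply: prodr_ge0 => i _; case: nuP. Qed.

Lemma Ex_cst c : Ex (fun=> c) = c.
Proof.
rewrite /Ex -mulr_suml /weight -(bigA_distr_bigA (fun=> nu)).
by rewrite big1 ?mul1r // => i _; case: nuP.
Qed.

Lemma ler_Ex F G : (forall g, F g <= G g) -> Ex F <= Ex G.
Proof.
by move=> FG; apply: ler_sum => g _; apply: ler_wpM2l; rewrite ?weight_ge0.
Qed.

Lemma Ex_ge0 F : (forall g, 0 <= F g) -> 0 <= Ex F.
Proof. by move=> F0; rewrite -[X in X <= _](Ex_cst 0); apply: ler_Ex. Qed.

Lemma Ex_le_cst c F : (forall g, F g <= c) -> Ex F <= c.
Proof. by move=> Fc; rewrite -[leRHS](Ex_cst c); apply: ler_Ex. Qed.

Lemma sqr_Ex F : Ex F ^+ 2 <= Ex (fun g => F g ^+ 2).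
Proof.
have : 0 <= Ex (fun g => (F g - Ex F) ^+ 2) by apply: Ex_ge0 => g; apply: sqr_ge0.
have -> : Ex (fun g => (F g - Ex F) ^+ 2) =
          Ex (fun g => F g ^+ 2 - 2 * Ex F * F g + Ex F ^+ 2).
  by apply: eq_Ex => g; ring.
rewrite ExD ExB ExZ Ex_cst => E0; rewrite -subr_ge0; apply: le_trans E0 _.
by rewrite le_eqVlt; apply/orP; left; apply/eqP; ring.
Qed.

Lemma weight_mix A g g' : weight (mix A g g') * weight (mix A g' g) =
  weight g * weight g'.
Proof.
rewrite /weight -!big_split; apply: eq_bigr => i _ /=; rewrite !ffunE.
by case: ifP => // _; rewrite mulrC.
Qed.

Lemma mixK A g g' : mix A (mix A g g') (mix A g' g) = g.
Proof. by apply/ffunP => i; rewrite !ffunE; case: (A i). Qed.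

(* The coordinates in [A] may be resampled: (g, g') |-> (mix A g g', mix A g' g)
   is a weight preserving involution. *)
Lemma Ex_mix A F : Ex F = Ex (fun g => Ex (fun g' => F (mix A g g'))).
Proof.
pose phi (p : {ffun I -> T} * {ffun I -> T}) := (mix A p.1 p.2, mix A p.2 p.1).
have phiK : involutive phi by case=> g g'; rewrite /phi /= !mixK.
transitivity (\sum_(p : {ffun I -> T} * {ffun I -> T})
    weight p.1 * weight p.2 * F (mix A p.1 p.2)); last first.
  rewrite -(pair_bigA _ (fun g g' => weight g * weight g' * F (mix A g g'))).
  apply: eq_bigr => g _; rewrite mulr_sumr.
  by apply: eq_bigr => g' _; rewrite mulrA.
rewrite (reindex_inj (inv_inj phiK)) /=.
transitivity (\sum_(p : {ffun I -> T} * {ffun I -> T})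
    weight p.1 * weight p.2 * F p.1); last first.
  by apply: eq_bigr => -[g g'] _ /=; rewrite weight_mix mixK.
rewrite -(pair_bigA _ (fun g g' => weight g * weight g' * F g)).
apply: eq_bigr => g _; rewrite -{1}[F g]Ex_cst mulr_sumr.
by apply: eq_bigr => g' _; rewrite mulrA.
Qed.

(** After [Ex_mix], [F] sees only the fresh sample and [G] only the old one. *)
Lemma Ex_indep A F G : depends_on A F -> depends_off A G ->
  Ex (fun g => F g * G g) = Ex F * Ex G.
Proof.
move=> onF offG; rewrite (Ex_mix A) -ExZ; apply: eq_Ex => g.
by rewrite mulrC -ExZ; apply: eq_Ex => g'; rewrite onF offG mulrC.
Qed.

Lemma Ex1_coord2 i j f1 f2 : i != j ->
  Ex (fun g => f1 (g i) * f2 (g j)) = Ex1 f1 * Ex1 f2.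
Proof.
move=> ij; have [_ nu1] := nuP.
rewrite -(Ex1_coord i f1 nu1) -(Ex1_coord j f2 nu1) (Ex_indep (A := pred1 i)) //.
  by move=> g g'; rewrite ffunE /= eqxx.
by move=> g g'; rewrite ffunE /= eq_sym (negbTE ij).
Qed.

End ProductSpace.

Lemma is_pmf_Ex1_ge0 (R : realFieldType) (T : finType) (nu : T -> R) (f : T -> R) :
  is_pmf nu -> (forall t, 0 <= f t) -> 0 <= Ex1 nu f.
Proof. by case=> nu0 _ f0; apply: sumr_ge0 => t _; apply: mulr_ge0. Qed.

(** * Random graphs as functions of independent edge labels *)

Section EdgeLabels.
Context {n : nat} {T : finType}.
Notation V := (vertex n).
Implicit Types (e : T -> bool) (g : {ffun vpair n -> T}) (X : {set V}) (u v w : V).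

Definition graph e g : rel V := adj (fun s => e (g s)).

(** The coordinates discarded by deleting [X]; their labels are independent of the layers of the
    remaining graph. *)
Definition touch X : pred (vpair n) :=
  fun s => ~~ [disjoint (val s : {set V}) & X].

Lemma adj_edge u v : u != v -> exists2 s : vpair n, val s = [set u; v] &
  forall G, adj G u v = G s.
Proof.
move=> uv; have c2 : #|[set u; v]| == 2%N by rewrite cards2 uv.
exists (Sub [set u; v] c2) => [|G]; first exact: SubK.
by rewrite /adj insubT.
Qed.

Lemma adjxx (G : vpair n -> bool) u : adj G u u = false.
Proof. by rewrite /adj insubN // setUid cards1. Qed.

Lemma touchE X (s : vpair n) u v : val s = [set u; v] ->
  touch X s = (u \in X) || (v \in X).
Proof.
move=> sE; rewrite /touch /= sE.
apply/idP/idP => [|uvX].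
  rewrite disjoint_subset => /subsetPn[w].
  by rewrite !inE negbK => /orP[]/eqP-> ->; rewrite ?orbT.
case/orP: uvX => xX; apply/negP => dis.
  by have := disjointFr dis (set21 u v); rewrite xX.
by have := disjointFr dis (set22 u v); rewrite xX.
Qed.

Lemma graph_off e X g g' u w : u \notin X -> w \notin X ->
  graph e (mix (touch X) g g') u w = graph e g u w.
Proof.
move=> uX wX; have [->|/adj_edge[s sE sP]] := eqVneq u w; first by rewrite /graph !adjxx.
by rewrite /graph !sP ffunE (touchE _ sE) (negbTE uX) (negbTE wX).
Qed.

Lemma graph_on e X g g' u v : v \in X ->
  graph e (mix (touch X) g g') u v = graph e g' u v.
Proof.
move=> vX; have [->|/adj_edge[s sE sP]] := eqVneq u v; first by rewrite /graph !adjxx.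
by rewrite /graph !sP ffunE (touchE _ sE) vX orbT.
Qed.

Lemma link_on e v X L : v \in X ->
  depends_on (touch X) (fun g => link (graph e g) v L).
Proof. by move=> vX g g'; apply/setP => u; rewrite !inE graph_on. Qed.

Lemma link_off e v X (L : {set V}) : v \notin X -> [disjoint L & X] ->
  depends_off (touch X) (fun g => link (graph e g) v L).
Proof.
move=> vX LX g g'; apply/setP => u; rewrite !inE.
have [uL /=|//] := boolP (u \in L).
by rewrite graph_off // (disjointFr LX uL).
Qed.

Lemma ball_off e (r : V) X k : r \notin X ->
  depends_off (touch X) (fun g => gball r (graph e g) X k).
Proof. by move=> rX g g'; apply: ball_ext => // u w uX wX; apply: graph_off. Qed.

Lemma layer_off e (r : V) X k : r \notin X ->
  depends_off (touch X) (fun g => layer r (graph e g) X k).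
Proof. by move=> rX g g'; apply: layer_ext => // u w uX wX; apply: graph_off. Qed.

End EdgeLabels.

(** * Moments of links and of layers *)

Section Links.
Context {R : realFieldType} {n : nat} {T : finType} (nu : T -> R).
Hypothesis nuP : is_pmf nu.
Notation V := (vertex n).
Notation config := {ffun vpair n -> T}.
Notation E := (@Ex R (vpair n) T nu).
Implicit Types (e : T -> bool) (g : config) (X Z : {set V}) (u v w : V)
  (A : config -> {set V}).

Definition pr e : R := Ex1 nu (fun t => (e t)%:R).

Lemma pr_ge0 e : 0 <= pr e.
Proof. by apply: is_pmf_Ex1_ge0 => // t; rewrite ler0n. Qed.

Lemma card_sum_out (B Z : {set V}) : B \subset ~: Z ->
  #|B|%:R = \sum_(u in ~: Z) (u \in B)%:R :> R.
Proof.
move=> BZ; rewrite -sum1_card natr_sum [RHS](bigID (mem B)) /=.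
rewrite [X in _ + X]big1 ?addr0; last by move=> u /andP[_ /negbTE->].
rewrite (eq_bigl (fun u => (u \in ~: Z) && (u \in B))); last first.
  by move=> u; have [/(subsetP BZ)->|] := boolP (u \in B); rewrite ?andbF.
by apply: eq_bigr => u /andP[_ ->].
Qed.

Lemma card_link_out e g v (B Z : {set V}) : B \subset ~: Z ->
  #|link (graph e g) v B|%:R =
  \sum_(u in ~: Z) (graph e g u v)%:R * (u \in B)%:R :> R.
Proof.
move=> BZ; rewrite (@card_sum_out _ Z); last first.
  by apply: subset_trans BZ; apply/subsetP => u; rewrite inE => /andP[].
by apply: eq_bigr => u _; rewrite inE andbC -natrM mulnb.
Qed.

Lemma Ex_edge e Z u v (G : config -> R) : u \notin Z -> v \in Z ->
  depends_off (touch Z) G ->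
  E (fun g => (graph e g u v)%:R * G g) = pr e * E G.
Proof.
move=> uZ vZ offG; have uv : u != v by apply: contraNneq uZ => ->.
rewrite (Ex_indep nuP _ offG); last by move=> g g'; rewrite graph_on.
have [s _ sP] := adj_edge uv.
rewrite /pr -(Ex1_coord s (fun t => (e t)%:R)); last by case: nuP.
by congr (_ * _); apply: eq_Ex => g; rewrite /graph sP.
Qed.

Lemma Ex_edge2 e e' Z u v u' v' (G : config -> R) :
  u \notin Z -> v \in Z -> u' \notin Z -> v' \in Z -> (u, v) != (u', v') ->
  depends_off (touch Z) G ->
  E (fun g => (graph e g u v)%:R * (graph e' g u' v')%:R * G g) =
  pr e * pr e' * E G.
Proof.
move=> uZ vZ uZ' vZ' neq offG.
have uv : u != v by apply: contraNneq uZ => ->.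
have uv' : u' != v' by apply: contraNneq uZ' => ->.
have nX x y : x \notin Z -> y \in Z -> (x == y) = false.
  by move=> xZ yZ; apply: contraNF xZ => /eqP->.
rewrite (Ex_indep nuP _ offG); last by move=> g g'; rewrite !graph_on.
have [s sE sP] := adj_edge uv; have [s' sE' sP'] := adj_edge uv'.
rewrite /pr -(@Ex1_coord2 _ _ _ _ nuP s s'); first by congr (_ * _); apply: eq_Ex => g; rewrite /graph sP sP'.
(* An edge between [Z] and its complement tells which of its ends lies in [Z], so equal edges come
   from equal ordered pairs. *)
apply: contraNneq neq => ss'; move: sE'; rewrite -ss' sE => eqs.
have := set21 u v; have := set22 u v; rewrite eqs !inE.
rewrite (eq_sym v) nX //= (nX u v') // orbF => /eqP-> /eqP->.
by [].
Qed.

Lemma Ex_link e Z v A : v \in Z -> depends_off (touch Z) A ->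
  (forall g, A g \subset ~: Z) ->
  E (fun g => #|link (graph e g) v (A g)|%:R) = pr e * E (fun g => #|A g|%:R).
Proof.
move=> vZ offA AZ.
under eq_Ex => g do rewrite (card_link_out _ _ _ (AZ g)).
under [in RHS]eq_Ex => g do rewrite (card_sum_out (AZ g)).
rewrite !Ex_sum mulr_sumr; apply: eq_bigr => u; rewrite inE => uZ.
by rewrite (Ex_edge _ uZ vZ) // => g g'; rewrite offA.
Qed.

Lemma Ex_link_link e e' Z v w A A' : v \in Z -> w \in Z -> v != w ->
  depends_off (touch Z) A -> depends_off (touch Z) A' ->
  (forall g, A g \subset ~: Z) -> (forall g, A' g \subset ~: Z) ->
  E (fun g => #|link (graph e g) v (A g)|%:R * #|link (graph e' g) w (A' g)|%:R) =
  pr e * pr e' * E (fun g => #|A g|%:R * #|A' g|%:R).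
Proof.
move=> vZ wZ vw offA offA' AZ AZ'.
under eq_Ex => g do rewrite (card_link_out _ _ _ (AZ g)) (card_link_out _ _ _ (AZ' g)) big_distrlr /=.
under [in RHS]eq_Ex => g do rewrite (card_sum_out (AZ g)) (card_sum_out (AZ' g)) big_distrlr /=.
rewrite !Ex_sum mulr_sumr; apply: eq_bigr => u; rewrite inE => uZ.
rewrite !Ex_sum mulr_sumr; apply: eq_bigr => u'; rewrite inE => uZ'.
rewrite -(@Ex_edge2 _ _ Z u v u' w) //; last 2 first.
- by rewrite xpair_eqE negb_and vw orbT.
- by move=> g g'; rewrite offA offA'.
by apply: eq_Ex => g; rewrite mulrACA.
Qed.

(** Distinct sources give independent edges, while a common source contributes the probability that
    both predicates hold for one label. It is only an upper bound because the last product also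
    counts the diagonal. *)
Lemma Ex_link2_le e e' Z v A A' : v \in Z ->
  depends_off (touch Z) A -> depends_off (touch Z) A' ->
  (forall g, A g \subset ~: Z) -> (forall g, A' g \subset ~: Z) ->
  E (fun g => #|link (graph e g) v (A g)|%:R * #|link (graph e' g) v (A' g)|%:R) <=
  pr (fun t => e t && e' t) * E (fun g => #|A g :&: A' g|%:R) +
  pr e * pr e' * E (fun g => #|A g|%:R * #|A' g|%:R).
Proof.
move=> vZ offA offA' AZ AZ'.
under eq_Ex => g do rewrite (card_link_out _ _ _ (AZ g)) (card_link_out _ _ _ (AZ' g)) big_distrlr /=.
have AAZ g : A g :&: A' g \subset ~: Z := subset_trans (subsetIl _ _) (AZ g).
under [X in _ <= pr _ * X + _]eq_Ex => g do rewrite (card_sum_out (AAZ g)).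
under [X in _ <= _ + _ * X]eq_Ex => g do rewrite (card_sum_out (AZ g)) (card_sum_out (AZ' g)) big_distrlr /=.
rewrite !Ex_sum [X in _ <= X + _]mulr_sumr [X in _ <= _ + X]mulr_sumr -big_split /=.
apply: ler_sum => u; rewrite inE => uZ.
rewrite !Ex_sum [X in _ <= _ + X]mulr_sumr (bigD1 u) ?inE //= [in X in _ <= _ + X](bigD1 u) ?inE //=.
rewrite addrA; apply: lerD.
  rewrite -[X in X <= _]addr0; apply: lerD; last first.
    by rewrite !mulr_ge0 ?pr_ge0 ?Ex_ge0 // => g; rewrite mulr_ge0 ?ler0n.
  rewrite -(Ex_edge _ uZ vZ); last by move=> g g'; rewrite offA offA'.
  apply: ler_Ex => // g; rewrite mulrACA -!natrM !mulnb -in_setI.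
  by rewrite /graph; have [->|/adj_edge[s _ sP]] := eqVneq u v; rewrite ?adjxx ?sP.
apply: ler_sum => u' /andP[]; rewrite inE => uZ' neq.
rewrite -(@Ex_edge2 _ _ Z u v u' v) //; last 2 first.
- by rewrite xpair_eqE negb_and eq_sym neq.
- by move=> g g'; rewrite offA offA'.
by apply: ler_Ex => // g; rewrite mulrACA.
Qed.

End Links.

Lemma card_sum_mem (R : pzSemiRingType) (V : finType) (B : {set V}) :
  #|B|%:R = \sum_v (v \in B)%:R :> R.
Proof.
rewrite -sum1_card natr_sum [LHS]big_mkcond.
by apply: eq_bigr => v _; case: (v \in B).
Qed.

(** Both vertices lie outside the ball of radius [k], so deleting them together does not alter layer
    [k]; their links then use disjoint sets of edges. *)
Lemma layer_pair (V : finType) (r : V) (e : rel V) X k v w : v != w ->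
  v \in layer r e X k.+1 -> w \in layer r e X k.+1 ->
  link e v (layer r e (v |: (w |: X)) k) != set0.
Proof.
move=> vw vL; have := layer_link vL; move: vL.
rewrite !in_setD /= => /andP[vB _] + /andP[wB _].
by rewrite [layer _ _ (v |: X) _]layer_add // layer_add ?layer_add // ball_add.
Qed.

Section LayerMoments.
Context {R : realFieldType} {n : nat} {T : finType} (nu : T -> R).
Hypothesis nuP : is_pmf nu.
Hypothesis n_gt0 : (0 < n)%N.
Notation V := (vertex n).
Notation config := {ffun vpair n -> T}.
Notation E := (@Ex R (vpair n) T nu).
Context (r : V).
Implicit Types (e : T -> bool) (g : config) (X Z : {set V}) (u v w : V).

Local Notation lay e g X k := (layer r (graph e g) X k).
Local Notation bal e g X k := (gball r (graph e g) X k).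

Lemma card_vertex : #|V| = n.
Proof. by rewrite card_ord prednK. Qed.

Lemma layer_out e g Z k : r \notin Z -> lay e g Z k \subset ~: Z.
Proof. by move=> rZ; apply/subsetP => u uL; rewrite inE (layer_avoid rZ uL). Qed.

Lemma ball_out e g Z k : r \notin Z -> bal e g Z k \subset ~: Z.
Proof. by move=> rZ; apply/subsetP => u uL; rewrite inE (ball_avoid rZ uL). Qed.

Lemma root_notin_layerS e g X k : r \notin lay e g X k.+1.
Proof. by rewrite in_setD /= root_ball. Qed.

Lemma setU1_out v Z : v != r -> r \notin Z -> r \notin v |: Z.
Proof. by move=> vr rZ; rewrite !inE negb_or eq_sym vr. Qed.

Lemma Ex_sum_mem (B : config -> {set V}) :
  E (fun g => #|B g|%:R) = \sum_v E (fun g => (v \in B g)%:R).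
Proof.
rewrite -Ex_sum; apply: eq_Ex => g; exact: card_sum_mem.
Qed.

Lemma sum_vertex_cst (c : R) : \sum_(v : V) c = n%:R * c.
Proof. by rewrite sumr_const card_vertex mulr_natl. Qed.

Section OneGraph.
Context (e : T -> bool).
Let p := pr nu e.
Let D := n%:R * p.

Let p_ge0 : 0 <= p. Proof. exact: pr_ge0. Qed.
Let D_ge0 : 0 <= D. Proof. by rewrite mulr_ge0. Qed.
Let nR_gt0 : 0 < n%:R :> R. Proof. by rewrite ltr0n. Qed.

Lemma Ex_layer_le k X : r \notin X -> E (fun g => #|lay e g X k|%:R) <= D ^+ k.
Proof.
elim: k X => [|k IH] X rX.
  by apply: Ex_le_cst => // g; rewrite layer0 cards1.
rewrite Ex_sum_mem exprS -mulrA -sum_vertex_cst; apply: ler_sum => v _.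
have pD0 : 0 <= p * D ^+ k by rewrite mulr_ge0 ?exprn_ge0.
have [->|vr] := eqVneq v r.
  by apply: Ex_le_cst => // g; rewrite (negbTE (root_notin_layerS _ _ _ _)).
have rvX := setU1_out vr rX.
apply: le_trans (ler_wpM2l p_ge0 (IH _ rvX)).
rewrite -(Ex_link nuP e (setU11 v X)); last 2 first.
- exact: layer_off.
- by move=> g; apply: layer_out.
apply: ler_Ex => // g; case: (boolP (v \in _)) => [vL|_]; last by rewrite ler0n.
by rewrite ler1n card_gt0 layer_link.
Qed.

Hypothesis D_ge2 : 2 <= D.

Let D_gt0 : 0 < D. Proof. by apply: lt_le_trans D_ge2. Qed.

(** Off the diagonal a pair of vertices costs [p * p] times the previous second moment, whence
    [S k.+1 <= D ^+ 2 * S k + D ^+ k.+1]. The subtracted [D ^+ k] is what lets the induction absorb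
    the diagonal term, given [2 <= D]. *)
Lemma Ex_layer_sqr_le k X : r \notin X ->
  E (fun g => #|lay e g X k|%:R ^+ 2) <=
  (D ^+ k) ^+ 2 + 2 / D * ((D ^+ k) ^+ 2 - D ^+ k).
Proof.
elim: k X => [|k IH] X rX.
  by apply: Ex_le_cst => // g; rewrite layer0 cards1 !expr0 expr1n subrr mulr0 addr0.
set x := D ^+ k; have x_ge0 : 0 <= x by rewrite exprn_ge0.
set m := (D ^+ k) ^+ 2 + _ in IH.
have m_ge0 : 0 <= m.
  by apply: le_trans (IH _ rX); apply: Ex_ge0 => // g; apply: sqr_ge0.
have -> : E (fun g => #|lay e g X k.+1|%:R ^+ 2) =
    \sum_v \sum_w E (fun g => (v \in lay e g X k.+1)%:R * (w \in lay e g X k.+1)%:R).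
  rewrite -[RHS](eq_bigr _ (fun v _ => Ex_sum _ _ _ _)) -Ex_sum.
  by apply: eq_Ex => g; rewrite expr2 !card_sum_mem big_distrlr.
apply: (@le_trans _ _ (\sum_(v : V) (E (fun g => (v \in lay e g X k.+1)%:R) +
    \sum_(w : V) p * p * m))).
  apply: ler_sum => v _; rewrite (bigD1 v) //=; apply: lerD.
    apply: ler_Ex => // g.
    by case: (v \in _); rewrite ?mulr1 ?mulr0.
  rewrite [leRHS](bigD1 v) //= -[leLHS]add0r; apply: lerD; first by rewrite !mulr_ge0.
  apply: ler_sum => w wv.
  have [->|vr] := eqVneq v r.
    apply: Ex_le_cst => // g; rewrite (negbTE (root_notin_layerS _ _ _ _)) mul0r.
    by rewrite !mulr_ge0.
  have [->|wr] := eqVneq w r.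
    apply: Ex_le_cst => // g; rewrite (negbTE (root_notin_layerS _ _ _ _)) mulr0.
    by rewrite !mulr_ge0.
  pose Z := v |: (w |: X).
  have rZ : r \notin Z by rewrite !setU1_out.
  have vw : v != w by rewrite eq_sym.
  apply: le_trans (ler_wpM2l (mulr_ge0 p_ge0 p_ge0) (IH _ rZ)).
  rewrite -(@Ex_link_link _ _ _ _ nuP e e Z v w) ?setU11 ?inE ?eqxx ?orbT //; first last.
  - by move=> g; apply: layer_out.
  - by move=> g; apply: layer_out.
  - exact: layer_off.
  - exact: layer_off.
  apply: ler_Ex => // g.
  case: (boolP (v \in _)) => [vL|_]; last by rewrite mul0r mulr_ge0.
  case: (boolP (w \in _)) => [wL|_]; last by rewrite mulr0 mulr_ge0.
  rewrite mulr1 -natrM ler1n muln_gt0 !card_gt0 layer_pair //=.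
  by rewrite /Z setUCA layer_pair // eq_sym.
rewrite big_split /= -Ex_sum_mem.
have := Ex_layer_le k.+1 rX; rewrite exprS -/x => E1.
rewrite !sum_vertex_cst.
rewrite (_ : n%:R * (n%:R * (p * p * m)) = D ^+ 2 * m); last by rewrite /D; ring.
rewrite /m -/x.
have -> : 2 / D * ((D * x) ^+ 2 - D * x) = 2 * (D * x ^+ 2 - x).
  by field; rewrite gt_eqF.
have -> : D ^+ 2 * (x ^+ 2 + 2 / D * (x ^+ 2 - x)) = (D * x) ^+ 2 + 2 * D * (x ^+ 2 - x).
  by field; rewrite gt_eqF.
have : 2 * x <= D * x by apply: ler_wpM2r.
lra.
Qed.

Lemma Ex_layer_sqr_le2 k X : r \notin X ->
  E (fun g => #|lay e g X k|%:R ^+ 2) <= 2 * (D ^+ k) ^+ 2.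
Proof.
move=> rX; apply: le_trans (Ex_layer_sqr_le k rX) _.
have x_ge0 : 0 <= D ^+ k by rewrite exprn_ge0.
have iD : 2 / D <= 1 by rewrite ler_pdivrMr ?mul1r.
have i0 : 0 <= 2 / D by rewrite divr_ge0.
have : 2 / D * (D ^+ k) ^+ 2 <= 1 * (D ^+ k) ^+ 2 by rewrite ler_wpM2r ?sqr_ge0.
have : 0 <= 2 / D * D ^+ k by rewrite mulr_ge0.
lra.
Qed.

Lemma Ex_ball_le k X : r \notin X -> E (fun g => #|bal e g X k|%:R) <= 2 * D ^+ k.
Proof.
move=> rX; elim: k => [|k IH].
  by apply: Ex_le_cst => // g; rewrite /= cards1 expr0 mulr1 ler1n.
under eq_Ex => g do rewrite card_ballS natrD.
rewrite ExD; have := Ex_layer_le k.+1 rX; rewrite exprS => E1.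
have : 2 * D ^+ k <= D * D ^+ k by apply: ler_wpM2r; rewrite ?exprn_ge0.
by lra.
Qed.

Lemma Ex_ball_sqr_le k X : r \notin X ->
  E (fun g => #|bal e g X k|%:R ^+ 2) <= 8 * (D ^+ k) ^+ 2.
Proof.
move=> rX; elim: k => [|k IH].
  by apply: Ex_le_cst => // g; rewrite /= cards1 !expr1n mulr1 ler1n.
apply: (@le_trans _ _ (E (fun g => 2 * #|bal e g X k|%:R ^+ 2 +
                                   2 * #|lay e g X k.+1|%:R ^+ 2))).
  apply: ler_Ex => // g; rewrite card_ballS natrD.
  have := sqr_ge0 (#|bal e g X k|%:R - #|lay e g X k.+1|%:R : R); nra.
rewrite ExD !ExZ; have := Ex_layer_sqr_le2 k.+1 rX; rewrite (exprS D).
set x := D ^+ k in IH *; have x2 : 0 <= x ^+ 2 by apply: sqr_ge0.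
have : 2 * 2 * x ^+ 2 <= D * D * x ^+ 2 by apply: ler_wpM2r => //; apply: ler_pM.
rewrite [(D * x) ^+ 2]exprMn; lra.
Qed.

(** A Bonferroni inequality. If [v] has [y] links into layer [k] and [y'] into the whole ball, its
    indicator is at least [2 * y - y * y']: without links to earlier layers [y' = y] and
    [2 * y - y ^+ 2 <= 1]; with [y >= 1] and an earlier link, [y' >= 2] and the expression is
    nonpositive. *)
Lemma Ex_mem_layer_ge k X v : v != r -> v \notin X -> r \notin X ->
  p * E (fun g => #|lay e g (v |: X) k|%:R) -
  p * p * E (fun g => #|bal e g (v |: X) k|%:R ^+ 2) <=
  E (fun g => (v \in lay e g X k.+1)%:R).
Proof.
move=> vr vX rX; set Z := v |: X; have rZ : r \notin Z := setU1_out vr rX.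
pose y g := #|link (graph e g) v (lay e g Z k)|%:R : R.
pose y' g := #|link (graph e g) v (bal e g Z k)|%:R : R.
apply: (@le_trans _ _ (E (fun g => 2 * y g - y g * y' g))).
  rewrite ExB ExZ (Ex_link nuP e (setU11 v X)); first last.
  - by move=> g; apply: layer_out.
  - exact: layer_off.
  have := @Ex_link2_le _ _ _ nu nuP e e Z v (fun g => lay e g Z k)
    (fun g => bal e g Z k) (setU11 v X) (layer_off e k rZ) (ball_off e k rZ)
    (fun g => layer_out e g k rZ) (fun g => ball_out e g k rZ).
  have -> : pr nu (fun t => e t && e t) = p.
    by apply: eq_bigr => t _; rewrite andbb.
  have -> : E (fun g => #|lay e g Z k :&: bal e g Z k|%:R) =
            E (fun g => #|lay e g Z k|%:R).
    by apply: eq_Ex => g; rewrite (setIidPl (layer_sub_ball _ _ _ _)).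
  have : p * p * E (fun g => #|lay e g Z k|%:R * #|bal e g Z k|%:R) <=
         p * p * E (fun g => #|bal e g Z k|%:R ^+ 2).
    apply: ler_wpM2l; first exact: mulr_ge0.
    apply: ler_Ex => // g; rewrite expr2 ler_wpM2r // ler_nat.
    by case: (card_layer_inner r (graph e g) Z k).
  rewrite -/(y _) -/(y' _) -/p; lra.
apply: ler_Ex => // g; rewrite /y /y'.
have -> : link (graph e g) v (bal e g Z k) = link (graph e g) v (lay e g Z k) :|:
    link (graph e g) v (inner_ball r (graph e g) Z k).
  apply/setP => u; rewrite !inE -andb_orl; congr (_ && _).
  have := subsetP (sub_inner_ball r (graph e g) Z k) u.
  by case: (u \in inner_ball _ _ _ _) => [->|_] //=; rewrite ?orbF.
have [-> | Ln] := eqVneq (link (graph e g) v (lay e g Z k)) set0.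
  by rewrite cards0 mulr0 mul0r subr0 ler0n.
set A := link _ v (lay e g Z k) in Ln *; set B := link _ v (inner_ball _ _ _ _).
have A1 : 1 <= #|A|%:R :> R by rewrite ler1n card_gt0.
have [B0|Bn] := eqVneq B set0.
  rewrite (link_layer vr vX Ln B0) B0 setU0 /=.
  by have := sqr_ge0 (#|A|%:R - 1 : R); nra.
suff U2 : 2 <= #|A :|: B|%:R :> R by have := ler0n R (v \in lay e g X k.+1); nra.
rewrite ler_nat cardsU disjoint_setI0 ?cards0 ?subn0.
  by rewrite -[2%N]/(1 + 1)%N leq_add // card_gt0.
rewrite disjoint_subset; apply/subsetP => u; rewrite !inE => /andP[/andP[uI _] _].
by rewrite (negbTE uI).
Qed.

(** The deficit has two sources. Links into the ball that spoil the new layer cost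
    [8 * D ^+ 2 * x ^+ 2] per step for [x = D ^+ k], and [16] closes that recursion when [2 <= D].
    The root and the deleted vertices, one more at each recursive call, cost the polynomial term. *)
Lemma Ex_layer_ge k X : r \notin X ->
  n%:R * (D ^+ k - E (fun g => #|lay e g X k|%:R)) <=
  D ^+ k * (16 * D ^+ k + (k * (k + #|X|))%:R).
Proof.
elim: k X => [|k IH] X rX.
  under eq_Ex => g do rewrite layer0 cards1.
  by rewrite Ex_cst // expr0 subrr mulr0 mul0n !mulr1 addr0 mul1r ler0n.
set x := D ^+ k; have x_ge0 : 0 <= x by rewrite exprn_ge0.
pose kap : R := (k * (k + #|X|.+1))%:R.
pose c : R := #|X|.+1%:R.
pose O := ~: (r |: X).
pose M : R := #|O|%:R.
have nM : n%:R = c + M.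
  rewrite /c /M -natrD; congr _%:R.
  by rewrite -[LHS]card_vertex -(cardsC (r |: X)) cardsU1 rX.
pose m := x - x * (16 * x + kap) / n%:R.
have kap_ge0 : 0 <= kap by apply: ler0n.
have mx : m <= x.
  rewrite /m gerBl divr_ge0 // mulr_ge0 // addr_ge0 // mulr_ge0 //.
have nm : n%:R * m = n%:R * x - x * (16 * x + kap).
  by rewrite /m; field; rewrite gt_eqF.
have Ev : M * (p * m - 8 * (p * p) * x ^+ 2) <= E (fun g => #|lay e g X k.+1|%:R).
  rewrite Ex_sum_mem (bigID (mem O)) /= -[leLHS]addr0; apply: lerD; last first.
    by apply: sumr_ge0 => v _; apply: Ex_ge0 => // g; apply: ler0n.
  rewrite /M mulr_natl -sumr_const; apply: ler_sum => v.
  rewrite !inE negb_or => /andP[vr vX]; have rZ := setU1_out vr rX.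
  apply: le_trans (Ex_mem_layer_ge k vr vX rX); apply: lerB.
    apply: ler_wpM2l => //.
    rewrite -(ler_pM2l nR_gt0) nm.
    by have := IH _ rZ; rewrite -/x cardsU1 vX -/kap; lra.
  rewrite (_ : 8 * (p * p) * x ^+ 2 = p * p * (8 * x ^+ 2)); last by ring.
  apply: ler_wpM2l; first exact: mulr_ge0.
  exact: Ex_ball_sqr_le.
have M_ge0 : 0 <= M by apply: ler0n.
have c_ge0 : 0 <= c by apply: ler0n.
rewrite exprS -/x mulrBr lerBlDr.
have H1 : n%:R * (M * (p * m - 8 * (p * p) * x ^+ 2)) =
     D * (n%:R * m) - D * c * m - 8 * D * (M * p) * x ^+ 2.
  by rewrite /D nM; ring.
have H2 : 8 * D * (M * p) * x ^+ 2 <= 8 * D * D * x ^+ 2.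
  apply: ler_wpM2r; first exact: sqr_ge0.
  apply: ler_wpM2l; first by rewrite mulr_ge0.
  by rewrite /D ler_wpM2r // nM lerDr.
have H3 : D * c * m <= D * c * x by apply: ler_wpM2l => //; apply: mulr_ge0.
have := ler_wpM2l (ltW nR_gt0) Ev; rewrite H1 nm => H4.
have H5 : 2 * (D * x * x) <= D * (D * x * x).
  by apply: ler_wpM2r => //; rewrite !mulr_ge0.
have -> : (k.+1 * (k.+1 + #|X|))%:R = kap + k%:R + c :> R.
  by rewrite /kap /c !natrM !natrD -!natr1; ring.
have H6 : 0 <= D * x * k%:R by rewrite !mulr_ge0.
apply: le_trans (lerD (lexx _) H4).
lra.
Qed.

Hypothesis D_ge4 : 4 <= D.

Lemma Ex_layer_var k X : r \notin X ->
  E (fun g => (#|lay e g X k|%:R - D ^+ k) ^+ 2) <=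
  (D ^+ k) ^+ 2 * (2 / D + 2 * (17 + #|X|%:R) * (D ^+ k / n%:R)).
Proof.
move=> rX; set x := D ^+ k; have x_ge0 : 0 <= x by rewrite exprn_ge0.
have -> : E (fun g => (#|lay e g X k|%:R - x) ^+ 2) =
  E (fun g => #|lay e g X k|%:R ^+ 2 - 2 * x * #|lay e g X k|%:R + x ^+ 2).
  by apply: eq_Ex => g; ring.
rewrite ExD ExB ExZ Ex_cst //.
have E2 := Ex_layer_sqr_le k rX; rewrite -/x in E2.
have E1 := Ex_layer_ge k rX; rewrite -/x in E1.
set S2 := E _ in E2 *; set S := E _ in E1 *.
(* From [k < 2 ^ k] follows [k ^ 2 <= 4 ^ k <= D ^ k]: the polynomial deficit is absorbed by the
   other one. Here [4 <= D] enters. *)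
have kx : (k * (k + #|X|))%:R <= (1 + #|X|%:R) * x.
  have k2 : (k ^ 2)%:R <= x.
    apply: (@le_trans _ _ (4 ^+ k)); last by rewrite /x lerXn2r ?nnegrE.
    rewrite -natrX ler_nat -[4%N]/(2 ^ 2)%N -expnM mulnC expnM leq_exp2r //.
    exact: ltnW (ltn_expl _ _).
  apply: (@le_trans _ _ ((1 + #|X|)%:R * (k ^ 2)%:R)).
    rewrite -natrM ler_nat mulnDl mul1n mulnDr leq_add2l mulnC leq_mul2l.
    by rewrite [(k <= _)%N](_ : _ = true) ?orbT //; case: (k) => // j; rewrite expnS leq_pmulr.
  by rewrite natrD; apply: ler_wpM2l => //; rewrite addr_ge0.
have E1' : x - S <= x * (16 * x + (1 + #|X|%:R) * x) / n%:R.
  rewrite ler_pdivlMr // mulrC; apply: le_trans E1 _; apply: ler_wpM2l => //.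
  by rewrite lerD2l.
have H := ler_wpM2l x_ge0 E1'.
have i0 : 0 <= 2 / D * x by rewrite mulr_ge0 ?divr_ge0.
have -> : x ^+ 2 * (2 / D + 2 * (17 + #|X|%:R) * (x / n%:R)) =
  2 / D * x ^+ 2 + 2 * (x * (x * (16 * x + (1 + #|X|%:R) * x) / n%:R)).
  by field; rewrite !gt_eqF.
lra.
Qed.

End OneGraph.
End LayerMoments.

(** * Common part of the layers of two correlated graphs *)

Section CommonLayers.
Context {R : realFieldType} {n : nat} {T : finType} (nu : T -> R).
Hypothesis nuP : is_pmf nu.
Hypothesis n_gt0 : (0 < n)%N.
Notation V := (vertex n).
Notation config := {ffun vpair n -> T}.
Notation E := (@Ex R (vpair n) T nu).
Context (r : V).
Implicit Types (e : T -> bool) (g : config) (X Z : {set V}) (u v w : V).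

Local Notation lay e g X k := (layer r (graph e g) X k).
Local Notation bal e g X k := (gball r (graph e g) X k).

(** Jensen's inequality for the variance bound, with [40 = 2 * (17 + 3)]. Three deleted vertices
    suffice throughout: one whose links into the next layer are studied, and two for a second
    moment. *)
Lemma Ex_layer_dist e k X s : r \notin X -> (#|X| <= 3)%N ->
  4 <= n%:R * pr nu e -> 0 <= s ->
  2 / (n%:R * pr nu e) + 40 * ((n%:R * pr nu e) ^+ k / n%:R) <= s ^+ 2 ->
  E (fun g => `|#|lay e g X k|%:R - (n%:R * pr nu e) ^+ k|) <=
  (n%:R * pr nu e) ^+ k * s.
Proof.
set D := n%:R * pr nu e => rX X3 D4 s0 Ds.
have D_ge0 : 0 <= D by apply: le_trans D4.
have x_ge0 : 0 <= D ^+ k by rewrite exprn_ge0.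
rewrite -(ler_pXn2r (ltn0Sn 1)) ?nnegrE ?mulr_ge0 //; last first.
  by apply: Ex_ge0 => // g; apply: normr_ge0.
apply: le_trans (sqr_Ex nuP _) _.
under eq_Ex => g do rewrite real_normK ?num_real //.
have D2 : 2 <= D by lra.
apply: le_trans (Ex_layer_var nuP n_gt0 D2 D4 k rX) _.
rewrite [leRHS]exprMn; apply: ler_wpM2l; first exact: sqr_ge0.
apply: le_trans Ds; rewrite lerD2l; apply: ler_wpM2r; first by rewrite divr_ge0.
have : #|X|%:R <= 3 :> R by rewrite ler_nat.
by lra.
Qed.

Lemma Ex_inner_ball_le e k X : r \notin X -> 2 <= n%:R * pr nu e ->
  E (fun g => #|inner_ball r (graph e g) X k|%:R) <=
  2 * ((n%:R * pr nu e) ^+ k / (n%:R * pr nu e)).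
Proof.
move=> rX D2; have D0 : 0 < n%:R * pr nu e by apply: lt_le_trans D2.
case: k => [|k] /=.
  apply: Ex_le_cst => // g; rewrite cards0 mulr_ge0 // divr_ge0 //; exact: ltW.
rewrite exprS [X in 2 * (X / _)]mulrC mulfK ?gt_eqF //.
exact: Ex_ball_le.
Qed.

Context (e1 e2 : T -> bool) (q ro : R).
Let e12 t := e1 t && e2 t.
Hypothesis pr1 : pr nu e1 = q.
Hypothesis pr2 : pr nu e2 = q.
Hypothesis pr12 : pr nu e12 = q * ro.
Hypothesis ro_ge0 : 0 <= ro.
Hypothesis ro_le1 : ro <= 1.
Let D := n%:R * q.
Hypothesis D_ge2 : 2 <= D.

Let D_gt0 : 0 < D. Proof. by apply: lt_le_trans D_ge2. Qed.
Let nR_gt0 : 0 < n%:R :> R. Proof. by rewrite ltr0n. Qed.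
Let q_ge0 : 0 <= q. Proof. by rewrite -pr1 pr_ge0. Qed.

Definition common k X g : {set V} := lay e1 g X k :&: lay e2 g X k.

(** A common child either has a common parent through an edge of both graphs, with probability
    [q * ro], or two different parents. The latter case costs [q * q] times a product of layer sizes
    and accumulates to the term with factor 4. *)
Lemma Ex_common_le k X : r \notin X ->
  E (fun g => #|common k X g|%:R) <= D ^+ k * (ro ^+ k + 4 * (D ^+ k / n%:R)).
Proof.
elim: k X => [|k IH] X rX.
  apply: Ex_le_cst => // g; rewrite /common !layer0 setIid cards1 !expr0 mul1r.
  by rewrite lerDl mulr_ge0 // divr_ge0.
set x := D ^+ k in IH *; have x_ge0 : 0 <= x by rewrite exprn_ge0 // ltW.
rewrite Ex_sum_mem //.
pose m := q * ro * (x * (ro ^+ k + 4 * (x / n%:R))) + q * q * (2 * x ^+ 2).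
have m_ge0 : 0 <= m.
  rewrite addr_ge0 ?mulr_ge0 ?addr_ge0 ?exprn_ge0 ?mulr_ge0 ?invr_ge0 //.
apply: (@le_trans _ _ (n%:R * m)).
  rewrite -(sum_vertex_cst n_gt0); apply: ler_sum => v _.
  have [->|vr] := eqVneq v r.
    by apply: Ex_le_cst => // g; rewrite inE (negbTE (root_notin_layerS _ _ _ _ _)).
  pose Z := v |: X; have rZ : r \notin Z := setU1_out vr rX.
  apply: (@le_trans _ _ (E (fun g => #|link (graph e1 g) v (lay e1 g Z k)|%:R *
                                    #|link (graph e2 g) v (lay e2 g Z k)|%:R))).
    apply: ler_Ex => // g; rewrite inE.
    case: (boolP (v \in _)) => [vL|_]; last by rewrite mulr_ge0.
    case: (boolP (v \in _)) => [wL|_]; last by rewrite mulr_ge0.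
    by rewrite -natrM ler1n muln_gt0 !card_gt0 !layer_link.
  have := @Ex_link2_le _ _ _ nu nuP e1 e2 Z v (fun g => lay e1 g Z k)
    (fun g => lay e2 g Z k) (setU11 v X) (layer_off e1 k rZ) (layer_off e2 k rZ)
    (fun g => layer_out e1 g k rZ) (fun g => layer_out e2 g k rZ).
  move=> /le_trans; apply; rewrite -/e12 pr12 pr1 pr2; apply: lerD.
    by apply: ler_wpM2l; [rewrite mulr_ge0|exact: IH].
  apply: ler_wpM2l; first exact: mulr_ge0.
  have D2 : 2 <= n%:R * pr nu e1 by rewrite pr1.
  have D2' : 2 <= n%:R * pr nu e2 by rewrite pr2.
  have := Ex_layer_sqr_le2 nuP n_gt0 D2 k rZ.
  have := Ex_layer_sqr_le2 nuP n_gt0 D2' k rZ.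
  rewrite pr1 pr2 -/D -/x => E1 E2.
  apply: (@le_trans _ _ (E (fun g => 2^-1 * (#|lay e1 g Z k|%:R ^+ 2 +
                                            #|lay e2 g Z k|%:R ^+ 2)))).
    apply: ler_Ex => // g.
    by have := sqr_ge0 (#|lay e1 g Z k|%:R - #|lay e2 g Z k|%:R : R); nra.
  by rewrite ExZ ExD; lra.
rewrite !exprS -/x.
have -> : n%:R * m = D * x * (ro * ro ^+ k) + (4 * ro + 2 * D) * (D * x ^+ 2 / n%:R).
  by rewrite /m /D; field; rewrite gt_eqF.
have -> : D * x * (ro * ro ^+ k + 4 * (D * x / n%:R)) =
          D * x * (ro * ro ^+ k) + (4 * D) * (D * x ^+ 2 / n%:R).
  by field; rewrite gt_eqF.
rewrite lerD2l; apply: ler_wpM2r.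
  by rewrite divr_ge0 // mulr_ge0 ?sqr_ge0 // ltW.
by have := D_ge2; have := ro_le1; lra.
Qed.

Lemma Ex_common_dist_small k X : r \notin X ->
  E (fun g => `|#|common k X g|%:R - ro ^+ k * D ^+ k|) <=
  D ^+ k * (2 * ro ^+ k + 4 * (D ^+ k / n%:R)).
Proof.
move=> rX; have x_ge0 : 0 <= D ^+ k by rewrite exprn_ge0 // ltW.
apply: (@le_trans _ _ (E (fun g => #|common k X g|%:R + ro ^+ k * D ^+ k))).
  apply: ler_Ex => // g; apply: le_trans (ler_normB _ _) _.
  by rewrite !ger0_norm // mulr_ge0 // exprn_ge0.
rewrite ExD Ex_cst //; have := Ex_common_le k rX; lra.
Qed.

(* A vertex at distance k in the intersection graph is at distance at most k in
   both graphs, and the balls of radius k - 1 are negligible. *)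
Lemma Ex_common_dist k X s : r \notin X -> (#|X| <= 3)%N ->
  4 <= D * ro -> 0 <= s -> 2 / (D * ro) + 40 * (D ^+ k / n%:R) <= s ^+ 2 ->
  E (fun g => `|#|common k X g|%:R - ro ^+ k * D ^+ k|) <=
  D ^+ k * (4 * (D ^+ k / n%:R) + 2 * s + 8 / D).
Proof.
move=> rX X3 D4 s0 Ds; set x := D ^+ k.
have x_ge0 : 0 <= x by rewrite exprn_ge0 // ltW.
have rok_ge0 : 0 <= ro ^+ k by rewrite exprn_ge0.
have rok_le1 : ro ^+ k <= 1 by rewrite exprn_ile1.
have DE : n%:R * pr nu e12 = D * ro by rewrite pr12 mulrA.
pose y := (D * ro) ^+ k; have yE : ro ^+ k * x = y by rewrite /y exprMn mulrC.
have yx : y <= x by rewrite -yE ler_piMl.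
have y_ge0 : 0 <= y by rewrite -yE mulr_ge0.
pose S g := #|lay e12 g X k|%:R : R.
pose B e g := #|inner_ball r (graph e g) X k|%:R : R.
have ES : E (fun g => `|S g - y|) <= x * s.
  have := @Ex_layer_dist e12 k X s rX X3; rewrite DE => /(_ D4 s0) ESs.
  apply: le_trans (ESs _) _; last by rewrite -/y ler_wpM2r.
  apply: le_trans Ds; rewrite lerD2l; apply: ler_wpM2l => //.
  by rewrite -/y ler_wpM2r ?invr_ge0.
have EB1 : E (B e1) <= 2 * (x / D).
  by have := @Ex_inner_ball_le e1 k X rX; rewrite pr1; apply.
have EB2 : E (B e2) <= 2 * (x / D).
  by have := @Ex_inner_ball_le e2 k X rX; rewrite pr2; apply.
have sub g : S g <= #|common k X g|%:R + B e1 g + B e2 g.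
  rewrite -!natrD ler_nat.
  have : lay e12 g X k \subset common k X g :|: inner_ball r (graph e1 g) X k
             :|: inner_ball r (graph e2 g) X k.
    apply/subsetP => u /(subsetP (layer_sub_ball _ _ _ _)) uB.
    have sub1 : subrel (graph e12 g) (graph e1 g).
      move=> a b; have [->|/adj_edge[t _ tP]] := eqVneq a b; first by rewrite /graph adjxx.
      by rewrite /graph !tP => /andP[].
    have sub2 : subrel (graph e12 g) (graph e2 g).
      move=> a b; have [->|/adj_edge[t _ tP]] := eqVneq a b; first by rewrite /graph adjxx.
      by rewrite /graph !tP => /andP[].
    rewrite !inE (subsetP (ball_subrel r X k sub1) _ uB).
    rewrite (subsetP (ball_subrel r X k sub2) _ uB) !andbT.
    by case: (u \in inner_ball _ (graph e1 g) _ _); case: (u \in inner_ball _ _ _ _).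
  move=> /subset_leq_card /leq_trans; apply.
  apply: leq_trans (leq_card_setU _ _) _; rewrite leq_add2r.
  exact: leq_card_setU.
(* Since the common layer [C] satisfies [S - C <= B e1 + B e2], one has
   [|C - S| <= C - S + 2 * (B e1 + B e2)]. The absolute value is gone, and the upper bound on the
   mean of [C] applies. *)
rewrite yE; apply: (@le_trans _ _ (E (fun g => #|common k X g|%:R - S g
   + `|S g - y| + 2 * (B e1 g + B e2 g)))).
  apply: ler_Ex => // g; have := sub g.
  have B1 : 0 <= B e1 g by apply: ler0n.
  have B2 : 0 <= B e2 g by apply: ler0n.
  by case: (lerP y (S g)); case: (lerP y #|common k X g|%:R); lra.
rewrite ExD ExZ [E (fun g => B e1 g + B e2 g)]ExD ExD ExB.
have ES1 : y - E S <= x * s.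
  rewrite -[y](@Ex_cst _ (vpair n) _ _ nuP) -ExB; apply: le_trans ES; apply: ler_Ex => // g.
  by rewrite distrC ler_norm.
have := Ex_common_le k rX; rewrite -/x mulrDr [x * ro ^+ k]mulrC yE => EC.
have -> : x * (4 * (x / n%:R) + 2 * s + 8 / D) =
   x * (4 * (x / n%:R)) + 2 * (x * s) + 8 * (x / D) by ring.
lra.
Qed.

End CommonLayers.

From mathcomp Require Import boolp classical_sets functions reals topology normedtype sequences exp.
(* Reimported so that [set0], [setU], ... denote finite sets again. *)
From mathcomp Require Import fintype finset.
Import numFieldNormedType.Exports.

(** * Poisson expectations *)

Lemma dist_trans (R : numDomainType) (x y z a b : R) :
  `|x - y| <= a -> `|y - z| <= b -> `|x - z| <= a + b.
Proof. by move=> xy yz; apply: le_trans (ler_distD y x z) (lerD xy yz). Qed.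

Section PoissonExpectation.
Context {R : realType}.
Implicit Types (a b p q : R) (f g : nat -> R).

Definition unit_valued f := forall k, 0 <= f k <= 1.

Definition pois a k : R := expR (- a) * (a ^+ k / k`!%:R).

(** Poisson expectation as a series, which keeps the perturbation estimates elementary;
    [integral_poisson] identifies it with the integral used by [h]. *)
Definition PE a f : R := limn (series (fun k => pois a k * f k)).

Lemma pois_ge0 a k : 0 <= a -> 0 <= pois a k.
Proof. by move=> a0; rewrite mulr_ge0 ?expR_ge0 // divr_ge0 // exprn_ge0. Qed.

Lemma pois_sum a : (series (pois a) @ \oo --> (1 : R))%classic.
Proof.
have -> : series (pois a) = (fun n => expR (- a) * series (exp_coeff a) n).
  by apply/funext => n; rewrite /series /= mulr_sumr.
have -> : (1 : R) = expR (- a) * expR a by rewrite expRN mulVf // gt_eqF // expR_gt0.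
by apply: cvgMr; exact: is_cvg_series_exp_coeff.
Qed.

Lemma PE_cvg a f : 0 <= a -> unit_valued f ->
  (series (fun k => pois a k * f k) @ \oo --> PE a f)%classic.
Proof.
move=> a0 f01; apply: (@series_le_cvg _ _ (pois a)).
- by move=> k; rewrite mulr_ge0 ?pois_ge0 //; case/andP: (f01 k).
- by move=> k; apply: pois_ge0.
- by move=> k; rewrite ler_piMr ?pois_ge0 //; case/andP: (f01 k).
by apply/cvg_ex; exists 1; apply: pois_sum.
Qed.

Lemma eq_PE a f g : f =1 g -> PE a f = PE a g.
Proof. by move=> fg; congr PE; apply/funext. Qed.

Lemma PE_le a f g : 0 <= a -> unit_valued f -> unit_valued g ->
  (forall k, f k <= g k) -> PE a f <= PE a g.
Proof.
move=> a0 f01 g01 fg; apply: (ler_cvg_to (PE_cvg a0 f01) (PE_cvg a0 g01)).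
by apply: nearW => n; apply: ler_sum => k _; apply: ler_wpM2l; rewrite ?pois_ge0.
Qed.

Lemma PE_cst a c : PE a (fun=> c) = c.
Proof.
apply/cvg_lim => //.
have -> : series (fun k => pois a k * c) = (fun n => series (pois a) n * c).
  by apply/funext => n; rewrite /series /= mulr_suml.
by rewrite -[X in (_ --> X)%classic]mul1r; apply: cvgMl; exact: pois_sum.
Qed.

Lemma PE_unit a f : 0 <= a -> unit_valued f -> 0 <= PE a f <= 1.
Proof.
move=> a0 f01; apply/andP; split.
  rewrite -[X in X <= _](PE_cst a); apply: PE_le => // k; first by rewrite lexx ler01.
  by case/andP: (f01 k).
rewrite -[X in _ <= X](PE_cst a); apply: PE_le => // k; first by rewrite lexx ler01.
by case/andP: (f01 k).
Qed.

Lemma PE_lin a c d f g : 0 <= a -> unit_valued f -> unit_valued g ->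
  PE a (fun k => c * f k + d * g k) = c * PE a f + d * PE a g.
Proof.
move=> a0 f01 g01; apply/cvg_lim => //.
have -> : series (fun k => pois a k * (c * f k + d * g k)) =
  (fun n => c * series (fun k => pois a k * f k) n +
            d * series (fun k => pois a k * g k) n).
  apply/funext => n; rewrite /series /= !mulr_sumr -big_split /=.
  by apply: eq_bigr => k _; ring.
by apply: cvgD; apply: cvgMr; apply: PE_cvg.
Qed.

Lemma PE_contract a f g c : 0 <= a -> unit_valued f -> unit_valued g ->
  (forall k, `|f k - g k| <= c) -> `|PE a f - PE a g| <= c.
Proof.
move=> a0 f01 g01 fg.
have c0 : 0 <= c := le_trans (normr_ge0 _) (fg 0%N).
have c1 k : (f k <= g k + c) /\ (g k <= f k + c).
  by have := fg k; rewrite ler_norml => /andP[]; lra.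
suff H f' g' : unit_valued f' -> unit_valued g' -> (forall k, f' k <= g' k + c) ->
    PE a f' <= PE a g' + c.
  have := H _ _ f01 g01 (fun k => (c1 k).1); have := H _ _ g01 f01 (fun k => (c1 k).2).
  by rewrite ler_norml; lra.
move=> f01' g01' le.
have -> : PE a g' + c = 1 * PE a g' + c * PE a (fun=> 1) by rewrite PE_cst mul1r mulr1.
have u1 : unit_valued (fun=> 1) by move=> k; rewrite ler01 lexx.
apply: (ler_cvg_to (PE_cvg a0 f01') (_ : (_ --> _)%classic)).
  by apply: cvgD; apply: cvgMr; apply: PE_cvg.
apply: nearW => n; rewrite fctE /= /series /= !mulr_sumr -big_split /=; apply: ler_sum => k _.
have := ler_wpM2l (pois_ge0 k a0) (le k); lra.
Qed.

Lemma exprD_ge a p k : 0 <= a -> 0 <= p ->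
  a ^+ k.+1 + k.+1%:R * a ^+ k * p <= (a + p) ^+ k.+1.
Proof.
move=> a0 p0; elim: k => [|k IH]; first by rewrite !expr1 expr0 mulr1 mul1r.
rewrite [(a + p) ^+ _]exprS.
apply: le_trans (ler_wpM2l (addr_ge0 a0 p0) IH).
have : 0 <= p * (k.+1%:R * a ^+ k * p) by rewrite !mulr_ge0 ?exprn_ge0.
rewrite [a ^+ k.+2]exprS [a ^+ k.+1]exprS -[k.+2%:R]natr1.
set x := a ^+ k; set m := k.+1%:R; lra.
Qed.

(** This combines [1 - p <= expR (- p)] with the first two terms of the binomial expansion of
    [(a + p) ^+ k]. *)
Lemma pois_ge a p k : 0 <= a -> 0 <= p -> p <= 1 ->
  (1 - p) * pois a k + (if k is j.+1 then p * (1 - p) * pois a j else 0) <=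
  pois (a + p) k.
Proof.
move=> a0 p0 p1.
have ep : 1 - p <= expR (- p) by apply: expR_ge1Dx.
rewrite /pois opprD expRD; have ea := expR_ge0 (- a).
case: k => [|k].
  rewrite addr0 !expr0 fact0 divr1 !mulr1 mulrC; exact: ler_wpM2l.
have H := exprD_ge k a0 p0.
have f0 : 0 < k.+1`!%:R :> R by rewrite ltr0n fact_gt0.
have -> : a ^+ k / k`!%:R = k.+1%:R * a ^+ k / k.+1`!%:R.
  by rewrite factS natrM invfM mulrACA mulfV ?mul1r ?pnatr_eq0.
apply: (@le_trans _ _ (expR (- a) * (1 - p) * ((a + p) ^+ k.+1 / k.+1`!%:R))).
  have := ler_wpM2r (_ : 0 <= k.+1`!%:R^-1) H; rewrite invr_ge0 => /(_ (ltW f0)) H'.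
  have w0 : 0 <= expR (- a) * (1 - p) by rewrite mulr_ge0 // subr_ge0.
  have := ler_wpM2l w0 H'; set x := k.+1`!%:R^-1; lra.
apply: ler_wpM2r; last by apply: ler_wpM2l.
by rewrite divr_ge0 // exprn_ge0 // addr_ge0.
Qed.

Lemma unit_shift f : unit_valued f -> unit_valued (fun k => f k.+1).
Proof. by move=> f01 k. Qed.

Lemma PE_add_ge a p f : 0 <= a -> 0 <= p -> p <= 1 -> unit_valued f ->
  (1 - p) * PE a f + p * (1 - p) * PE a (fun k => f k.+1) <= PE (a + p) f.
Proof.
move=> a0 p0 p1 f01.
have := PE_cvg a0 f01; rewrite -cvg_shiftS => cf; have cf' := PE_cvg a0 (unit_shift f01).
have := PE_cvg (addr_ge0 a0 p0) f01; rewrite -cvg_shiftS => cp.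
apply: (ler_cvg_to _ cp); first by apply: cvgD; apply: cvgMr; [exact: cf|exact: cf'].
apply: nearW => n; rewrite fctE /= /series /= !mulr_sumr /=.
have -> : \sum_(0 <= k < n) p * (1 - p) * (pois a k * f k.+1) =
  \sum_(0 <= k < n.+1) (if k is j.+1 then p * (1 - p) * pois a j else 0) * f k.
  by rewrite big_nat_recl //= mul0r add0r; apply: eq_bigr => k _; rewrite !mulrA.
rewrite -big_split /=; apply: ler_sum => k _; rewrite mulrA -mulrDl.
by apply: ler_wpM2r (pois_ge _ a0 p0 p1); case/andP: (f01 k).
Qed.

Lemma unit_conv p f g : 0 <= p -> p <= 1 -> unit_valued f -> unit_valued g ->
  unit_valued (fun k => (1 - p) * f k + p * g k).
Proof.
move=> p0 p1 f01 g01 k; case/andP: (f01 k) => f0 f1; case/andP: (g01 k) => g0 g1.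
by apply/andP; split; nra.
Qed.

(* The Poisson law with parameter a + p dominates (1 - p) times the law with
   parameter a plus p (1 - p) times its shift, a measure of mass 1 - p^2. *)
Lemma PE_step a p f : 0 <= a -> 0 <= p -> p <= 1 -> unit_valued f ->
  `|PE (a + p) f - PE a (fun k => (1 - p) * f k + p * f k.+1)| <= p ^+ 2.
Proof.
move=> a0 p0 p1 f01; rewrite PE_lin //.
have u1 : unit_valued (fun=> 1) by move=> k; rewrite ler01 lexx.
(* The domination is applied to [f] and to [1 - f]; the latter gives the reverse inequality up to
   the missing mass [p ^+ 2]. *)
have f01' : unit_valued (fun k => 1 * 1 + (-1) * f k).
  by move=> k; case/andP: (f01 k); lra.
have H1 := PE_add_ge a0 p0 p1 f01.
have H2 := PE_add_ge a0 p0 p1 f01'.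
have compl b g : 0 <= b -> unit_valued g ->
    PE b (fun k => 1 * 1 + (-1) * g k) = 1 - PE b g.
  by move=> b0 g01; rewrite (PE_lin _ _ _ u1) // PE_cst mulr1 mulN1r.
rewrite !compl ?addr_ge0 // in H2.
have := PE_unit a0 (unit_shift f01); case/andP => s0 s1.
set x := PE a (fun k => f k.+1) in H1 H2 s0 s1 *.
by rewrite ler_norml; apply/andP; split; nra.
Qed.

Lemma PE_lip a b f : 0 <= a -> 0 <= b -> unit_valued f ->
  `|PE a f - PE b f| <= 2 * `|a - b|.
Proof.
move=> a0 b0 f01.
suff H c p : 0 <= c -> 0 <= p -> `|PE (c + p) f - PE c f| <= 2 * p.
  case: (lerP a b) => ab.
    have -> : b = a + (b - a) by rewrite addrC subrK.
    by rewrite distrC (le_trans (H _ _ _ _)) ?subr_ge0 //; lra.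
  have -> : a = b + (a - b) by rewrite addrC subrK.
  by rewrite (le_trans (H _ _ _ _)) ?subr_ge0 ?(ltW ab) //; lra.
move=> c0 p0; have /andP[x0 x1] := PE_unit (addr_ge0 c0 p0) f01.
have /andP[y0 y1] := PE_unit c0 f01.
(* For [p > 1] the bound is trivial, as both expectations lie in the unit interval; otherwise the
   difference is at most [p + p ^+ 2 <= 2 * p]. *)
have [p1|p1] := lerP p 1; last by rewrite ler_norml; lra.
have := PE_step c0 p0 p1 f01; rewrite PE_lin //.
have /andP[s0 s1] := PE_unit c0 (unit_shift f01).
rewrite !ler_norml => /andP[H1 H2]; apply/andP; split; nra.
Qed.

Lemma PE_at0 a : PE a (fun k => (k == 0)%N%:R) = expR (- a).
Proof.
apply/cvg_lim => //; rewrite -cvg_shiftS; apply: cvg_near_cst.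
apply: nearW => n; rewrite /= /series /= big_nat_recl //= big1 ?addr0.
  by rewrite /pois expr0 fact0 divr1 !mulr1.
by move=> k _; rewrite mulr0.
Qed.

Lemma PE0 f : unit_valued f -> PE 0 f = f 0%N.
Proof.
move=> f01; apply/cvg_lim => //; rewrite -cvg_shiftS; apply: cvg_near_cst.
apply: nearW => n; rewrite /= /series /= big_nat_recl //= big1 ?addr0.
  by rewrite /pois oppr0 expR0 expr0 fact0 divr1 !mul1r.
by move=> k _; rewrite /pois exprS mul0r mul0r mulr0 mul0r.
Qed.

Definition unit_valued3 (f : nat -> nat -> nat -> R) := forall x y z, 0 <= f x y z <= 1.

Definition PE3 (a1 a2 b : R) (f : nat -> nat -> nat -> R) : R :=
  PE a1 (fun x => PE a2 (fun y => PE b (f x y))).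

Implicit Types F G : nat -> nat -> nat -> R.

Lemma PE3_inner_unit a2 b F : 0 <= a2 -> 0 <= b -> unit_valued3 F ->
  unit_valued (fun x => PE a2 (fun y => PE b (F x y))).
Proof. by move=> a0 b0 F01 x; apply: PE_unit => // y; apply: PE_unit. Qed.

Lemma PE3_unit a1 a2 b F : 0 <= a1 -> 0 <= a2 -> 0 <= b -> unit_valued3 F ->
  0 <= PE3 a1 a2 b F <= 1.
Proof. by move=> a0 a0' b0 F01; apply: PE_unit => //; apply: PE3_inner_unit. Qed.

Lemma PE3_contract a1 a2 b F G c : 0 <= a1 -> 0 <= a2 -> 0 <= b ->
  unit_valued3 F -> unit_valued3 G -> (forall x y z, `|F x y z - G x y z| <= c) ->
  `|PE3 a1 a2 b F - PE3 a1 a2 b G| <= c.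
Proof.
move=> a0 a0' b0 F01 G01 FG.
apply: PE_contract => //; [exact: PE3_inner_unit|exact: PE3_inner_unit|] => x.
apply: PE_contract => // [y|y|y]; [exact: PE_unit|exact: PE_unit|].
exact: PE_contract.
Qed.

Lemma PE3_lip a1 a2 b a1' a2' b' F : 0 <= a1 -> 0 <= a2 -> 0 <= b ->
  0 <= a1' -> 0 <= a2' -> 0 <= b' -> unit_valued3 F ->
  `|PE3 a1 a2 b F - PE3 a1' a2' b' F| <=
  2 * (`|a1 - a1'| + `|a2 - a2'| + `|b - b'|).
Proof.
move=> h1 h2 h3 h1' h2' h3' F01.
have A1 : `|PE3 a1 a2 b F - PE3 a1' a2 b F| <= 2 * `|a1 - a1'|.
  by apply: PE_lip => //; apply: PE3_inner_unit.
have A2 : `|PE3 a1' a2 b F - PE3 a1' a2' b F| <= 2 * `|a2 - a2'|.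
  apply: PE_contract => //; [exact: PE3_inner_unit|exact: PE3_inner_unit|] => x.
  by apply: PE_lip => // y; apply: PE_unit.
have A3 : `|PE3 a1' a2' b F - PE3 a1' a2' b' F| <= 2 * `|b - b'|.
  apply: PE_contract => //; [exact: PE3_inner_unit|exact: PE3_inner_unit|] => x.
  apply: PE_contract => // [y|y|y]; [exact: PE_unit|exact: PE_unit|].
  exact: PE_lip.
apply: le_trans (dist_trans A1 (dist_trans A2 A3)) _.
by rewrite !mulrDr addrA.
Qed.

Definition step1 p F x y z := (1 - p) * F x y z + p * F x.+1 y z.
Definition step2 p F x y z := (1 - p) * F x y z + p * F x y.+1 z.
Definition step3 p F x y z := (1 - p) * F x y z + p * F x y z.+1.

Lemma step1_unit p F : 0 <= p -> p <= 1 -> unit_valued3 F -> unit_valued3 (step1 p F).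
Proof. by move=> p0 p1 F01 x y z; apply: (unit_conv (f := F x y) (g := F x.+1 y)). Qed.

Lemma step2_unit p F : 0 <= p -> p <= 1 -> unit_valued3 F -> unit_valued3 (step2 p F).
Proof. by move=> p0 p1 F01 x y z; apply: (unit_conv (f := F x y) (g := F x y.+1)). Qed.

Lemma step3_unit p F : 0 <= p -> p <= 1 -> unit_valued3 F -> unit_valued3 (step3 p F).
Proof. by move=> p0 p1 F01 x y z; apply: (unit_conv (f := F x y) (g := fun z => F x y z.+1)). Qed.

Lemma PE3_step1 a1 a2 b p F : 0 <= a1 -> 0 <= a2 -> 0 <= b -> 0 <= p -> p <= 1 ->
  unit_valued3 F -> `|PE3 (a1 + p) a2 b F - PE3 a1 a2 b (step1 p F)| <= p ^+ 2.
Proof.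
move=> h1 h2 h3 p0 p1 F01.
have := PE_step h1 p0 p1 (PE3_inner_unit h2 h3 F01).
rewrite /PE3 [X in `|_ - X|](_ : _ = PE a1 (fun x => PE a2 (fun y => PE b (step1 p F x y)))) //.
apply: eq_PE => x.
rewrite -PE_lin //; [|by move=> y; apply: PE_unit..].
by apply: eq_PE => y; rewrite -PE_lin.
Qed.

Lemma PE3_step2 a1 a2 b p F : 0 <= a1 -> 0 <= a2 -> 0 <= b -> 0 <= p -> p <= 1 ->
  unit_valued3 F -> `|PE3 a1 (a2 + p) b F - PE3 a1 a2 b (step2 p F)| <= p ^+ 2.
Proof.
move=> h1 h2 h3 p0 p1 F01.
apply: PE_contract => // [||x].
- by apply: PE3_inner_unit => //; apply: addr_ge0.
- by apply: PE3_inner_unit => //; apply: step2_unit.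
have Fy : unit_valued (fun y => PE b (F x y)) by move=> y; apply: PE_unit.
have := PE_step h2 p0 p1 Fy.
rewrite [X in `|_ - X|](_ : _ = PE a2 (fun y => PE b (step2 p F x y))) //.
apply: eq_PE => y.
by rewrite -PE_lin.
Qed.

Lemma PE3_step3 a1 a2 b p F : 0 <= a1 -> 0 <= a2 -> 0 <= b -> 0 <= p -> p <= 1 ->
  unit_valued3 F -> `|PE3 a1 a2 (b + p) F - PE3 a1 a2 b (step3 p F)| <= p ^+ 2.
Proof.
move=> h1 h2 h3 p0 p1 F01; have bp := addr_ge0 h3 p0.
have s01 := step3_unit p0 p1 F01.
apply: PE_contract => // [||x]; [exact: PE3_inner_unit|exact: PE3_inner_unit|].
apply: PE_contract => // [y|y|y]; [exact: PE_unit|exact: PE_unit|].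
exact: PE_step.
Qed.

(** The average of [F] over one potential parent, which raises at most one of the counts: private to
    the first graph, private to the second, common. *)
Definition jump p1 p2 p3 F x y z :=
  (1 - p1 - p2 - p3) * F x y z + p1 * F x.+1 y z + p2 * F x y.+1 z + p3 * F x y z.+1.

Lemma jump_unit p1 p2 p3 F : 0 <= p1 -> 0 <= p2 -> 0 <= p3 -> p1 + p2 + p3 <= 1 ->
  unit_valued3 F -> unit_valued3 (jump p1 p2 p3 F).
Proof.
move=> h1 h2 h3 hs F01 x y z; rewrite /jump.
case/andP: (F01 x y z) => A0 A1; case/andP: (F01 x.+1 y z) => B0 B1.
case/andP: (F01 x y.+1 z) => C0 C1; case/andP: (F01 x y z.+1) => D0 D1.
have h0 : 0 <= 1 - p1 - p2 - p3 by lra.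
apply/andP; split; first by rewrite !addr_ge0 ?mulr_ge0.
have := ler_wpM2l h0 A1; have := ler_wpM2l h1 B1; have := ler_wpM2l h2 C1.
have := ler_wpM2l h3 D1; lra.
Qed.

(** Three independent steps differ from one exclusive jump only when two of them occur. The four
    resulting terms are mixed differences, bounded by 2, times products at most [q ^+ 2]. The
    constant, plus 3 for the single steps, gives the 16 of [PE3_jump]. *)
Lemma steps_jump_dist p1 p2 p3 q F x y z : 0 <= p1 -> 0 <= p2 -> 0 <= p3 ->
  p1 <= q -> p2 <= q -> p3 <= q -> p3 <= 1 -> unit_valued3 F ->
  `|step3 p3 (step2 p2 (step1 p1 F)) x y z - jump p1 p2 p3 F x y z| <= 13 * q ^+ 2.
Proof.
move=> p10 p20 p30 p1q p2q p3q p31 F01.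
have -> : step3 p3 (step2 p2 (step1 p1 F)) x y z - jump p1 p2 p3 F x y z =
  p1 * p2 * (1 - p3) * (F x y z - F x.+1 y z - F x y.+1 z + F x.+1 y.+1 z) +
  p1 * p2 * p3 * (F x y z.+1 - F x.+1 y z.+1 - F x y.+1 z.+1 + F x.+1 y.+1 z.+1) +
  p3 * p1 * (F x y z - F x.+1 y z - F x y z.+1 + F x.+1 y z.+1) +
  p3 * p2 * (F x y z - F x y.+1 z - F x y z.+1 + F x y.+1 z.+1).
  by rewrite /step3 /step2 /step1 /jump; ring.
have F4 u v w t u' v' w' t' u'' v'' w'' t'' : `|F u u' u'' - F v v' v'' - F w w' w'' + F t t' t''| <= 2.
  by have := F01 u u' u''; have := F01 v v' v''; have := F01 w w' w''; have := F01 t t' t''; rewrite ler_norml; lra.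
have bd c d : 0 <= c -> c <= q ^+ 2 -> `|d| <= 2 -> `|c * d| <= 2 * q ^+ 2.
  by move=> c0 cq d2; rewrite normrM ger0_norm // mulrC; apply: ler_pM.
have pq c d : 0 <= c -> c <= q -> 0 <= d -> d <= q -> c * d <= q ^+ 2.
  by move=> *; rewrite expr2; apply: ler_pM.
have t1 : p1 * p2 * (1 - p3) <= q ^+ 2.
  by apply: le_trans (pq _ _ p10 p1q p20 p2q); rewrite ler_piMr ?mulr_ge0 // gerBl.
have t2 : p1 * p2 * p3 <= q ^+ 2.
  by apply: le_trans (pq _ _ p10 p1q p20 p2q); rewrite ler_piMr ?mulr_ge0.
have u1 : 0 <= p1 * p2 * (1 - p3) by rewrite !mulr_ge0 // subr_ge0.
have u2 : 0 <= p1 * p2 * p3 by rewrite !mulr_ge0.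
have B1 := bd _ _ u1 t1 (F4 x x.+1 x x.+1 y y y.+1 y.+1 z z z z).
have B2 := bd _ _ u2 t2 (F4 x x.+1 x x.+1 y y y.+1 y.+1 z.+1 z.+1 z.+1 z.+1).
have B3 := bd _ _ (mulr_ge0 p30 p10) (pq _ _ p30 p3q p10 p1q) (F4 x x.+1 x x.+1 y y y y z z z.+1 z.+1).
have B4 := bd _ _ (mulr_ge0 p30 p20) (pq _ _ p30 p3q p20 p2q) (F4 x x x x y y.+1 y y.+1 z z z.+1 z.+1).
have q2 : 0 <= q ^+ 2 by apply: sqr_ge0.
apply: le_trans (ler_normD _ _) _; apply: le_trans (lerD (ler_normD _ _) (lexx _)) _.
apply: le_trans (lerD (lerD (ler_normD _ _) (lexx _)) (lexx _)) _.
by apply: le_trans (lerD (lerD (lerD B1 B2) B3) B4) _; clear -q2; lra.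
Qed.

Lemma PE3_jump a1 a2 b p1 p2 p3 q F : 0 <= a1 -> 0 <= a2 -> 0 <= b ->
  0 <= p1 -> 0 <= p2 -> 0 <= p3 -> p1 <= q -> p2 <= q -> p3 <= q ->
  p1 + p2 + p3 <= 1 -> unit_valued3 F ->
  `|PE3 (a1 + p1) (a2 + p2) (b + p3) F - PE3 a1 a2 b (jump p1 p2 p3 F)| <=
  16 * q ^+ 2.
Proof.
move=> h1 h2 h3 p10 p20 p30 p1q p2q p3q ps F01.
have p11 : p1 <= 1 by lra.
have p21 : p2 <= 1 by lra.
have p31 : p3 <= 1 by lra.
have q0 : 0 <= q by lra.
have b2 : 0 <= a2 + p2 by lra.
have b3 : 0 <= b + p3 by lra.
have G1 := step1_unit p10 p11 F01.
have G2 := step2_unit p20 p21 G1.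
have G3 := step3_unit p30 p31 G2.
have GT := jump_unit p10 p20 p30 ps F01.
have A1 := PE3_step1 h1 b2 b3 p10 p11 F01.
have A2 := PE3_step2 h1 h2 b3 p20 p21 G1.
have A3 := PE3_step3 h1 h2 h3 p30 p31 G2.
have s1 : p1 ^+ 2 <= q ^+ 2 by rewrite lerXn2r ?nnegrE.
have s2 : p2 ^+ 2 <= q ^+ 2 by rewrite lerXn2r ?nnegrE.
have s3 : p3 ^+ 2 <= q ^+ 2 by rewrite lerXn2r ?nnegrE.
have A4 : `|PE3 a1 a2 b (step3 p3 (step2 p2 (step1 p1 F))) -
            PE3 a1 a2 b (jump p1 p2 p3 F)| <= 13 * q ^+ 2.
  by apply: PE3_contract => // x y z; apply: steps_jump_dist.
apply: le_trans (dist_trans A1 (dist_trans A2 (dist_trans A3 A4))) _.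
clear -s1 s2 s3; lra.
Qed.

End PoissonExpectation.

(** * Poisson approximation of the links of a vertex *)

Section Lindeberg.
Context {R : realType} {n : nat} {T : finType} (nu : T -> R).
Hypothesis nuP : is_pmf nu.
Notation V := (vertex n).
Notation config := {ffun vpair n -> T}.
Notation E := (@Ex R (vpair n) T nu).
Context (e1 e2 : T -> bool) (q ro : R).
Let e12 t := e1 t && e2 t.
Hypothesis pr1 : pr nu e1 = q.
Hypothesis pr2 : pr nu e2 = q.
Hypothesis pr12 : pr nu e12 = q * ro.
Implicit Types (g : config) (u v w : V) (F : nat -> nat -> nat -> R).

Let q_ge0 : 0 <= q. Proof. by rewrite -pr1 pr_ge0. Qed.

Lemma eq_pr (c c' : T -> bool) : c =1 c' -> pr nu c = pr nu c'.
Proof. by move=> cc'; apply: eq_bigr => t _; rewrite cc'. Qed.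

Lemma pr_le (c c' : T -> bool) : (forall t, c t -> c' t) -> pr nu c <= pr nu c'.
Proof.
case: nuP => nu0 _ cc'; apply: ler_sum => t _; apply: ler_wpM2l => //.
by rewrite ler_nat; case: (c t) (cc' t) => // ->.
Qed.

Lemma Ex1_jump (w1 w2 w3 : T -> bool) F x y z :
  (forall t, (w1 t + w2 t + w3 t <= 1)%N) ->
  Ex1 nu (fun t => F (w1 t + x)%N (w2 t + y)%N (w3 t + z)%N) =
  jump (pr nu w1) (pr nu w2) (pr nu w3) F x y z.
Proof.
move=> dis; have [_ nu1] := nuP.
have -> : jump (pr nu w1) (pr nu w2) (pr nu w3) F x y z =
  \sum_t nu t * ((1 - (w1 t)%:R - (w2 t)%:R - (w3 t)%:R) * F x y z +
     (w1 t)%:R * F x.+1 y z + (w2 t)%:R * F x y.+1 z + (w3 t)%:R * F x y z.+1).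
  rewrite /jump /pr /Ex1 -{1}nu1 -!sumrB !mulr_suml -!big_split /=.
  by apply: eq_bigr => t _; ring.
apply: eq_bigr => t _; congr (_ * _); have := dis t.
by case: (w1 t); case: (w2 t); case: (w3 t) => //= _;
  rewrite ?add0n ?add1n ?subr0 ?subrr ?mul1r ?mul0r ?addr0 ?add0r.
Qed.

Lemma pr3_le1 (w1 w2 w3 : T -> bool) :
  (forall t, (w1 t + w2 t + w3 t <= 1)%N) -> pr nu w1 + pr nu w2 + pr nu w3 <= 1.
Proof.
move=> dis; have [nu0 nu1] := nuP; rewrite /pr /Ex1 -!big_split /= -[leRHS]nu1.
apply: ler_sum => t _; rewrite -!mulrDr -!natrD ler_piMr //.
by rewrite lern1.
Qed.

Section Counts.
Context (v : V) (L1 L2 : {set V}).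

Let w10 u t := (u \in L1) && e1 t && ~~ ((u \in L2) && e2 t).
Let w01 u t := (u \in L2) && e2 t && ~~ ((u \in L1) && e1 t).
Let w11 u t := (u \in L1) && e1 t && ((u \in L2) && e2 t).

Let cnt (w : bool -> bool -> bool) s g :=
  count (fun u => w ((u \in L1) && graph e1 g u v) ((u \in L2) && graph e2 g u v)) s.

Let c10 := cnt (fun b1 b2 => b1 && ~~ b2).
Let c01 := cnt (fun b1 b2 => b2 && ~~ b1).
Let c11 := cnt andb.

Let dis u t : (w10 u t + w01 u t + w11 u t <= 1)%N.
Proof. by rewrite /w10 /w01 /w11; case: ((u \in L1) && _); case: ((u \in L2) && _). Qed.

Let pr_w11 u : pr nu (w11 u) = q * ro * (u \in L1 :&: L2)%:R.
Proof.
rewrite inE /pr /Ex1 /w11; case: (u \in L1); case: (u \in L2) => /=;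
  rewrite ?mulr1 ?mulr0; last 3 first.
- by rewrite big1 // => t _; rewrite andbF mulr0.
- by rewrite big1 // => t _; rewrite mulr0.
- by rewrite big1 // => t _; rewrite mulr0.
by rewrite -pr12.
Qed.

Let pr_split (b : bool) (w w' : T -> bool) (c : T -> bool) :
  (forall t, (w t + w' t)%N = (b && c t)) -> pr nu w + pr nu w' = pr nu c * b%:R.
Proof.
move=> h; rewrite /pr /Ex1 -big_split mulr_suml /=; apply: eq_bigr => t _.
by rewrite -mulrDr -natrD h -mulrA -natrM mulnb andbC.
Qed.

Let pr_w10 u : pr nu (w10 u) = q * (u \in L1)%:R - q * ro * (u \in L1 :&: L2)%:R.
Proof.
rewrite -pr_w11 -pr1 -(@pr_split (u \in L1) (w10 u) (w11 u)) ?addrK // => t.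
by rewrite /w10 /w11; case: ((u \in L1) && _); case: ((u \in L2) && _).
Qed.

Let pr_w01 u : pr nu (w01 u) = q * (u \in L2)%:R - q * ro * (u \in L1 :&: L2)%:R.
Proof.
rewrite -pr_w11 -pr2 -(@pr_split (u \in L2) (w01 u) (w11 u)) ?addrK // => t.
by rewrite /w01 /w11; case: ((u \in L1) && _); case: ((u \in L2) && _).
Qed.

(** The induction runs over all [F]: averaging over the edge from [u] to [v] turns [F] into the
    unit-valued [J], to which the hypothesis applies, and trading this jump for an increase of the
    Poisson rates costs [16 * q ^+ 2]. *)
Lemma lindeberg_seq F s : unit_valued3 F -> uniq s -> v \notin s ->
  `|E (fun g => F (c10 s g) (c01 s g) (c11 s g)) -
    PE3 (\sum_(u <- s) pr nu (w10 u)) (\sum_(u <- s) pr nu (w01 u))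
        (\sum_(u <- s) pr nu (w11 u)) F| <= (size s)%:R * (16 * q ^+ 2).
Proof.
elim: s F => [|u s IH] F F01.
  move=> _ _; rewrite !big_nil mul0r.
  have -> : PE3 0 0 0 F = F 0%N 0%N 0%N.
    have Fz x y : PE 0 (F x y) = F x y 0%N by apply: PE0.
    have Fy x : PE 0 (fun y => PE 0 (F x y)) = F x 0%N 0%N.
      by under eq_PE => y do rewrite Fz; apply: PE0 => y.
    by rewrite /PE3; under eq_PE => x do rewrite Fy; apply: PE0 => x.
  have -> : E (fun g => F (c10 [::] g) (c01 [::] g) (c11 [::] g)) = F 0%N 0%N 0%N.
    by rewrite -[RHS](@Ex_cst _ (vpair n) _ _ nuP); apply: eq_Ex => g.
  by rewrite subrr normr0.
rewrite /= in_cons negb_or => /andP[us uniqs] /andP[vu vs].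
have uv : u != v by rewrite eq_sym.
have [i iE iP] := adj_edge uv.
have sum_ge0 (w : V -> T -> bool) : 0 <= \sum_(u <- s) pr nu (w u).
  by apply: sumr_ge0 => u' _; apply: pr_ge0.
pose J := jump (pr nu (w10 u)) (pr nu (w01 u)) (pr nu (w11 u)) F.
have le1 := pr3_le1 (dis u).
have J01 : unit_valued3 J by apply: jump_unit => //; apply: pr_ge0.
have -> : E (fun g => F (c10 (u :: s) g) (c01 (u :: s) g) (c11 (u :: s) g)) =
          E (fun g => J (c10 s g) (c01 s g) (c11 s g)).
  rewrite (Ex_mix nuP (pred1 i)); apply: eq_Ex => g.
  have cs (w : bool -> bool -> bool) g' : cnt w s (mix (pred1 i) g g') = cnt w s g.
    apply: eq_in_count => u' u's.
    have u'u : u' != u by apply: contraNneq us => <-.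
    have u'v : u' != v by apply: contraNneq vs => <-.
    have [j jE jP] := adj_edge u'v.
    suff ji : j != i by rewrite /graph !jP !ffunE /= (negbTE ji).
    apply: contraNneq u'u => ji.
    have : u' \in val j by rewrite jE set21.
    by rewrite ji iE !inE (negbTE u'v) orbF.
  have consE (w : bool -> bool -> bool) g' : cnt w (u :: s) g' =
    (w ((u \in L1) && graph e1 g' u v) ((u \in L2) && graph e2 g' u v) + cnt w s g')%N.
    by [].
  rewrite /J -(Ex1_jump F _ _ _ (dis u)) -(Ex1_coord i); last by case: nuP.
  apply: eq_Ex => g'; rewrite /c10 /c01 /c11 !consE !cs.
  by rewrite /graph !iP !ffunE /= eqxx.
have jmp := PE3_jump (sum_ge0 w10) (sum_ge0 w01) (sum_ge0 w11) (pr_ge0 nuP (w10 u))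
  (pr_ge0 nuP (w01 u)) (pr_ge0 nuP (w11 u)) _ _ _ le1 F01.
rewrite !big_cons ![pr nu _ + _]addrC.
have dst := IH J J01 uniqs vs.
have jmp' := jmp q; rewrite distrC in jmp'.
apply: le_trans (dist_trans dst (jmp' _ _ _)) _.
- by rewrite -pr1; apply: pr_le => t /andP[/andP[]].
- by rewrite -pr2; apply: pr_le => t /andP[/andP[]].
- by rewrite -pr1; apply: pr_le => t /andP[/andP[]].
by rewrite -[X in _ <= X * _]natr1 [leRHS]mulrDl mul1r.
Qed.

Definition link_stat F g : R :=
  let A := link (graph e1 g) v L1 in let B := link (graph e2 g) v L2 in
  F #|A :\: B| #|B :\: A| #|A :&: B|.

Lemma link_stat_unit F g : unit_valued3 F -> 0 <= link_stat F g <= 1.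
Proof. by apply. Qed.

Lemma lindeberg F : unit_valued3 F -> v \notin L1 -> v \notin L2 ->
  `|E (link_stat F) - PE3 (q * #|L1|%:R - q * ro * #|L1 :&: L2|%:R)
                          (q * #|L2|%:R - q * ro * #|L1 :&: L2|%:R)
                          (q * ro * #|L1 :&: L2|%:R) F| <=
  16 * q ^+ 2 * (#|L1|%:R + #|L2|%:R).
Proof.
move=> F01 vL1 vL2; pose s := enum (L1 :|: L2).
have vs : v \notin s by rewrite mem_enum inE negb_or vL1.
have cntE (w : bool -> bool -> bool) (B : {set V}) g : w false false = false ->
    (forall u, (u \in B) = w (u \in link (graph e1 g) v L1) (u \in link (graph e2 g) v L2)) ->
    cnt w s g = #|B|.
  move=> w0 BE; rewrite /cnt -size_filter cardE; apply: perm_size.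
  apply: uniq_perm; [exact/filter_uniq/enum_uniq|exact: enum_uniq|move=> u].
  rewrite mem_filter !mem_enum BE !inE.
  by case: (u \in L1); case: (u \in L2); rewrite ?andbT ?w0.
have := lindeberg_seq F01 (enum_uniq _) vs.
have -> : E (fun g => F (c10 s g) (c01 s g) (c11 s g)) = E (link_stat F).
  apply: eq_Ex => g; rewrite /link_stat /c10 /c01 /c11.
  congr F; apply: cntE => // u; rewrite !inE ?andbb //.
  - by rewrite andbC.
  - by rewrite andbC.
have sumE (B : {set V}) : B \subset L1 :|: L2 -> \sum_(u <- s) (u \in B)%:R = #|B|%:R :> R.
  move=> BL; rewrite /s big_enum /= -sum1_card natr_sum [RHS]big_mkcond [LHS]big_mkcond /=.
  apply: eq_bigr => u _; have := subsetP BL u; case: (u \in B) => [-> //|_].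
  by case: ifP.
have S1 := sumE _ (subsetUl L1 L2); have S2 := sumE _ (subsetUr L1 L2).
have S12 := sumE _ (subset_trans (subsetIl L1 L2) (subsetUl L1 L2)).
rewrite (eq_bigr _ (fun u _ => pr_w10 u)) (eq_bigr _ (fun u _ => pr_w01 u)).
rewrite (eq_bigr _ (fun u _ => pr_w11 u)) !sumrB -!mulr_sumr S1 S2 S12.
move=> /le_trans; apply; rewrite mulrC; apply: ler_wpM2l; first by rewrite mulr_ge0 ?sqr_ge0.
by rewrite -natrD ler_nat -cardE leq_card_setU.
Qed.

End Counts.
End Lindeberg.

(** * Concentration of link statistics *)

Lemma link_stat_on {R : realType} {n : nat} {T : finType} (e1 e2 : T -> bool)
    (v : vertex n) (L1 L2 Z : {set vertex n}) (F : nat -> nat -> nat -> R) :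
  v \in Z -> depends_on (touch Z) (link_stat e1 e2 v L1 L2 F).
Proof. by move=> vZ g g'; rewrite /link_stat !link_on. Qed.

Lemma link_stat_off {R : realType} {n : nat} {T : finType} (e1 e2 : T -> bool)
    (v : vertex n) (L1 L2 Z : {set vertex n}) (F : nat -> nat -> nat -> R) :
  v \notin Z -> [disjoint L1 & Z] -> [disjoint L2 & Z] ->
  depends_off (touch Z) (link_stat e1 e2 v L1 L2 F).
Proof. by move=> vZ L1Z L2Z g g'; rewrite /link_stat !link_off. Qed.

Lemma mul_unit_le (R : realFieldType) (x y t : R) : 0 <= x <= 1 -> 0 <= y <= 1 ->
  0 <= t <= 1 -> x * y <= t ^+ 2 + `|x - t| + `|y - t|.
Proof.
move=> /andP[x0 x1] /andP[y0 y1] /andP[t0 t1].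
have h1 := ler_norm (x - t); have h2 := ler_norm (y - t).
have h3 := normr_ge0 (x - t); have h4 := normr_ge0 (y - t).
have a1 : (x - t) * y <= `|x - t|.
  apply: le_trans (ler_wpM2r y0 h1) _; exact: ler_piMr.
have a2 : t * (y - t) <= `|y - t|.
  apply: le_trans (ler_wpM2l t0 h2) _; exact: ler_piMl.
lra.
Qed.

Lemma second_moment_arith (R : realFieldType) (m2 m1 t i d x : R) :
  m2 <= i + (t ^+ 2 + 2 * d) -> 2 * t * (t - d - 4 * x) <= m1 ->
  0 <= t -> t <= 1 -> 0 <= d -> 0 <= x -> m2 - m1 + t ^+ 2 <= i + 4 * d + 8 * x.
Proof.
move=> h2 h1 t0 t1 d0 x0.
have : t * d <= 1 * d by apply: ler_wpM2r.
have : t * x <= 1 * x by apply: ler_wpM2r.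
lra.
Qed.

Section Concentration.
Context {R : realType} {n : nat} {T : finType} (nu : T -> R).
Hypothesis nuP : is_pmf nu.
Hypothesis n_gt0 : (0 < n)%N.
Notation V := (vertex n).
Notation config := {ffun vpair n -> T}.
Notation E := (@Ex R (vpair n) T nu).
Context (r : V) (e1 e2 : T -> bool) (q ro : R).
Hypothesis pr1 : pr nu e1 = q.
Hypothesis pr2 : pr nu e2 = q.
Hypothesis pr12 : pr nu (fun t => e1 t && e2 t) = q * ro.
Hypothesis ro_ge0 : 0 <= ro.
Hypothesis ro_le1 : ro <= 1.
Let D := n%:R * q.
Hypothesis D_ge2 : 2 <= D.
Context (k : nat) (a b delta : R).
Hypothesis a_ge0 : 0 <= a.
Hypothesis b_ge0 : 0 <= b.
Implicit Types (g : config) (u v w : V) (X Z : {set V}).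

Local Notation lay e g X := (layer r (graph e g) X k).
Local Notation bal e g X := (gball r (graph e g) X k).

Let q_ge0 : 0 <= q. Proof. by rewrite -pr1 pr_ge0. Qed.

(** Bounds the distance from [tau] of the expected link statistic given the layers: the Lindeberg
    error, then the Lipschitz cost of replacing the random rates. The common rate also enters both
    private rates, whence the factor 3. *)
Definition link_error Z g : R :=
  16 * q ^+ 2 * (#|lay e1 g Z|%:R + #|lay e2 g Z|%:R) +
  2 * (`|q * #|lay e1 g Z|%:R - (a + b)| + `|q * #|lay e2 g Z|%:R - (a + b)| +
       3 * `|q * ro * #|common r e1 e2 k Z g|%:R - b|).

Hypothesis error_le : forall Z, r \notin Z -> (#|Z| <= 3)%N ->
  E (link_error Z) <= delta.

Context (F : nat -> nat -> nat -> R).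
Hypothesis F01 : unit_valued3 F.
Let tau := PE3 a a b F.

Let tau01 : 0 <= tau <= 1. Proof. exact: PE3_unit. Qed.

Let inner v Z g := E (link_stat e1 e2 v (lay e1 g Z) (lay e2 g Z) F).

Definition layer_stat v Z g := link_stat e1 e2 v (lay e1 g Z) (lay e2 g Z) F g.

Let inner01 v Z g : 0 <= inner v Z g <= 1.
Proof.
apply/andP; split; first by apply: Ex_ge0 => // g'; case/andP: (link_stat_unit e1 e2 v (lay e1 g Z) (lay e2 g Z) g' F01).
by apply: Ex_le_cst => // g'; case/andP: (link_stat_unit e1 e2 v (lay e1 g Z) (lay e2 g Z) g' F01).
Qed.

Lemma layer_stat01 v Z g : 0 <= layer_stat v Z g <= 1.
Proof. exact: link_stat_unit. Qed.

Let inner_dist v Z g : r \notin Z -> v \in Z -> `|inner v Z g - tau| <= link_error Z g.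
Proof.
move=> rZ vZ.
have vL e : v \notin lay e g Z.
  by apply: contraTN vZ => /layer_avoid; apply.
have lin := lindeberg nuP pr1 pr2 pr12 F01 (vL e1) (vL e2).
rewrite -/(inner v Z g) -/(common r e1 e2 k Z g) in lin.
set s1 := #|lay e1 g Z|%:R in lin *; set s2 := #|lay e2 g Z|%:R in lin *.
set c := #|common r e1 e2 k Z g|%:R in lin *.
have c0 : 0 <= c by apply: ler0n.
have c1 : c <= s1 by rewrite ler_nat subset_leq_card ?subsetIl.
have c2 : c <= s2 by rewrite ler_nat subset_leq_card ?subsetIr.
have qc : q * ro * c <= q * c.
  by rewrite -mulrA; apply: ler_wpM2l => //; apply: ler_piMl.
have p1 : 0 <= q * s1 - q * ro * c.
  by rewrite subr_ge0 (le_trans qc) // ler_wpM2l.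
have p2 : 0 <= q * s2 - q * ro * c.
  by rewrite subr_ge0 (le_trans qc) // ler_wpM2l.
have p3 : 0 <= q * ro * c by rewrite !mulr_ge0.
have lip := PE3_lip p1 p2 p3 a_ge0 a_ge0 b_ge0 F01.
apply: le_trans (dist_trans lin lip) _.
rewrite /link_error -/s1 -/s2 -/c lerD2l; apply: ler_wpM2l => //.
have h s : `|q * s - q * ro * c - a| <= `|q * s - (a + b)| + `|q * ro * c - b|.
  have -> : q * s - q * ro * c - a = (q * s - (a + b)) - (q * ro * c - b) by ring.
  exact: ler_normB.
have h1 := h s1; have h2 := h s2; clear lin lip h; lra.
Qed.

Let Ex_layer_stat v Z : r \notin Z -> v \in Z -> E (layer_stat v Z) = E (inner v Z).
Proof.
move=> rZ vZ; rewrite (Ex_mix nuP (touch Z)); apply: eq_Ex => g; apply: eq_Ex => g'.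
by rewrite /layer_stat !(layer_off _ _ rZ) link_stat_on.
Qed.

Let Ex_layer_stat_ge v Z : r \notin Z -> v \in Z -> (#|Z| <= 3)%N ->
  tau - delta <= E (layer_stat v Z).
Proof.
move=> rZ vZ Z3; rewrite Ex_layer_stat //.
rewrite lerBlDl -lerBlDr -[tau](@Ex_cst _ (vpair n) _ _ nuP) -ExB.
apply: le_trans (error_le rZ Z3); apply: ler_Ex => // g.
by apply: le_trans (inner_dist g rZ vZ); rewrite distrC ler_norm.
Qed.

Let Ex_layer_stat2_le v w Z : r \notin Z -> v \in Z -> w \in Z -> v != w ->
  (#|Z| <= 3)%N ->
  E (fun g => layer_stat v Z g * layer_stat w Z g) <= tau ^+ 2 + 2 * delta.
Proof.
move=> rZ vZ wZ vw Z3; rewrite (Ex_mix nuP (touch Z)).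
apply: (@le_trans _ _ (E (fun g => tau ^+ 2 + 2 * link_error Z g))); last first.
  by rewrite ExD Ex_cst // ExZ lerD2l; apply: ler_wpM2l => //; apply: error_le.
apply: ler_Ex => // g.
have -> : E (fun g' => layer_stat v Z (mix (touch Z) g g') *
   layer_stat w Z (mix (touch Z) g g')) = inner v Z g * inner w Z g.
  (* Given the layers, the links of [v] use pairs containing [v] and those of [w] use pairs avoiding
     it, since the layers avoid [Z]. Hence the expectation factors. *)
  have disj e : [disjoint lay e g Z & [set v]].
    rewrite disjoint_sym disjoints1; apply: contraTN vZ => /layer_avoid; exact.
  have wv : w \notin [set v] by rewrite inE eq_sym.
  have onv := @link_stat_on R n T e1 e2 v (lay e1 g Z) (lay e2 g Z) _ F (set11 v).
  have offw := @link_stat_off R n T e1 e2 w _ _ _ F wv (disj e1) (disj e2).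
  rewrite /inner -(Ex_indep nuP onv offw); apply: eq_Ex => g'.
  by rewrite /layer_stat !(layer_off _ _ rZ) !link_stat_on.
apply: le_trans (mul_unit_le (inner01 v Z g) (inner01 w Z g) tau01) _.
have h1 := inner_dist g rZ vZ; have h2 := inner_dist g rZ wZ.
move: (`|inner v Z g - tau|) (`|inner w Z g - tau|) h1 h2 => x y h1 h2.
by rewrite -addrA lerD2l mulr_natl mulr2n lerD.
Qed.

(** Outside both balls the deletion of [v] leaves layer [k] unchanged, so the statistic describes
    its links in the graph where only [X] is deleted. The few vertices inside a ball are given the
    value 0. *)
Definition outer_stat X v g : R :=
  (v \notin bal e1 g X)%:R * (v \notin bal e2 g X)%:R * layer_stat v (v |: X) g.

Context (X : {set V}).
Hypothesis rX : r \notin X.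
Hypothesis X1 : (#|X| <= 1)%N.
Let O := ~: (r |: X).
Let N : R := #|O|%:R.
Hypothesis N_gt0 : 0 < N.

Let S g := \sum_(v in O) outer_stat X v g.

Lemma outer_stat01 v g : 0 <= outer_stat X v g <= 1.
Proof.
rewrite /outer_stat; have /andP[h0 h1] := layer_stat01 v (v |: X) g.
apply/andP; split; first by rewrite !mulr_ge0.
by case: (v \notin _); case: (v \notin _); rewrite ?mulr1 ?mul1r ?mul0r ?mulr0 ?mul0r.
Qed.

Let S_ge : N * (tau - delta) - 4 * D ^+ k <= E S.
Proof.
have B e : pr nu e = q -> E (fun g => \sum_(v in O) (v \in bal e g X)%:R) <= 2 * D ^+ k.
  move=> pe; have := @Ex_ball_le _ _ _ nu nuP n_gt0 r e; rewrite pe => /(_ D_ge2 k X rX).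
  apply: le_trans; apply: ler_Ex => // g; rewrite card_sum_mem [leRHS](bigID (mem O)) /=.
  by rewrite lerDl sumr_ge0.
apply: (@le_trans _ _ (E (fun g => \sum_(v in O) layer_stat v (v |: X) g -
   (\sum_(v in O) (v \in bal e1 g X)%:R + \sum_(v in O) (v \in bal e2 g X)%:R)))).
  rewrite ExB ExD; have h1 := B e1 pr1; have h2 := B e2 pr2.
  apply: lerB; last by apply: le_trans (lerD h1 h2) _; lra.
  rewrite Ex_sum /N mulr_natl -sumr_const; apply: ler_sum => v.
  rewrite !inE negb_or => /andP[vr vX].
  apply: Ex_layer_stat_ge; rewrite ?setU11 ?setU1_out //.
  by rewrite cardsU1 vX (leq_trans (leq_add (leqnn 1) X1)).
apply: ler_Ex => // g; rewrite -big_split -sumrB /=; apply: ler_sum => v _.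
rewrite /outer_stat; have /andP[h0 h1] := layer_stat01 v (v |: X) g.
move: (layer_stat _ _ _) h0 h1 => x h0 h1.
by case: (v \in _); case: (v \in _) => /=; lra.
Qed.

Let S2_le : E (fun g => S g ^+ 2) <= N + N ^+ 2 * (tau ^+ 2 + 2 * delta).
Proof.
have d0 : 0 <= tau ^+ 2 + 2 * delta.
  apply: addr_ge0; first exact: sqr_ge0.
  apply: mulr_ge0 => //; apply: le_trans (error_le rX _); last exact: leq_trans X1 _.
  apply: Ex_ge0 => // g; rewrite /link_error !(addr_ge0, mulr_ge0) ?sqr_ge0 //.
have -> : E (fun g => S g ^+ 2) =
    \sum_(v in O) \sum_(w in O) E (fun g => outer_stat X v g * outer_stat X w g).
  rewrite -[RHS](eq_bigr _ (fun v _ => Ex_sum _ _ _ _)) -Ex_sum.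
  by apply: eq_Ex => g; rewrite expr2 big_distrlr.
have -> : N + N ^+ 2 * (tau ^+ 2 + 2 * delta) =
    \sum_(v in O) (1 + \sum_(w in O) (tau ^+ 2 + 2 * delta)).
  by rewrite big_split /= !sumr_const /N expr2 -mulrA !mulr_natl.
apply: ler_sum => v vO; rewrite (bigD1 v) //=; apply: lerD.
  apply: Ex_le_cst => // g; have /andP[h0 h1] := outer_stat01 v g.
  by apply: mulr_ile1.
rewrite [leRHS](bigD1 v) //= -[leLHS]add0r; apply: lerD => //.
apply: ler_sum => w /andP[wO wv]; have vw : v != w by rewrite eq_sym.
move: vO wO; rewrite !inE !negb_or => /andP[vr vX] /andP[wr wX].
pose Z := v |: (w |: X).
apply: (@le_trans _ _ (E (fun g => layer_stat v Z g * layer_stat w Z g))); last first.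
  apply: Ex_layer_stat2_le; rewrite ?setU11 ?setU1_out ?inE ?eqxx ?orbT //.
  rewrite /Z cardsU1 cardsU1 !inE (negbTE vw) vX wX /=.
  by rewrite (leq_add (leqnn 1) (leq_add (leqnn 1) X1)).
apply: ler_Ex => // g; rewrite /outer_stat.
have /andP[v0 _] := layer_stat01 v Z g; have /andP[w0 _] := layer_stat01 w Z g.
(* If [v] and [w] both avoid the two balls, deleting the other vertex as well does not change the
   layers, so both statistics may be taken with the same [Z]; otherwise the left-hand side is 0. *)
case: (boolP (v \in bal e1 g X)) => [_|v1]; first by rewrite !mul0r mulr_ge0.
case: (boolP (v \in bal e2 g X)) => [_|v2]; first by rewrite mulr0 !mul0r mulr_ge0.
case: (boolP (w \in bal e1 g X)) => [_|w1]; first by rewrite !mul0r mulr0 mulr_ge0.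
case: (boolP (w \in bal e2 g X)) => [_|w2]; first by rewrite mulr0 mul0r mulr0 mulr_ge0.
rewrite !mul1r /layer_stat /Z.
have layZ e : v \notin bal e g X -> w \notin bal e g X ->
    layer r (graph e g) (v |: (w |: X)) k = layer r (graph e g) X k.
  by move=> vB wB; rewrite layer_add ?layer_add // ball_add.
by rewrite !layZ // !layer_add.
Qed.

(** In the expansion of the square about [tau] the mean of [S] has a negative coefficient, so the
    lower bound [S_ge] and the upper bound [S2_le] suffice. *)
Lemma outer_stat_concentration :
  E (fun g => (S g / N - tau) ^+ 2) <= N^-1 + 4 * delta + 8 * (D ^+ k / N).
Proof.
have H1 := S_ge; have H2 := S2_le; have /andP[t0 t1] := tau01.
have -> : E (fun g => (S g / N - tau) ^+ 2) =
   E (fun g => N^-1 ^+ 2 * S g ^+ 2 - (2 * tau * N^-1) * S g + tau ^+ 2).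
  by apply: eq_Ex => g; ring.
rewrite ExD ExB !ExZ Ex_cst //.
have D0 : 0 <= D ^+ k by rewrite exprn_ge0 // (le_trans _ D_ge2).
have i0 : 0 <= N^-1 by rewrite invr_ge0 ltW.
have NN : N * N^-1 = 1 by rewrite divff // gt_eqF.
have H2' : N^-1 ^+ 2 * E (fun g => S g ^+ 2) <= N^-1 + (tau ^+ 2 + 2 * delta).
  apply: le_trans (ler_wpM2l (sqr_ge0 _) H2) _.
  have -> : N^-1 ^+ 2 * (N + N ^+ 2 * (tau ^+ 2 + 2 * delta)) =
    (N * N^-1) * N^-1 + (N * N^-1) ^+ 2 * (tau ^+ 2 + 2 * delta) by ring.
  by rewrite NN expr1n !mul1r.
have H1' : 2 * tau * (tau - delta - 4 * (D ^+ k * N^-1)) <= 2 * tau * N^-1 * E S.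
  rewrite -[leRHS]mulrA; apply: ler_wpM2l; first exact: mulr_ge0.
  apply: le_trans (ler_wpM2l i0 H1).
  rewrite (_ : N^-1 * _ = (N * N^-1) * (tau - delta) - 4 * (D ^+ k * N^-1)); last by ring.
  by rewrite NN mul1r.
have x0 : 0 <= D ^+ k * N^-1 by apply: mulr_ge0.
have d0 : 0 <= delta.
  apply: le_trans (error_le rX _); last exact: leq_trans X1 _.
  by apply: Ex_ge0 => // g; rewrite /link_error !(addr_ge0, mulr_ge0) ?sqr_ge0.
exact: second_moment_arith H2' H1' t0 t1 d0 x0.
Qed.

End Concentration.

(** * Parents and their overlap *)

Section CappedInverse.
Context {R : realFieldType}.

(** The value 1 at 0 matters: a vertex without links into the given layer may have parents
    elsewhere, and its overlap is only known to be at most 1. *)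
Definition capped_inv (m : nat) : R := if m == 0%N then 1 else m%:R^-1.

Lemma capped_inv_ge0 m : 0 <= capped_inv m.
Proof. by rewrite /capped_inv; case: ifP => // _; rewrite invr_ge0. Qed.

Lemma capped_inv_le1 m : capped_inv m <= 1.
Proof.
rewrite /capped_inv; case: eqP => // /eqP m0; rewrite invf_le1 ?ler1n ?ltr0n ?lt0n //.
Qed.

(** Chebyshev's argument made pointwise: either [m >= t / 2], or the quadratic term is at least
    1. *)
Lemma capped_inv_le m (t : R) : 0 < t ->
  capped_inv m <= 2 / t + 4 * (m%:R - t) ^+ 2 / t ^+ 2.
Proof.
move=> t0; have t2 : 0 < t ^+ 2 by rewrite exprn_gt0.
have p1 : 0 <= 2 / t by rewrite divr_ge0 // ltW.
have p2 : 0 <= 4 * (m%:R - t) ^+ 2 / t ^+ 2.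
  apply: divr_ge0; last exact: sqr_ge0.
  by apply: mulr_ge0 => //; exact: sqr_ge0.
have [mt|mt] := lerP (t / 2) m%:R.
  have m0 : 0 < m%:R :> R by apply: lt_le_trans mt; rewrite divr_gt0.
  have -> : capped_inv m = m%:R^-1.
    by rewrite /capped_inv ifF //; apply/negbTE; rewrite -lt0n -(ltr0n R).
  have : m%:R^-1 <= 2 / t by rewrite -[2 / t]invf_div lef_pV2 // posrE divr_gt0.
  lra.
apply: le_trans (capped_inv_le1 m) _.
have : 1 <= 4 * (m%:R - t) ^+ 2 / t ^+ 2.
  rewrite ler_pdivlMr // mul1r.
  have : (t / 2) ^+ 2 <= (t - m%:R) ^+ 2.
    by rewrite lerXn2r ?nnegrE; lra.
  lra.
lra.
Qed.

End CappedInverse.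

Definition set_overlap (R : realFieldType) (V : finType) (A B : {set V}) : R :=
  #|A :&: B|%:R / (#|A|%:R * #|B|%:R).

Section SetOverlap.
Context {R : realFieldType} {V : finType}.
Implicit Types A B : {set V}.

Lemma set_overlapC A B : set_overlap R A B = set_overlap R B A.
Proof. by rewrite /set_overlap setIC [X in _ / X]mulrC. Qed.

Lemma set_overlap_ge0 A B : 0 <= set_overlap R A B.
Proof. by rewrite divr_ge0 ?mulr_ge0. Qed.

Lemma set_overlap_le_inv A B : set_overlap R A B <= #|A|%:R^-1.
Proof.
rewrite /set_overlap; have [B0|B0] := eqVneq #|B| 0%N.
  by rewrite B0 mulr0 invr0 mulr0 invr_ge0.
have Bp : 0 < #|B|%:R :> R by rewrite ltr0n lt0n.
rewrite invfM mulrCA ler_piMr ?invr_ge0 // ler_pdivrMr // mul1r ler_nat.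
by rewrite subset_leq_card // subsetIr.
Qed.

Lemma set_overlap_le_capped A B : set_overlap R A B <= capped_inv #|A|.
Proof.
apply: le_trans (set_overlap_le_inv A B) _; rewrite /capped_inv.
by case: eqP => // ->; rewrite invr0.
Qed.

Lemma set_overlap_le1 A B : set_overlap R A B <= 1.
Proof. exact: le_trans (set_overlap_le_capped A B) (capped_inv_le1 _). Qed.

End SetOverlap.

Section ParOverlap.
Context {R : realFieldType} {V : finType} (r : V).
Implicit Types (e : rel V) (v : V).

Definition par_overlap e1 e2 v : R := set_overlap R (par e1 r v) (par e2 r v).

Lemma par_overlap_le e1 e2 k v :
  par_overlap e1 e2 v <= (v \in gball r e1 set0 k)%:R +
    capped_inv #|link e1 v (layer r e1 (v |: set0) k)|.
Proof.
have [_|vB] := boolP (v \in gball r e1 set0 k).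
  apply: le_trans (set_overlap_le1 _ _) _; rewrite lerDl; exact: capped_inv_ge0.
rewrite add0r; have [->|Ln] := eqVneq (link e1 v (layer r e1 (v |: set0) k)) set0.
  by rewrite cards0 /capped_inv eqxx set_overlap_le1.
by move: Ln; rewrite setU0 => Ln; rewrite -(par_layer vB Ln) set_overlap_le_capped.
Qed.

Definition overlap_stat (x y z : nat) : R := z%:R / ((x + z)%:R * (y + z)%:R).

Lemma overlap_stat_sets (A B : {set V}) :
  overlap_stat #|A :\: B| #|B :\: A| #|A :&: B| = set_overlap R A B.
Proof.
rewrite /overlap_stat /set_overlap addnC cardsID.
by rewrite (_ : (#|B :\: A| + #|A :&: B|)%N = #|B|) // addnC setIC cardsID.
Qed.

(** Having missed layer [k], the vertex is still outside the ball of radius [k.+1], so its parents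
    lie in layer [k.+1] as soon as it has a link there. *)
Lemma par_overlap_empty e1 e2 k v : v \notin gball r e1 set0 k ->
  link e1 v (layer r e1 (v |: set0) k) = set0 ->
  par_overlap e1 e2 v <= capped_inv #|link e1 v (layer r e1 (v |: set0) k.+1)|.
Proof.
move=> vB L0; apply: le_trans (par_overlap_le _ _ k.+1 v) _.
suff /negbTE-> : v \notin gball r e1 set0 k.+1 by rewrite add0r.
apply/negP => vB'.
have vL : v \in layer r e1 set0 k.+1 by rewrite in_setD vB.
by have := layer_link vL; rewrite L0 eqxx.
Qed.

(** Outside the balls, if both link sets are nonempty, they are the sets of parents and the two
    terms agree. If one of them is empty the statistic vanishes, and the overlap is charged to the
    links into the next layer of that graph. *)
Lemma par_overlap_stat e1 e2 k v A B :
  A = link e1 v (layer r e1 (v |: set0) k) ->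
  B = link e2 v (layer r e2 (v |: set0) k) ->
  `|par_overlap e1 e2 v - (v \notin gball r e1 set0 k)%:R *
     (v \notin gball r e2 set0 k)%:R * overlap_stat #|A :\: B| #|B :\: A| #|A :&: B| | <=
  (v \in gball r e1 set0 k)%:R + (v \in gball r e2 set0 k)%:R +
  capped_inv #|link e1 v (layer r e1 (v |: set0) k.+1)| +
  capped_inv #|link e2 v (layer r e2 (v |: set0) k.+1)|.
Proof.
move=> AE BE; rewrite overlap_stat_sets.
set c1 := capped_inv _; set c2 := capped_inv _.
have c10 : 0 <= c1 by apply: capped_inv_ge0.
have c20 : 0 <= c2 by apply: capped_inv_ge0.
have x0 := set_overlap_ge0 (R := R) (par e1 r v) (par e2 r v).
have x1 := set_overlap_le1 (R := R) (par e1 r v) (par e2 r v).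
rewrite /par_overlap.
case: (boolP (v \in gball r e1 set0 k)) => [_|v1].
  by rewrite !mul0r subr0 ger0_norm //; case: (v \in _) => /=; lra.
case: (boolP (v \in gball r e2 set0 k)) => [_|v2].
  by rewrite mulr0 !mul0r subr0 ger0_norm //=; lra.
rewrite /= !mul1r !add0r.
have [A0|An] := eqVneq A set0; first rewrite A0 in AE.
  have := par_overlap_empty e2 v1 (esym AE); rewrite -/c1 /par_overlap => h.
  by rewrite [X in _ - X]/set_overlap A0 set0I cards0 mul0r subr0 ger0_norm //; lra.
have [B0|Bn] := eqVneq B set0; first rewrite B0 in BE.
  have := par_overlap_empty e1 v2 (esym BE); rewrite -/c2 /par_overlap set_overlapC => h.
  by rewrite [X in _ - X]/set_overlap B0 setI0 cards0 mul0r subr0 ger0_norm //; lra.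
move: An Bn; rewrite AE BE setU0 => An Bn.
by rewrite (par_layer v1 An) (par_layer v2 Bn) subrr normr0 addr_ge0.
Qed.

End ParOverlap.

(** * Small overlap when parents are numerous *)

Section FiniteBounds.
Context {R : realType} {n : nat} {T : finType} (nu : T -> R).
Hypothesis nuP : is_pmf nu.
Hypothesis n_gt1 : (1 < n)%N.
Notation V := (vertex n).
Notation config := {ffun vpair n -> T}.
Notation E := (@Ex R (vpair n) T nu).
Let r : V := ord0.
Implicit Types (e : T -> bool) (g : config) (u v w : V) (X Z : {set V}).

Let n_gt0 : (0 < n)%N. Proof. exact: ltnW. Qed.
Let nR_gt0 : 0 < n%:R :> R. Proof. by rewrite ltr0n. Qed.

(** The number of links has mean [t] and variance at most [t], so [capped_inv_le] gives
    [2 / t + 4 * t / t ^+ 2]. *)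
Lemma Ex_capped_link e v (L : {set V}) : v \notin L -> 0 < pr nu e * #|L|%:R ->
  E (fun g => capped_inv #|link (graph e g) v L|) <= 6 / (pr nu e * #|L|%:R).
Proof.
move=> vL; set t := _ * _ => t0.
have LZ : L \subset ~: [set v].
  by apply/subsetP => u uL; rewrite !inE; apply: contraNneq vL => <-.
have E1 := @Ex_link _ _ _ nu nuP e [set v] v (fun=> L) (set11 v) (fun _ _ => erefl) (fun=> LZ).
have E2 := @Ex_link2_le _ _ _ nu nuP e e [set v] v (fun=> L) (fun=> L) (set11 v)
  (fun _ _ => erefl) (fun _ _ => erefl) (fun=> LZ) (fun=> LZ).
rewrite Ex_cst // -/t in E1.
rewrite !Ex_cst // setIid (@eq_pr _ _ nu _ e) in E2; last by move=> x; rewrite andbb.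
have t2 : 0 < t ^+ 2 by rewrite exprn_gt0.
apply: (@le_trans _ _ (E (fun g => (2 / t + 4) + (4 / t ^+ 2 *
    (#|link (graph e g) v L|%:R * #|link (graph e g) v L|%:R) -
    8 / t * #|link (graph e g) v L|%:R)))).
  apply: ler_Ex => // g; apply: le_trans (capped_inv_le _ t0) _.
  by rewrite le_eqVlt; apply/orP; left; apply/eqP; field; exact: lt0r_neq0.
rewrite ExD Ex_cst // ExB !ExZ E1.
have h : 4 / t ^+ 2 * E (fun g => #|link (graph e g) v L|%:R * #|link (graph e g) v L|%:R) <=
    4 / t + 4.
  apply: le_trans (ler_wpM2l _ E2) _; first by rewrite divr_ge0 // ltW.
  rewrite (_ : pr nu e * pr nu e * (#|L|%:R * #|L|%:R) = t ^+ 2) -/t; last by rewrite /t; ring.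
  by rewrite le_eqVlt; apply/orP; left; apply/eqP; field; exact: lt0r_neq0.
have -> : 8 / t * t = 8 by rewrite mulfVK // gt_eqF.
lra.
Qed.

Lemma Ex_capped_layer e k Z v c : r \notin Z -> v \in Z -> 0 < pr nu e -> 0 < c ->
  E (fun g => capped_inv #|link (graph e g) v (layer r (graph e g) Z k)|) <=
  E (fun g => (#|layer r (graph e g) Z k|%:R < c)%R%:R) + 6 / (pr nu e * c).
Proof.
move=> rZ vZ p0 c0; rewrite (Ex_mix nuP (touch Z)).
have pc0 : 0 < pr nu e * c by rewrite mulr_gt0.
rewrite -[X in _ <= _ + X](@Ex_cst _ (vpair n) _ _ nuP) -ExD; apply: ler_Ex => // g.
under eq_Ex => g' do rewrite (layer_off _ _ rZ) (link_on _ _ vZ).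
have vL : v \notin layer r (graph e g) Z k by apply: contraTN vZ => /layer_avoid; apply.
have [Lc|cL] /= := ltrP #|layer r (graph e g) Z k|%:R c.
  apply: (@le_trans _ _ 1); last by rewrite lerDl divr_ge0 // ltW.
  by apply: Ex_le_cst => // g'; apply: capped_inv_le1.
have pcL : pr nu e * c <= pr nu e * #|layer r (graph e g) Z k|%:R by rewrite ler_pM2l.
rewrite add0r; apply: le_trans (Ex_capped_link vL (lt_le_trans pc0 pcL)) _.
apply: ler_wpM2l => //; rewrite lef_pV2 ?posrE //; exact: lt_le_trans pcL.
Qed.

Lemma Ex_markov_sqr (S : config -> R) (x : R) (B : config -> bool) : 0 < x ->
  (forall g, B g -> S g <= x / 2) ->
  E (fun g => (B g)%:R) <= 4 / x ^+ 2 * E (fun g => (S g - x) ^+ 2).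
Proof.
move=> x0 BS; have x2 : 0 < x ^+ 2 by rewrite exprn_gt0.
rewrite -ExZ; apply: ler_Ex => // g; case: (boolP (B g)) => [/BS Sx|_] /=; last first.
  by rewrite mulr_ge0 ?sqr_ge0 // divr_ge0 // ltW.
rewrite mulrAC ler_pdivlMr // mul1r -[X in _ <= 4 * X]sqrrN opprB.
have : (x / 2) ^+ 2 <= (x - S g) ^+ 2 by rewrite lerXn2r ?nnegrE; lra.
lra.
Qed.

Let N1 : R := n%:R - 1.
Let N1_gt0 : 0 < N1. Proof. by rewrite subr_gt0 ltr1n. Qed.

Lemma overlapE (e1 e2 : T -> bool) g :
  overlap R (fun s => e1 (g s)) (fun s => e2 (g s)) =
  N1^-1 * \sum_(v : V | v != r) par_overlap r (graph e1 g) (graph e2 g) v :> R.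
Proof. by []. Qed.

Lemma sum_vertex_ne (c : R) : \sum_(v : V | v != r) c = N1 * c.
Proof.
have := sum_vertex_cst n_gt0 c; rewrite (bigD1 r) //= => /(canRL (addKr _)) ->.
by rewrite /N1 mulrBl mul1r addrC.
Qed.

(** Meant for a depth with [D ^+ k] much smaller and [D ^+ k.+1] much larger than [n]: most vertices
    avoid the ball of radius [k] and have about [D ^+ k.+1 / n] links into layer [k]. Many parents
    in one graph already make the overlap small. *)
Lemma Ex_overlap_le e1 e2 k D : D = n%:R * pr nu e1 -> 4 <= D ->
  E (fun g => overlap R (fun s => e1 (g s)) (fun s => e2 (g s))) <=
  2 * (D ^+ k / N1) + 4 * (2 / D + 40 * (D ^+ k / n%:R)) + 12 * (n%:R / D ^+ k.+1).
Proof.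
move=> DE D4; set x := D ^+ k.
have D0 : 0 < D by apply: lt_le_trans D4.
have D2 : 2 <= D by apply: le_trans D4; rewrite ler_nat.
have p0 : 0 < pr nu e1 by rewrite -(pmulr_rgt0 _ nR_gt0) -DE.
have D2' : 2 <= n%:R * pr nu e1 by rewrite -DE.
have D4' : 4 <= n%:R * pr nu e1 by rewrite -DE.
have x0 : 0 < x by rewrite exprn_gt0.
pose lay v g := layer r (graph e1 g) (v |: set0) k.
have cap v : v != r -> E (fun g => capped_inv #|link (graph e1 g) v (lay v g)|) <=
    4 * (2 / D + 40 * (x / n%:R)) + 12 * (n%:R / D ^+ k.+1).
  move=> vr; have rZ : r \notin v |: set0 by apply: setU1_out => //; rewrite inE.
  have c0 : 0 < x / 2 by rewrite divr_gt0.
  apply: le_trans (Ex_capped_layer k rZ (setU11 v set0) p0 c0) _; apply: lerD.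
    have hB g : #|lay v g|%:R < x / 2 -> #|lay v g|%:R <= x / 2 by apply: ltW.
    apply: le_trans (Ex_markov_sqr x0 hB) _.
    have := Ex_layer_var nuP n_gt0 D2' D4' k rZ; rewrite -DE -/x => V1.
    rewrite -mulrA ler_pM2l ?ltr0n // ler_pdivrMl ?exprn_gt0 //.
    apply: le_trans V1 _; apply: ler_wpM2l; first exact: sqr_ge0.
    rewrite setU0 cards1 lerD2l; apply: ler_wpM2r; last by lra.
    by rewrite divr_ge0 ?ltW.
  rewrite le_eqVlt; apply/orP; left; apply/eqP; rewrite exprS -/x DE.
  by field; rewrite !lt0r_neq0.
apply: (@le_trans _ _ (N1^-1 * (\sum_(v | v != r) E (fun g => (v \in gball r (graph e1 g) set0 k)%:R) +
   \sum_(v | v != r) E (fun g => capped_inv #|link (graph e1 g) v (lay v g)|)))).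
  under eq_Ex => g do rewrite overlapE.
  rewrite ExZ Ex_sum -big_split /=; apply: ler_wpM2l; first by rewrite invr_ge0 ltW.
  apply: ler_sum => v vr; rewrite -ExD; apply: ler_Ex => // g.
  exact: par_overlap_le.
rewrite mulrDr -addrA; apply: lerD.
  rewrite mulrC mulrA ler_pM2r ?invr_gt0 //.
  have r0 : r \notin set0 by rewrite inE.
  have := Ex_ball_le nuP n_gt0 D2' k r0.
  rewrite Ex_sum_mem -DE -/x; apply: le_trans.
  rewrite [leRHS](bigD1 r) //= lerDr; apply: Ex_ge0 => // g; exact: ler0n.
rewrite ler_pdivrMl // -sum_vertex_ne; apply: ler_sum => v vr; exact: cap.
Qed.

End FiniteBounds.

(** * Overlap and attachment as functions of three Poisson counts *)

Section PoissonStatistics.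
Context {R : realType}.

Lemma overlap_stat_unit : unit_valued3 (@overlap_stat R).
Proof.
move=> x y z; rewrite /overlap_stat divr_ge0 ?mulr_ge0 //=.
have [->|z0] := eqVneq z 0%N; first by rewrite mul0r.
rewrite -natrM ler_pdivrMr ?ltr0n ?muln_gt0 ?addn_gt0 ?lt0n ?z0 ?orbT //.
rewrite mul1r ler_nat; apply: (@leq_trans (x + z)); first exact: leq_addl.
by rewrite leq_pmulr // addn_gt0 !lt0n z0 orbT.
Qed.

(** Indicator of a link in the first graph, in terms of the three counts. Summed over the outer
    vertices it bounds layer [k.+1] from below, so the same concentration result controls the size
    of that layer. *)
Definition nonzero1 (x y z : nat) : R := 1 - ((x == 0) && (z == 0))%N%:R.
Definition nonzero2 (x y z : nat) : R := 1 - ((y == 0) && (z == 0))%N%:R.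

Lemma nonzero1_unit : unit_valued3 nonzero1.
Proof. by move=> x y z; rewrite /nonzero1; case: ((x == 0) && _)%N; rewrite ?subrr ?subr0 lexx ?ler01. Qed.

Lemma nonzero2_unit : unit_valued3 nonzero2.
Proof. by move=> x y z; rewrite /nonzero2; case: ((y == 0) && _)%N; rewrite ?subrr ?subr0 lexx ?ler01. Qed.

Let u1 : unit_valued (fun=> 1 : R). Proof. by move=> k; rewrite ler01 lexx. Qed.

Let u0 : unit_valued (fun k => (k == 0)%N%:R : R).
Proof. by move=> k; case: (k == 0)%N; rewrite ?ler01 lexx. Qed.

Lemma PE_nonzero (a c : R) : 0 <= a ->
  PE a (fun x => 1 - (x == 0)%N%:R * c) = 1 - expR (- a) * c.
Proof.
move=> a0; rewrite (@eq_PE _ _ _ (fun x => 1 * 1 + (- c) * (x == 0)%N%:R)); last first.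
  by move=> x; rewrite mul1r mulNr mulrC.
by rewrite PE_lin // PE_cst PE_at0 mulr1 mulNr mulrC.
Qed.

Lemma PE_nonzero_and (a : R) (x : nat) : 0 <= a ->
  PE a (fun z => 1 - ((x == 0) && (z == 0))%N%:R) = 1 - (x == 0)%N%:R * expR (- a).
Proof.
move=> a0; rewrite mulrC -PE_nonzero //; apply: eq_PE => z.
by rewrite -natrM mulnb andbC.
Qed.

Lemma PE3_nonzero1 (a b : R) : 0 <= a -> 0 <= b ->
  PE3 a a b nonzero1 = 1 - expR (- (a + b)).
Proof.
move=> a0 b0; rewrite opprD expRD -PE_nonzero //; apply: eq_PE => x.
rewrite -[RHS](PE_cst a); apply: eq_PE => y; exact: PE_nonzero_and.
Qed.

Lemma PE3_nonzero2 (a b : R) : 0 <= a -> 0 <= b ->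
  PE3 a a b nonzero2 = 1 - expR (- (a + b)).
Proof.
move=> a0 b0; rewrite -[RHS](PE_cst a); apply: eq_PE => x.
rewrite opprD expRD -PE_nonzero //; apply: eq_PE => y; exact: PE_nonzero_and.
Qed.

End PoissonStatistics.

(** * Mean distance of the overlap from its Poisson value *)

Section MainBound.
Context {R : realType} {n : nat} {T : finType} (nu : T -> R).
Hypothesis nuP : is_pmf nu.
Hypothesis n_gt2 : (2 < n)%N.
Notation V := (vertex n).
Notation config := {ffun vpair n -> T}.
Notation E := (@Ex R (vpair n) T nu).
Let r : V := ord0.
Context (e1 e2 : T -> bool) (q ro : R).
Hypothesis pr1 : pr nu e1 = q.
Hypothesis pr2 : pr nu e2 = q.
Hypothesis pr12 : pr nu (fun t => e1 t && e2 t) = q * ro.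
Hypothesis ro_ge0 : 0 <= ro.
Hypothesis ro_le1 : ro <= 1.
Let D := n%:R * q.
Hypothesis D_ge2 : 2 <= D.
Context (k : nat) (a b delta : R).
Hypothesis a_ge0 : 0 <= a.
Hypothesis b_ge0 : 0 <= b.
Hypothesis ab_gt0 : 0 < a + b.
Hypothesis error_le : forall Z : {set V}, r \notin Z -> (#|Z| <= 3)%N ->
  E (link_error r e1 e2 q ro k a b Z) <= delta.
Implicit Types (g : config) (u v w : V) (X Z : {set V}).

Let n_gt1 : (1 < n)%N. Proof. exact: ltnW. Qed.
Let n_gt0 : (0 < n)%N. Proof. exact: ltnW. Qed.
Let nR_gt0 : 0 < n%:R :> R. Proof. by rewrite ltr0n. Qed.
Let q_gt0 : 0 < q.
Proof. by rewrite -(pmulr_rgt0 _ nR_gt0); apply: lt_le_trans D_ge2. Qed.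

Local Notation lay e g X j := (layer r (graph e g) X j).
Local Notation bal e g X j := (gball r (graph e g) X j).

Let kappa (N : R) := N^-1 + 4 * delta + 8 * (D ^+ k / N).

Lemma small_layer_prob e (F : nat -> nat -> nat -> R) X : unit_valued3 F ->
  r \notin X -> (#|X| <= 1)%N -> 0 < #|~: (r |: X)|%:R :> R -> 0 < PE3 a a b F ->
  (forall g v, v \notin X -> outer_stat r e1 e2 k F X v g <= (v \in lay e g X k.+1)%:R) ->
  E (fun g => (#|lay e g X k.+1|%:R < #|~: (r |: X)|%:R * (PE3 a a b F / 2))%R%:R) <=
  4 / PE3 a a b F ^+ 2 * kappa #|~: (r |: X)|%:R.
Proof.
move=> F01 rX X1 N0 t0 Fle.
have conc := outer_stat_concentration nuP n_gt0 pr1 pr2 pr12 ro_ge0 ro_le1 D_ge2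
  a_ge0 b_ge0 error_le F01 rX X1 N0.
set N := #|_|%:R in N0 conc *; move: (PE3 a a b F) t0 conc => tau t0 conc.
apply: le_trans (ler_wpM2l _ conc); last by rewrite divr_ge0 // ?sqr_ge0 ?ltW.
apply: Ex_markov_sqr => // g Sg.
rewrite ler_pdivrMr // mulrC; apply: le_trans (ltW Sg).
rewrite card_sum_mem [leRHS](bigID (mem (~: (r |: X)))) /=.
apply: le_trans (_ : _ <= \sum_(v in ~: (r |: X)) (v \in lay e g X k.+1)%:R) _.
  by apply: ler_sum => v vO; apply: Fle; move: vO; rewrite !inE negb_or => /andP[].
by rewrite lerDl sumr_ge0.
Qed.

Let tau1 : R := 1 - expR (- (a + b)).

Let tau1_gt0 : 0 < tau1.
Proof. by rewrite subr_gt0 expR_lt1 oppr_lt0. Qed.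

Let N2 : R := n%:R - 2.
Let N2_gt0 : 0 < N2. Proof. by rewrite subr_gt0 ltr_nat. Qed.

Let card_out2 v : v != r -> #|~: (r |: (v |: set0))|%:R = N2.
Proof.
move=> vr; have := cardsC (r |: (v |: set0)).
rewrite card_vertex // setU0 cards2 eq_sym vr => cE.
by apply: (addrI 2%:R); rewrite -natrD cE /N2 addrC subrK.
Qed.

(** Up to a small probability the next layer has at least [N2 * tau1 / 2] vertices, so [v] has order
    [D] links into it. The count [N2 = n - 2] leaves out the root and [v]. *)
Lemma Ex_capped_next e (F : nat -> nat -> nat -> R) v : unit_valued3 F ->
  pr nu e = q -> PE3 a a b F = tau1 -> v != r ->
  (forall X g v, v \notin X ->
     outer_stat r e1 e2 k F X v g <= (v \in lay e g X k.+1)%:R) ->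
  E (fun g => capped_inv #|link (graph e g) v (lay e g (v |: set0) k.+1)|) <=
  4 / tau1 ^+ 2 * kappa N2 + 12 / (q * (N2 * tau1)).
Proof.
move=> F01 pe tE vr Fle.
have rZ : r \notin v |: set0 by apply: setU1_out => //; rewrite inE.
have c0 : 0 < N2 * (tau1 / 2) by rewrite mulr_gt0 // divr_gt0.
have p0 : 0 < pr nu e by rewrite pe.
apply: le_trans (Ex_capped_layer nuP k.+1 rZ (setU11 v set0) p0 c0) _; apply: lerD.
  have Z1 : (#|v |: set0| <= 1)%N by rewrite setU0 cards1.
  have := @small_layer_prob e F _ F01 rZ Z1.
  by rewrite tE !card_out2 //; apply=> // g w; apply: Fle.
rewrite pe le_eqVlt; apply/orP; left; apply/eqP; field.
by rewrite !lt0r_neq0.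
Qed.

Let link_nonzero v g (F : nat -> nat -> nat -> R) e X :
  F = nonzero1 /\ e = e1 \/ F = nonzero2 /\ e = e2 -> v \notin X ->
  outer_stat r e1 e2 k F X v g <= (v \in lay e g X k.+1)%:R.
Proof.
move=> Fe vX; rewrite /outer_stat /layer_stat /link_stat.
set A := link _ v (lay e1 g _ _); set B := link _ v (lay e2 g _ _).
have eA (C C' : {set V}) : (C == set0) = (#|C :\: C'| == 0)%N && (#|C :&: C'| == 0)%N.
  by rewrite -addn_eq0 addnC cardsID cards_eq0.
case: Fe => -[-> ->].
  case: (boolP (v \in bal e1 g X k)) => v1; first by rewrite !mul0r ler0n.
  rewrite /nonzero1 -eA; have [_|An] := eqVneq A set0.
    by rewrite subrr mulr0 ler0n.
  rewrite (notin_ball_link_layer vX v1 An) mul1r subr0 mulr1.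
  by case: (v \notin _).
case: (boolP (v \in bal e2 g X k)) => v1; first by rewrite mulr0 !mul0r ler0n.
rewrite /nonzero2 [A :&: B]setIC -eA; have [_|An] := eqVneq B set0.
  by rewrite subrr mulr0 ler0n.
rewrite (notin_ball_link_layer vX v1 An) mulr1 subr0 mulr1.
by case: (v \notin _).
Qed.

Let N1 : R := n%:R - 1.
Let N1_gt0 : 0 < N1. Proof. by rewrite subr_gt0 ltr1n. Qed.

Lemma Ex_overlap_dist s : 0 <= s -> kappa N1 <= s ^+ 2 ->
  E (fun g => `|overlap R (fun s => e1 (g s)) (fun s => e2 (g s)) -
                PE3 a a b (@overlap_stat R)|) <=
  s + 4 * (D ^+ k / N1) +
  2 * (4 / tau1 ^+ 2 * kappa N2 + 12 / (q * (N2 * tau1))).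
Proof.
move=> s0 ks.
have r0 : r \notin set0 by rewrite inE.
have X1 : (#|@set0 V| <= 1)%N by rewrite cards0.
have N1E : #|~: (r |: set0)|%:R = N1.
  have := cardsC (r |: set0); rewrite card_vertex // setU0 cards1 => cE.
  by apply: (addrI 1); rewrite -[X in X + _]/(1%:R) -natrD cE /N1 addrC subrK.
have N0 : 0 < #|~: (r |: set0)|%:R :> R by rewrite N1E.
have conc := outer_stat_concentration nuP n_gt0 pr1 pr2 pr12 ro_ge0 ro_le1 D_ge2
  a_ge0 b_ge0 error_le overlap_stat_unit r0 X1 N0.
rewrite N1E in conc.
pose Y v g := outer_stat r e1 e2 k (@overlap_stat R) set0 v g.
move: (PE3 a a b _) conc => tau conc.
pose W g := (\sum_(v in ~: (r |: set0)) Y v g) / N1.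
have sumO (f : V -> R) : \sum_(v in ~: (r |: set0)) f v = \sum_(v | v != r) f v.
  by apply: eq_bigl => v; rewrite !inE orbF.
have EW : E (fun g => `|W g - tau|) <= s.
  rewrite -(ler_pXn2r (ltn0Sn 1)) ?nnegrE //; last by apply: Ex_ge0 => // g.
  apply: le_trans (sqr_Ex nuP _) _; apply: le_trans ks; apply: le_trans conc.
  by apply: ler_Ex => // g; rewrite real_normK ?num_real.
pose cap e v g : R := capped_inv #|link (graph e g) v (lay e g (v |: set0) k.+1)|.
have EQ : E (fun g => `|overlap R (fun s => e1 (g s)) (fun s => e2 (g s)) - W g|) <=
    4 * (D ^+ k / N1) + 2 * (4 / tau1 ^+ 2 * kappa N2 + 12 / (q * (N2 * tau1))).
  apply: (@le_trans _ _ (E (fun g => N1^-1 * \sum_(v | v != r)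
    ((v \in bal e1 g set0 k)%:R + (v \in bal e2 g set0 k)%:R + cap e1 v g + cap e2 v g)))).
    apply: ler_Ex => // g; rewrite overlapE // /W sumO [X in _ - X]mulrC -mulrBr normrM.
    rewrite (@ger0_norm _ N1^-1) ?invr_ge0 ?(ltW N1_gt0) // ler_pM2l ?invr_gt0 // -sumrB.
    apply: le_trans (ler_norm_sum _ _ _) _; apply: ler_sum => v vr.
    exact: par_overlap_stat.
  rewrite ExZ Ex_sum ler_pdivrMl //.
  have Bd e : pr nu e = q -> \sum_(v | v != r) E (fun g => (v \in bal e g set0 k)%:R) <= 2 * D ^+ k.
    move=> pe; have := @Ex_ball_le _ _ _ nu nuP n_gt0 r e; rewrite pe => /(_ D_ge2 k _ r0).
    rewrite Ex_sum_mem; apply: le_trans.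
    by rewrite [leRHS](bigD1 r) //= lerDr; apply: Ex_ge0 => // g; apply: ler0n.
  have C1 v : v != r -> E (cap e1 v) <= 4 / tau1 ^+ 2 * kappa N2 + 12 / (q * (N2 * tau1)).
    move=> vr; apply: (@Ex_capped_next e1 nonzero1) => //; first exact: nonzero1_unit.
      exact: PE3_nonzero1.
    by move=> X g w; apply: link_nonzero; left.
  have C2 v : v != r -> E (cap e2 v) <= 4 / tau1 ^+ 2 * kappa N2 + 12 / (q * (N2 * tau1)).
    move=> vr; apply: (@Ex_capped_next e2 nonzero2) => //; first exact: nonzero2_unit.
      exact: PE3_nonzero2.
    by move=> X g w; apply: link_nonzero; right.
  set c := 4 / _ * _ + _ in C1 C2 *.
  under eq_bigr => v _ do rewrite !ExD.
  rewrite !big_split /=.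
  have B1 := Bd e1 pr1; have B2 := Bd e2 pr2.
  have S1 : \sum_(v | v != r) E (cap e1 v) <= N1 * c.
    by rewrite -(sum_vertex_ne n_gt1); apply: ler_sum.
  have S2 : \sum_(v | v != r) E (cap e2 v) <= N1 * c.
    by rewrite -(sum_vertex_ne n_gt1); apply: ler_sum.
  apply: le_trans (lerD (lerD (lerD B1 B2) S1) S2) _.
  rewrite le_eqVlt; apply/orP; left; apply/eqP; field; exact: lt0r_neq0.
apply: (@le_trans _ _ (E (fun g => `|overlap R (fun s => e1 (g s)) (fun s => e2 (g s)) - W g|
  + `|W g - tau|))).
  by apply: ler_Ex => // g; apply: ler_distD.
rewrite ExD [leLHS]addrC -addrA; exact: lerD.
Qed.

End MainBound.

From mathcomp Require Import all_classical all_reals all_analysis.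
Import numFieldNormedType.Exports.

Local Open Scope classical_set_scope.

(** * The Poisson functional [h] *)

Section PoissonIntegral.
Context {R : realType}.

Lemma measurable_prod_nat (d1 : measure_display) (T1 : measurableType d1) :
  (forall A : set T1, measurable A) -> forall A : set (T1 * nat), measurable A.
Proof.
move=> mT A.
have -> : A = \bigcup_j ([set i | A (i, j)] `*` [set j]).
  apply/seteqP; split=> [[i j] Aij|[i j] [j' _ [/= Aij ->]]] //.
  by exists j.
by apply: bigcup_measurable => j _; apply: measurableX.
Qed.

Lemma measurable_nat3 (A : set (nat * nat * nat)) : measurable A.
Proof. by apply: measurable_prod_nat; apply: measurable_prod_nat. Qed.

Lemma integral_poisson (a : R) (f : nat -> R) : 0 <= a -> unit_valued f ->
  (\int[poisson a]_x (f x)%:E)%E = (PE a f)%:E.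
Proof.
move=> a0 f01.
have f0 k : (0 <= (f k)%:E)%E by rewrite lee_fin; case/andP: (f01 k).
(* At rate 0 [poisson_prob] is by definition the Dirac mass at 0, not the series. *)
have [->|an0] := eqVneq a 0.
  rewrite (eq_measure_integral \d_0%N) => [|A _ _]; last first.
    by rewrite /= /poisson_prob ltxx.
  by rewrite integral_dirac // diracT mul1e PE0.
have ap : 0 < a by rewrite lt0r an0.
pose m_ k : {measure set nat -> \bar R} := mscale (NngNum (pois_ge0 k a0)) \d_k.
rewrite (eq_measure_integral (mseries m_ 0)) => [|A _ _]; last first.
  rewrite /= /poisson_prob ap /mseries esum_mkcond -nneseries_esumT; last first.
    by move=> k; case: ifP => // _; rewrite lee_fin poisson_pmf_ge0.
  apply: eq_eseriesr => k _; rewrite /m_ /= /mscale /= diracE /poisson_pmf ap.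
  case: (k \in A); rewrite ?mule1 ?mule0 // /pois; congr (_%:E).
  by rewrite mulrC.
rewrite ge0_integral_measure_series //.
rewrite -EFin_lim; last by apply/cvg_ex; exists (PE a f); apply: PE_cvg.
apply/congr_lim/funext => n /=; rewrite /series /= -sumEFin.
apply: eq_bigr => k _; rewrite /m_ ge0_integral_mscale //=.
by rewrite integral_dirac // diracT mul1e.
Qed.

Lemma integral_poisson3 (a b : R) (F : nat -> nat -> nat -> R) :
  0 <= a -> 0 <= b -> unit_valued3 F ->
  (\int[poisson3 a b]_w (F w.1.1 w.1.2 w.2)%:E)%E = (PE3 a a b F)%:E.
Proof.
move=> a0 b0 F01.
have F0 x y z : (0 <= (F x y z)%:E)%E by rewrite lee_fin; case/andP: (F01 x y z).
rewrite /poisson3 fubini_tonelli1 /=; first last.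
- by move=> [[x y] z]; apply: F0.
- by move=> _ Y mY; apply: measurable_nat3.
rewrite (_ : (fun x => _) = fun p => (PE b (F p.1 p.2))%:E); last first.
  by apply/funext => -[x y]; rewrite /fubini_F /= integral_poisson.
rewrite fubini_tonelli1 /=; first last.
- move=> [x y] /=; rewrite lee_fin; by case/andP: (PE_unit b0 (F01 x y)).
- by move=> _ Y mY; apply: measurable_prod_nat.
rewrite (_ : (fun x => _) = fun x => (PE a (fun y => PE b (F x y)))%:E); last first.
  apply/funext => x; rewrite /fubini_F /= integral_poisson // => y; exact: PE_unit.
rewrite integral_poisson //; exact: PE3_inner_unit.
Qed.

Lemma cond_expectation_PE (d : measure_display) (T : measurableType d)
    (P : probability T R) (f : T -> R) (A : set T) (e c : R) :
  (forall x, ~ A x -> f x = 0) -> (\int[P]_x (f x)%:E)%E = e%:E ->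
  measurable A -> (\int[P]_x (\1_A x)%:E)%E = c%:E -> cond_expectation P f A = e / c.
Proof.
move=> fA fE mA cE; rewrite /cond_expectation.
move: cE; rewrite integral_indic // setIT => ->; congr (_ / _).
rewrite /Rintegral integral_mkcond (_ : _ \_ A = fun x => (f x)%:E) ?fE //.
apply/funext => x; rewrite /patch; case: ifPn => // /negP xA.
by rewrite fA // => Ax; apply: xA; rewrite inE.
Qed.

(** The integrand vanishes for [Z = 0], so conditioning only divides by the probability
    [1 - expR (- b)] of [Z > 0]. For [a = 0] the private counts vanish and the integrand is [1 / Z],
    as in the separate clause of [h]. *)
Lemma h_PE3 (a b : R) : 0 <= a -> 0 < b ->
  h a b * (1 - expR (- b)) = PE3 a a b (@overlap_stat R).
Proof.
move=> a0 b0; have b0' := ltW b0.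
have c0 : 1 - expR (- b) != 0 by rewrite gt_eqF // subr_gt0 expR_lt1 oppr_lt0.
have nz : unit_valued (fun z => 1 - (z == 0)%N%:R * 1 : R).
  by move=> z; case: (z == 0)%N; rewrite mulr1 ?subrr ?subr0 lexx ler01.
rewrite /h; case: eqP => [->|_].
  have uF z : @overlap_stat R 0 0 z = z%:R^-1.
    rewrite /overlap_stat add0n; have [->|z0] := eqVneq z 0%N; first by rewrite mul0r invr0.
    by rewrite invfM mulrA divff ?mul1r // pnatr_eq0.
  have -> : PE3 0 0 b (@overlap_stat R) = PE b (fun z => z%:R^-1).
    have ov := @overlap_stat_unit R.
    rewrite /PE3 PE0; last exact: PE3_inner_unit.
    rewrite PE0; last by move=> y; apply: PE_unit.
    exact: eq_PE.
  rewrite (@cond_expectation_PE _ _ _ _ _ (PE b (fun z => z%:R^-1)) (1 - expR (- b))) //.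
  - by rewrite divfK.
  - by case=> [_|z zn]; [rewrite invr0|case: zn].
  - rewrite integral_poisson // => z; rewrite -uF; exact: overlap_stat_unit.
  have := integral_poisson b0' nz; rewrite PE_nonzero // mulr1 => <-.
  apply: eq_integral => -[|z] _; rewrite indicE mulr1.
    by rewrite memNset // subrr.
  by rewrite mem_set // subr0.
rewrite (@cond_expectation_PE _ _ _ _ _ (PE3 a a b (@overlap_stat R)) (1 - expR (- b))).
- by rewrite divfK.
- by move=> [[x y] z] /= /negP; rewrite -leqNgt leqn0 => /eqP->; rewrite mul0r.
- exact: (integral_poisson3 a0 b0' (@overlap_stat_unit R)).
- exact: measurable_nat3.
have nz3 : unit_valued3 (fun _ _ z => 1 - (z == 0)%N%:R * 1 : R) by move=> x y z.
have := integral_poisson3 a0 b0' nz3.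
rewrite /PE3 PE_nonzero // mulr1 !PE_cst => <-.
apply: eq_integral => -[[x y] [|z]] _; rewrite indicE mulr1.
  by rewrite memNset // subrr.
by rewrite mem_set // subr0.
Qed.

End PoissonIntegral.

(** * The law of a resampled pair of graphs *)

Definition labels : finType := (bool * bool * bool)%type.

(* A label records the first adjacency, whether it is resampled, and the fresh
   adjacency. *)
Definition edge1 (t : labels) : bool := t.1.1.
Definition edge2 (t : labels) : bool := if t.1.2 then t.2 else t.1.1.

Definition label_pmf (R : realType) (q rho : R) (t : labels) : R :=
  bernoulli_pmf q t.1.1 * bernoulli_pmf (1 - rho) t.1.2 * bernoulli_pmf q t.2.

Section LabelLaw.
Context {R : realType} (q rho : R).
Hypothesis q01 : 0 <= q <= 1.
Hypothesis rho01 : 0 <= rho <= 1.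

Let sum_labels (f : labels -> R) : \sum_t f t =
  \sum_(a : bool) \sum_(b : bool) \sum_(c : bool) f (a, b, c).
Proof.
rewrite (eq_bigr (fun t : labels => f (t.1, t.2))); last by case.
rewrite -(pair_bigA _ (fun p c => f (p, c))) /=.
rewrite (eq_bigr (fun p : bool * bool => \sum_(c : bool) f (p.1, p.2, c))); last by case.
by rewrite -(pair_bigA _ (fun a b => \sum_(c : bool) f (a, b, c))).
Qed.

Lemma label_pmfP : is_pmf (label_pmf q rho).
Proof.
split=> [t|].
  have := q01; have := rho01 => /andP[r0 r1] q01'.
  by rewrite !mulr_ge0 ?bernoulli_pmf_ge0 // subr_ge0 r1 /= gerBl.
by rewrite sum_labels !big_bool /label_pmf /bernoulli_pmf /=; ring.
Qed.

Lemma pr_edge1 : pr (label_pmf q rho) edge1 = q.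
Proof. by rewrite /pr /Ex1 sum_labels !big_bool /label_pmf /bernoulli_pmf /edge1 /=; ring. Qed.

Lemma pr_edge2 : pr (label_pmf q rho) edge2 = q.
Proof. by rewrite /pr /Ex1 sum_labels !big_bool /label_pmf /bernoulli_pmf /edge2 /=; ring. Qed.

(** A present edge survives either because it is kept or because resampling draws it again; the
    bracket is the effective correlation [ro]. *)
Lemma pr_edge12 : pr (label_pmf q rho) (fun t => edge1 t && edge2 t) =
  q * (rho + (1 - rho) * q).
Proof.
by rewrite /pr /Ex1 sum_labels !big_bool /label_pmf /bernoulli_pmf /edge1 /edge2 /=; ring.
Qed.

Lemma measure_bigsetU_le (d : measure_display) (T : measurableType d)
    (P : probability T R) (I : finType) (B : pred I) (A : I -> set T) :
  (forall i, measurable (A i)) ->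
  (P (\big[setU/set0]_(i | B i) A i) <= \sum_(i | B i) P (A i))%E.
Proof.
move=> mA; suff : measurable (\big[setU/set0]_(i | B i) A i) /\
  (P (\big[setU/set0]_(i | B i) A i) <= \sum_(i | B i) P (A i))%E by case.
elim/big_ind2 : _ => //; first by rewrite measure0.
move=> X x Y y [mX PX] [mY PY]; split; first exact: measurableU.
by apply: le_trans (measureU2 _ mX mY) _; apply: leeD.
Qed.

(** Mutual independence gives each configuration of labels its product weight. The inequality, by
    finite subadditivity, is all that bounding the probability of a deviation requires. *)
Lemma resampled_gnp_law (d : measure_display) (T : measurableType d)
    (P : probability T R) (n : nat) (G1 G2 : vpair n -> {RV P >-> bool}) :
  resampled_gnp q rho G1 G2 ->
  exists cfg : T -> {ffun vpair n -> labels},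
    (forall w s, G1 s w = edge1 (cfg w s) /\ G2 s w = edge2 (cfg w s)) /\
    forall B : pred {ffun vpair n -> labels},
      (P [set w | B (cfg w)] <= (Ex (label_pmf q rho) (fun g => (B g)%:R))%:E)%E.
Proof.
move=> [S [F [ind lawG lawS lawF G2E]]].
pose cfg w : {ffun vpair n -> labels} := [ffun s => (G1 s w, S s w, F s w)].
exists cfg; split=> [w s|B]; first by rewrite ffunE G2E.
pose X := family3 G1 S F.
pose b (g : {ffun vpair n -> labels}) (i : vpair n + vpair n + vpair n) : bool :=
  family3 (fun s => (g s).1.1) (fun s => (g s).1.2) (fun s => (g s).2) i.
pose A g := \bigcap_i (X i @^-1` [set b g i]).
have mA g : measurable (A g).
  apply: fin_bigcap_measurable => // i _.
  by rewrite -[_ @^-1` _]setTI; apply: measurable_funPT.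
have AE g w : A g w <-> cfg w = g.
  split=> [Aw|<- i _].
    apply/ffunP => s; rewrite ffunE.
    have := Aw (inl (inl s)) I; have := Aw (inl (inr s)) I; have := Aw (inr s) I.
    rewrite /X /b /= => -> -> ->; by case: (g s) => -[].
  by case: i => [[s|s]|s]; rewrite /X /b /= ffunE.
have PA g : P (A g) = (weight (label_pmf q rho) g)%:E.
  rewrite ind // !big_sumType /=.
  have ber p c (Y : {RV P >-> bool}) : 0 <= p <= 1 -> distribution P Y =1 bernoulli_prob p ->
      P (Y @^-1` [set c]) = (bernoulli_pmf p c)%:E.
    move=> p01 lawY; have := lawY [set c]; rewrite /distribution /pushforward /= => ->.
    by rewrite /bernoulli_prob p01 fsbig_set1.
  have r01 : 0 <= 1 - rho <= 1.
    by case/andP: rho01 => r0 r1; rewrite subr_ge0 r1 /= gerBl.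
  rewrite (eq_bigr _ (fun s _ => ber q (g s).1.1 (G1 s) q01 (lawG s))).
  rewrite (eq_bigr _ (fun s _ => ber (1 - rho) (g s).1.2 (S s) r01 (lawS s))).
  rewrite (eq_bigr _ (fun s _ => ber q (g s).2 (F s) q01 (lawF s))).
  by rewrite !prodEFin -!EFinM -!big_split.
have -> : [set w | B (cfg w)] = \big[setU/set0]_(g | B g) A g.
  rewrite -bigcup_seq_cond; apply/seteqP; split=> w /= => [Bw|[g /= /andP[_ Bg] /AE->]//].
  by exists (cfg w); rewrite /= ?mem_index_enum //; apply/AE.
apply: le_trans (measure_bigsetU_le _ _ mA) _.
rewrite (eq_bigr _ (fun g _ => PA g)) sumEFin lee_fin /Ex big_mkcond /=.
by apply: ler_sum => g _; case: (B g); rewrite ?mulr1 ?mulr0.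
Qed.

End LabelLaw.

(** * Explicit bounds *)

Section ExplicitBounds.
Context {R : realType} (n : nat) (q rho : R).
Hypothesis n_gt2 : (2 < n)%N.
Hypothesis q01 : 0 <= q <= 1.
Hypothesis rho01 : 0 <= rho <= 1.
Let nu := label_pmf q rho.
Let ro := rho + (1 - rho) * q.
Let D := n%:R * q.
Hypothesis D_ge4 : 4 <= D.
Notation V := (vertex n).
Notation E := (@Ex R (vpair n) labels nu).
Let r : V := ord0.

Let nuP : is_pmf nu. Proof. exact: label_pmfP. Qed.
Let pr1 : pr nu edge1 = q. Proof. exact: pr_edge1. Qed.
Let pr2 : pr nu edge2 = q. Proof. exact: pr_edge2. Qed.
Let pr12 : pr nu (fun t => edge1 t && edge2 t) = q * ro. Proof. exact: pr_edge12. Qed.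
Let q_ge0 : 0 <= q. Proof. by case/andP: q01. Qed.
Let ro_ge0 : 0 <= ro.
Proof. by case/andP: rho01 => h0 h1; rewrite addr_ge0 // mulr_ge0 // subr_ge0. Qed.
Let ro_le1 : ro <= 1.
Proof.
case/andP: rho01 => h0 h1; case/andP: q01 => _ q1.
have : (1 - rho) * q <= (1 - rho) * 1 by apply: ler_wpM2l; rewrite ?subr_ge0.
by rewrite /ro mulr1; lra.
Qed.
Let D_ge2 : 2 <= D. Proof. by apply: le_trans D_ge4; rewrite ler_nat. Qed.
Let n_gt1 : (1 < n)%N. Proof. exact: ltnW. Qed.
Let n_gt0 : (0 < n)%N. Proof. exact: ltnW. Qed.
Let nR_gt0 : 0 < n%:R :> R. Proof. by rewrite ltr0n. Qed.
Let D_gt0 : 0 < D. Proof. by apply: lt_le_trans D_ge4. Qed.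

Let inv_le (m : nat) : (m <= 2)%N -> (n%:R - m%:R)^-1 <= 3 / n%:R :> R.
Proof.
move=> m2; have n3 : 3 <= n%:R :> R by rewrite ler_nat.
have m2' : m%:R <= 2 :> R by rewrite ler_nat.
have p : 0 < n%:R - m%:R :> R by lra.
by rewrite ler_pdivlMr // mulrC ler_pdivrMr //; lra.
Qed.

Lemma Ex_overlap_extreme k :
  E (fun g => overlap R (fun s => edge1 (g s)) (fun s => edge2 (g s))) <=
  6 * (D ^+ k / n%:R) + 4 * (2 / D + 40 * (D ^+ k / n%:R)) + 12 * (n%:R / D ^+ k.+1).
Proof.
have DE : D = n%:R * pr nu edge1 by rewrite pr1.
apply: le_trans (Ex_overlap_le nuP n_gt1 _ k DE D_ge4) _.
rewrite !lerD2r; have x0 : 0 <= D ^+ k by rewrite exprn_ge0 // ltW.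
have := ler_wpM2l x0 (@inv_le 1 isT).
rewrite [X in _ <= X](_ : _ = 3 * (D ^+ k / n%:R)); last by ring.
by move: (D ^+ k / _) (D ^+ k / _) => u v uv; lra.
Qed.

Section Limit.
Context (k : nat) (a b s c : R).
Hypothesis a_ge0 : 0 <= a.
Hypothesis b_ge0 : 0 <= b.
Hypothesis ab_gt0 : 0 < a + b.
Let x := D ^+ k.
Let y := q * x.
Hypothesis s_ge0 : 0 <= s.
Hypothesis sP : 2 / D + 40 * (x / n%:R) <= s ^+ 2.
Hypothesis cP : forall Z : {set V}, r \notin Z -> (#|Z| <= 3)%N ->
  ro * E (fun g => `|#|common r edge1 edge2 k Z g|%:R - ro ^+ k * x|) <= x * c.

(** Here [y] approximates the expected number of links of a vertex into layer [k] and should be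
    close to [a + b], while [y * ro ^+ k.+1] approximates that of common links and should be close
    to [b]. *)
Definition link_error_bound :=
  32 * (q * y) + 4 * (`|y - (a + b)| + y * s) + 6 * (y * c + `|y * ro ^+ k.+1 - b|).

Let x_ge0 : 0 <= x. Proof. by rewrite exprn_ge0 // ltW. Qed.

Lemma Ex_link_error (Z : {set V}) : r \notin Z -> (#|Z| <= 3)%N ->
  E (link_error r edge1 edge2 q ro k a b Z) <= link_error_bound.
Proof.
move=> rZ Z3.
have S1 e : pr nu e = q -> E (fun g => #|layer r (graph e g) Z k|%:R) <= x.
  by move=> pe; have := Ex_layer_le nuP n_gt0 e k rZ; rewrite pe.
have S2 e : pr nu e = q ->
    E (fun g => `|q * #|layer r (graph e g) Z k|%:R - (a + b)|) <= `|y - (a + b)| + y * s.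
  move=> pe; have h := @Ex_layer_dist _ _ _ nu nuP n_gt0 r e k Z s rZ Z3.
  rewrite pe in h; have {}h := h D_ge4 s_ge0 sP.
  apply: (@le_trans _ _ (E (fun g => `|y - (a + b)| +
      q * `|#|layer r (graph e g) Z k|%:R - x|))).
    apply: ler_Ex => // g; set S := #|_|%:R.
    have -> : q * S - (a + b) = (y - (a + b)) + q * (S - x) by rewrite /y; ring.
    by apply: le_trans (ler_normD _ _) _; rewrite normrM (ger0_norm q_ge0).
  by rewrite ExD Ex_cst // ExZ lerD2l /y -mulrA; apply: ler_wpM2l.
have S3 : E (fun g => `|q * ro * #|common r edge1 edge2 k Z g|%:R - b|) <=
    y * c + `|y * ro ^+ k.+1 - b|.
  apply: (@le_trans _ _ (E (fun g => (q * ro) *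
      `|#|common r edge1 edge2 k Z g|%:R - ro ^+ k * x| + `|y * ro ^+ k.+1 - b|))).
    have qr0 : 0 <= q * ro by rewrite mulr_ge0.
    apply: ler_Ex => // g; set C := #|_|%:R.
    have -> : q * ro * C - b = q * ro * (C - ro ^+ k * x) + (y * ro ^+ k.+1 - b).
      by rewrite /y exprS; ring.
    by apply: le_trans (ler_normD _ _) _; rewrite normrM (ger0_norm qr0).
  rewrite ExD ExZ Ex_cst // lerD2r /y -!mulrA; apply: ler_wpM2l => //; exact: cP.
rewrite /link_error ExD !ExZ !ExD ExZ /link_error_bound.
have := S1 _ pr1; have := S1 _ pr2; have := S2 _ pr1; have := S2 _ pr2; move: S3.
move: (E _) (E _) (E _) (E _) (E _) => e5 e3 e4 e1 e2 S3 h4 h3 h2 h1.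
have q2 : 0 <= 16 * q ^+ 2 by rewrite mulr_ge0 ?sqr_ge0.
have := ler_wpM2l q2 (lerD h1 h2).
have -> : 16 * q ^+ 2 * (x + x) = 32 * (q * y) by rewrite /y; ring.
lra.
Qed.

Let kap := 3 / n%:R + 4 * link_error_bound + 24 * (x / n%:R).
Let tau1 : R := 1 - expR (- (a + b)).
Let tau1_gt0 : 0 < tau1.
Proof. by rewrite subr_gt0 expR_lt1 oppr_lt0. Qed.

Lemma Ex_overlap_limit :
  E (fun g => `|overlap R (fun s => edge1 (g s)) (fun s => edge2 (g s)) -
                PE3 a a b (@overlap_stat R)|) <=
  Num.sqrt kap + 12 * (x / n%:R) + 2 * (4 / tau1 ^+ 2 * kap + 36 / tau1 * D^-1).
Proof.
pose kp (N : R) := N^-1 + 4 * link_error_bound + 8 * (x / N).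
have kpN m : (m <= 2)%N -> kp (n%:R - m%:R) <= kap.
  move=> m2; have i3 := inv_le m2; have := ler_wpM2l x_ge0 i3.
  rewrite [X in _ <= X](_ : _ = 3 * (x / n%:R)); last by ring.
  by rewrite /kp /kap; move: link_error_bound => e; lra.
have delta_ge0 : 0 <= link_error_bound.
  apply: le_trans (Ex_link_error (_ : r \notin finset.set0) _); rewrite ?inE ?cards0 //.
  by apply: Ex_ge0 => // g; rewrite /link_error !(addr_ge0, mulr_ge0) ?sqr_ge0.
have kap_ge0 : 0 <= kap.
  by rewrite /kap !addr_ge0 ?mulr_ge0 ?divr_ge0.
have sk : kp (n%:R - 1%:R) <= Num.sqrt kap ^+ 2 by rewrite sqr_sqrtr // kpN.
have := Ex_overlap_dist nuP n_gt2 pr1 pr2 pr12 ro_ge0 ro_le1 D_ge2 a_ge0 b_ge0 ab_gt0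
  Ex_link_error (sqrtr_ge0 _) sk.
move=> /le_trans; apply; apply: lerD; first apply: lerD => //.
  have := ler_wpM2l x_ge0 (@inv_le 1 isT).
  rewrite [X in _ <= X](_ : _ = 3 * (x / n%:R)); last by ring.
  by rewrite -/x; move: (x / _) (x / _) => u v uv; lra.
apply: ler_wpM2l => //; apply: lerD.
  apply: ler_wpM2l; first by rewrite divr_ge0 ?sqr_ge0.
  exact: (kpN 2%N).
have n2 : 0 < n%:R - 2%:R :> R by rewrite subr_gt0 ltr_nat.
have q0 : 0 < q by rewrite -(pmulr_rgt0 _ nR_gt0).
rewrite -/tau1 (_ : 12 / _ = 12 / (q * tau1) * (n%:R - 2%:R)^-1); last first.
  by field; rewrite !lt0r_neq0.
apply: le_trans (ler_wpM2l _ (@inv_le 2 isT)) _.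
  by rewrite divr_ge0 // mulr_ge0 // ltW.
rewrite le_eqVlt; apply/orP; left; apply/eqP; rewrite /D; field.
by rewrite !lt0r_neq0.
Qed.

End Limit.

Lemma common_dist_large k s (Z : {set V}) : r \notin Z -> (#|Z| <= 3)%N ->
  4 <= D * ro -> 0 <= s -> 2 / (D * ro) + 40 * (D ^+ k / n%:R) <= s ^+ 2 ->
  ro * E (fun g => `|#|common r edge1 edge2 k Z g|%:R - ro ^+ k * D ^+ k|) <=
  D ^+ k * (4 * (D ^+ k / n%:R) + 2 * s + 8 * D^-1).
Proof.
move=> rZ Z3 D4 s0 sP.
apply: le_trans (Ex_common_dist nuP n_gt0 pr1 pr2 pr12 ro_ge0 ro_le1 D_ge2 rZ Z3 D4 s0 sP).
by apply: ler_piMl => //; apply: Ex_ge0 => // g.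
Qed.

(** Intended for gamma = 0. The factor [ro], from the probability [q * ro] of a common link, raises
    [ro ^+ k] to [ro ^+ k.+1], the power whose limit is gamma. *)
Lemma common_dist_small k (Z : {set V}) : r \notin Z ->
  ro * E (fun g => `|#|common r edge1 edge2 k Z g|%:R - ro ^+ k * D ^+ k|) <=
  D ^+ k * (2 * ro ^+ k.+1 + 4 * (D ^+ k / n%:R)).
Proof.
move=> rZ; have x0 : 0 <= D ^+ k by rewrite exprn_ge0 // ltW.
have h := Ex_common_dist_small nuP n_gt0 pr1 pr2 pr12 ro_ge0 ro_le1 D_ge2 k rZ.
apply: le_trans (ler_wpM2l ro_ge0 h) _.
rewrite mulrCA; apply: ler_wpM2l => //; rewrite mulrDr exprS; apply: lerD.
  by rewrite mulrCA.
by apply: ler_piMl => //; rewrite mulr_ge0 // divr_ge0.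
Qed.

End ExplicitBounds.

(** * Asymptotics of the degree and of the critical depth *)

Section Growth.
Context {R : realType}.

Lemma cvgy_ln (u : nat -> R) : u n @[n --> \oo] --> +oo ->
  ln (u n) @[n --> \oo] --> +oo.
Proof.
move=> /cvgryPge uy; apply/cvgryPge => A; near=> n.
have Au : expR A <= u n by near: n; apply: uy.
by rewrite -[A]expRK ler_ln ?posrE ?expR_gt0 // (lt_le_trans (expR_gt0 A)).
Unshelve. all: by end_near. Qed.

Lemma cvgy_sqrt (u : nat -> R) : u n @[n --> \oo] --> +oo ->
  Num.sqrt (u n) @[n --> \oo] --> +oo.
Proof.
move=> /cvgryPge uy; apply/cvgryPge => A; near=> n.
have Au : A ^+ 2 <= u n by near: n; apply: uy.
apply: le_trans (ler_norm A) _; rewrite -sqrtr_sqr; exact: ler_wsqrtr.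
Unshelve. all: by end_near. Qed.

Lemma cvgy_natr : (n%:R : R) @[n --> \oo] --> +oo.
Proof. by apply/cvgryPge => A; exact: nbhs_infty_ger. Qed.

Lemma cvgy_inv0 (u : nat -> R) : u n @[n --> \oo] --> +oo ->
  (u n)^-1 @[n --> \oo] --> 0.
Proof.
move=> uy; apply/(@gtr0_cvgV0 _ _ _ _ u) => //.
by move/cvgryPgt : uy; apply.
Qed.

(** With [w] the fourth root of [t], [ln t = 4 * ln w <= 4 * w]. *)
Lemma sqr_ln_le (t : R) : 1 <= t -> ln t ^+ 2 <= 16 * Num.sqrt t.
Proof.
move=> t1; have t0 : 0 < t by apply: lt_le_trans t1.
pose w := Num.sqrt (Num.sqrt t).
have w0 : 0 < w by rewrite !sqrtr_gt0.
have w2 : w ^+ 2 = Num.sqrt t by rewrite sqr_sqrtr // sqrtr_ge0.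
have w4 : w ^+ 4 = t by rewrite (exprM w 2 2) w2 sqr_sqrtr // ltW.
have w1 : 1 <= w by rewrite -(ler_pXn2r (ltn0Sn 3)) ?nnegrE ?(ltW w0) // expr1n w4.
have lnt : ln t = 4 * ln w by rewrite -[in LHS]w4 lnXn // -[LHS]mulr_natl.
rewrite lnt exprMn -w2 -natrX.
apply: ler_wpM2l => //; rewrite lerXn2r ?nnegrE ?ln_ge0 ?(ltW w0) //.
exact/ltW/ln_sublinear.
Qed.

Lemma ln_le_sqrt (t : R) : 0 < t -> ln t <= 2 * Num.sqrt t.
Proof.
move=> t0; have w0 : 0 < Num.sqrt t by rewrite sqrtr_gt0.
have -> : ln t = 2 * ln (Num.sqrt t).
  by rewrite -[in LHS](sqr_sqrtr (ltW t0)) lnXn // -[LHS]mulr_natl.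
apply: ler_wpM2l => //; exact/ltW/ln_sublinear.
Qed.

Lemma limn_einf_gt0_bound (u : nat -> R) :
  (0 < limn_einf (fun n => (u n)%:E))%E ->
  exists2 a : R, 0 < a & \forall n \near \oo, a <= u n.
Proof.
rewrite limn_einf_lim (cvg_lim _ (cvg_einfs_sup (u := _))) // => /ereal_sup_gt[_ [m _ <-]].
set y := einfs _ m => y0.
have le k : (m <= k)%N -> (y <= (u k)%:E)%E.
  by move=> mk; apply: ereal_inf_lbound; exists k.
case E : y y0 (le m (leqnn m)) => [a| |] // y0 _; exists a; first by rewrite -lte_fin.
by exists m => // k /= mk; rewrite -lee_fin -E; apply: le.
Qed.

Lemma limn_esup_lty_bound (u : nat -> R) :
  (limn_esup (fun n => (u n)%:E) < +oo)%E ->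
  exists A : R, \forall n \near \oo, u n <= A.
Proof.
rewrite limn_esup_lim (cvg_lim _ (cvg_esups_inf (u := _))) // => /ereal_inf_lt[_ [m _ <-]].
set y := esups _ m => y0.
have le k : (m <= k)%N -> ((u k)%:E <= y)%E.
  by move=> mk; apply: ereal_sup_ubound; exists k.
case E : y y0 (le m (leqnn m)) => [A| |] // y0 _; exists A.
by exists m => // k /= mk; rewrite -lee_fin -E; apply: le.
Qed.

Lemma min_exponent (D M : R) : 2 <= D -> 1 < M ->
  exists K : nat, [/\ (0 < K)%N, M <= D ^+ K, D ^+ K.-1 < M &
    xget 0 [set d : int | (M <= D ^ d) /\ forall d' : int, (M <= D ^ d') -> d <= d']
    = K%:Z].
Proof.
move=> D2 M1; have D0 : 0 < D by apply: lt_le_trans D2.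
have ex : exists m : nat, M <= D ^+ m.
  exists (Num.truncn M).+1; apply: (@le_trans _ _ (Num.truncn M).+1%:R).
    by apply: ltW; apply: truncnS_gt.
  apply: (@le_trans _ _ (2 ^+ (Num.truncn M).+1)).
    by rewrite -natrX ler_nat ltnW // ltn_expl.
  by rewrite lerXn2r ?nnegrE // ltW.
have [K MK Kmin] := ex_minnP ex.
have K0 : (0 < K)%N by rewrite lt0n; apply: contraTneq MK => ->; rewrite expr0 -ltNge.
exists K; split=> //.
  by rewrite ltNge; apply/negP => /Kmin; rewrite -ltnS prednK // ltnn.
have okK : [set d : int | (M <= D ^ d) /\ forall d' : int, (M <= D ^ d') -> d <= d'] K%:Z.
  (* Negative exponents do not compete, since the power is then at most 1 and [1 < M]. *)
  split=> // -[m /Kmin//|m]; rewrite NegzE => /(lt_le_trans M1).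
  rewrite ltNge -exprnN invf_le1 ?exprn_gt0 // exprn_ege1 //.
  by apply: le_trans D2; rewrite ler1n.
apply: xget_unique => // d [okd dmin]; apply/eqP; rewrite eq_le dmin //=.
by case: okK => _; apply.
Qed.

Context (alpha : nat -> R).
Hypothesis alpha_gt0 : forall n, 0 < alpha n.
Hypothesis alpha_inf : (0 < limn_einf (fun n : nat => (alpha n)%:E))%E.
Hypothesis alpha_sup : (limn_esup (fun n : nat => (alpha n)%:E) < +oo)%E.

Definition mean_degree n : R := n%:R * edge_prob alpha n.

Lemma mean_degreeE n : (0 < n)%N -> mean_degree n = alpha n * ln n%:R.
Proof.
move=> n0; rewrite /mean_degree /edge_prob mulrC mulfVK //.
by rewrite pnatr_eq0 -lt0n.
Qed.

Lemma mean_degree_cvgy : mean_degree n @[n --> \oo] --> +oo.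
Proof.
have [a a0 na] := limn_einf_gt0_bound alpha_inf.
have /cvgryPge lny := cvgy_ln cvgy_natr.
apply/cvgryPge => A; near=> n.
have n0 : (0 < n)%N by near: n; exact: nbhs_infty_gt.
rewrite mean_degreeE //; apply: (@le_trans _ _ (a * (`|A| / a))).
  by rewrite mulrC divfK ?gt_eqF // ler_norm.
apply: ler_pM; first exact: ltW.
- by rewrite divr_ge0 // ltW.
- by near: n.
by near: n; apply: lny.
Unshelve. all: by end_near. Qed.

Lemma edge_prob_cvg0 : edge_prob alpha n @[n --> \oo] --> 0.
Proof.
have [A nA] := limn_esup_lty_bound alpha_sup.
apply: (@squeeze_cvgr _ _ _ _ (fun=> 0) (fun n => (2 * A) * (Num.sqrt n%:R)^-1)).
- near=> n.
  have n0 : (0 < n)%N by near: n; exact: nbhs_infty_gt.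
  have nR : 0 < n%:R :> R by rewrite ltr0n.
  have s0 : 0 < Num.sqrt n%:R :> R by rewrite sqrtr_gt0.
  have An : alpha n <= A by near: n.
  have l0 : 0 <= ln n%:R :> R by rewrite ln_ge0 // ler1n.
  rewrite /edge_prob divr_ge0 ?mulr_ge0 ?(ltW (alpha_gt0 n)) //=.
  rewrite ler_pdivrMr //.
  have -> : 2 * A * (Num.sqrt n%:R)^-1 * n%:R = A * (2 * Num.sqrt n%:R).
    rewrite -{2}(sqr_sqrtr (ltW nR)); field; exact: lt0r_neq0.
  by apply: ler_pM => //; [exact: ltW|exact: ln_le_sqrt].
- exact: cvg_cst.
- rewrite -[X in _ --> X](mulr0 (2 * A)); apply: cvgMr; apply: cvgy_inv0.
  exact: cvgy_sqrt cvgy_natr.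
Unshelve. all: by end_near. Qed.

Definition lnln n : R := ln (ln n%:R).

Lemma inv_sqr_lnln_cvg0 : (lnln n ^+ 2)^-1 @[n --> \oo] --> 0.
Proof.
have lly := cvgy_ln (cvgy_ln cvgy_natr).
rewrite (_ : (fun n => _) = fun n => (lnln n)^-1 * (lnln n)^-1); last first.
  by apply/funext => n; rewrite expr2 invfM.
by rewrite -[X in _ --> X](mulr0 0); apply: cvgM; apply: cvgy_inv0.
Qed.

(** Serves the case [lambda = 1]: there [D ^+ K / n] tends to 0, but stays above [(lnln n ^+ 2)^-1],
    and one more factor [D] outweighs this. *)
Lemma sqr_lnln_mean_degree_cvg0 :
  lnln n ^+ 2 / mean_degree n @[n --> \oo] --> 0.
Proof.
have [a a0 na] := limn_einf_gt0_bound alpha_inf.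
have lny := cvgy_ln cvgy_natr.
apply: (@squeeze_cvgr _ _ _ _ (fun=> 0) (fun n => (16 / a) * (Num.sqrt (ln n%:R))^-1)).
- near=> n.
  have n0 : (0 < n)%N by near: n; exact: nbhs_infty_gt.
  have l1 : 1 <= ln n%:R :> R by near: n; move/cvgryPge : lny; apply.
  have l0 : 0 < ln n%:R :> R by apply: lt_le_trans l1.
  have an : a <= alpha n by near: n.
  have s0 : 0 < Num.sqrt (ln n%:R) :> R by rewrite sqrtr_gt0.
  have D0 : 0 < mean_degree n by rewrite mean_degreeE // mulr_gt0.
  rewrite divr_ge0 ?sqr_ge0 ?(ltW D0) //= ler_pdivrMr // mean_degreeE //.
  apply: le_trans (sqr_ln_le l1) _.
  apply: (@le_trans _ _ (16 / a * (Num.sqrt (ln n%:R))^-1 * (a * ln n%:R))).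
    rewrite -{3}(sqr_sqrtr (ltW l0)) le_eqVlt; apply/orP; left; apply/eqP.
    by field; rewrite !lt0r_neq0.
  apply: ler_wpM2l; first by rewrite mulr_ge0 ?divr_ge0 ?invr_ge0 ?ltW.
  by apply: ler_wpM2r => //; apply: ltW.
- exact: cvg_cst.
- rewrite -[X in _ --> X](mulr0 (16 / a)); apply: cvgMr; apply: cvgy_inv0.
  exact: cvgy_sqrt lny.
Unshelve. all: by end_near. Qed.

Definition depth n : nat := `|dstar alpha n|%N.

Lemma near_regime : \forall n \near \oo,
  [/\ (2 < n)%N, 4 <= mean_degree n, 0 <= edge_prob alpha n <= 1 &
   [/\ dstar alpha n = (depth n)%:Z, (0 < depth n)%N,
   mean_degree n ^+ (depth n).-1 / n%:R <= (lnln n ^+ 2)^-1 &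
   (lnln n ^+ 2)^-1 <= mean_degree n ^+ depth n / n%:R]].
Proof.
have lny := cvgy_ln cvgy_natr; have lly := cvgy_ln lny.
have near1 : \forall n \near \oo, edge_prob alpha n <= 1.
  by near do apply: ltW; apply: (cvgr_lt _ edge_prob_cvg0 _ ltr01).
near=> n.
have n2 : (2 < n)%N by near: n; exact: nbhs_infty_gt.
have nR : 0 < n%:R :> R by rewrite ltr0n (ltn_trans _ n2).
have D4 : 4 <= mean_degree n by near: n; move/cvgryPge : mean_degree_cvgy; apply.
have q1 : edge_prob alpha n <= 1 by near: n.
have q0 : 0 <= edge_prob alpha n.
  by rewrite -(pmulr_rge0 _ nR); apply: le_trans D4.
(* This yields [lnln n ^+ 2 <= 16 * Num.sqrt (ln n) <= ln n < n], that is, a threshold above 1, as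
   [min_exponent] requires. *)
have l16 : 16 ^+ 2 <= ln n%:R :> R by near: n; move/cvgryPge : lny; apply.
have ll1 : 1 <= lnln n by near: n; move/cvgryPge : lly; apply.
have ll2 : 0 < lnln n ^+ 2 by rewrite exprn_gt0 // (lt_le_trans ltr01).
have D2 : 2 <= mean_degree n by apply: le_trans D4; rewrite ler_nat.
have l1 : 1 <= ln n%:R :> R by apply: le_trans l16; rewrite -natrX ler1n.
have M1 : 1 < n%:R / lnln n ^+ 2.
  rewrite ltr_pdivlMr // mul1r; apply: le_lt_trans (sqr_ln_le l1) _.
  apply: le_lt_trans (ln_sublinear nR).
  have s16 : 16 <= Num.sqrt (ln n%:R) :> R.
    by rewrite -[16](ger0_norm (_ : 0 <= _)) // -sqrtr_sqr ler_wsqrtr.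
  rewrite -[leRHS]sqr_sqrtr ?(le_trans _ l1) // expr2.
  by apply: ler_wpM2r => //; apply: sqrtr_ge0.
have [K [K0 MK MK1 KE]] := min_exponent D2 M1.
have dE : dstar alpha n = K%:Z := KE.
rewrite /depth dE absz_nat; split=> //; [exact/andP|split=> //].
  rewrite ler_pdivrMr // mulrC; exact: ltW.
by rewrite ler_pdivlMr // mulrC.
Unshelve. all: by end_near. Qed.

End Growth.

(** * Convergence in probability *)

Section Convergence.
Context {R : realType} (q rho : nat -> R).
Let ro n := rho n + (1 - rho n) * q n.
Let D n := n%:R * q n.

Notation Q n := (fun g : {ffun vpair n -> labels} =>
  overlap R (fun s => edge1 (g s)) (fun s => edge2 (g s))).

Lemma cvg_overlap_in_probability
    (d : nat -> measure_display) (T : forall n : nat, measurableType (d n))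
    (P : forall n : nat, probability (T n) R)
    (G1 G2 : forall n : nat, vpair n -> {RV (P n) >-> bool}) (c : R) (bnd : nat -> R) :
  (\forall n \near \oo, resampled_gnp (q n) (rho n) (G1 n) (G2 n)) ->
  (\forall n \near \oo, 0 <= q n <= 1) -> (forall n, 0 <= rho n <= 1) ->
  (\forall n \near \oo, Ex (label_pmf (q n) (rho n)) (fun g => `|Q n g - c|) <= bnd n) ->
  bnd n @[n --> \oo] --> 0 ->
  cvg_in_probability P
    (fun n w => overlap R (fun s => G1 n s w) (fun s => G2 n s w)) c.
Proof.
move=> law q01 rho01 Ebnd bnd0 eps eps0.
apply: (@squeeze_cvge _ _ _ _ (fun=> 0%E) _ (fun n => (bnd n / eps)%:E)); last 2 first.
- exact: cvg_cst.
- apply: cvg_EFin; first exact: nearW.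
  rewrite -[X in _ --> X](mul0r eps^-1); exact: cvgMl.
near=> n; rewrite measure_ge0 /=.
have q01n : 0 <= q n <= 1 by near: n.
have lawn : resampled_gnp (q n) (rho n) (G1 n) (G2 n) by near: n.
have nuP := label_pmfP q01n (rho01 n).
have [cfg [cfgE law_le]] := resampled_gnp_law q01n (rho01 n) lawn.
pose B g := eps <= `|Q n g - c|.
have -> : [set w | eps <= `|overlap R (fun s => G1 n s w) (fun s => G2 n s w) - c|] =
    [set w | B (cfg w)].
  have E1 w : (fun s => G1 n s w) = (fun s => edge1 (cfg w s)).
    by apply/funext => s; case: (cfgE w s).
  have E2 w : (fun s => G2 n s w) = (fun s => edge2 (cfg w s)).
    by apply/funext => s; case: (cfgE w s).
  by apply/funext => w; rewrite /mkset E1 E2.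
apply: le_trans (law_le B) _; rewrite lee_fin ler_pdivlMr // mulrC -ExZ.
apply: (@le_trans _ _ (Ex (label_pmf (q n) (rho n)) (fun g => `|Q n g - c|))).
  apply: ler_Ex => // g; case: (boolP (B g)) => [|_]; first by rewrite mulr1.
  by rewrite mulr0 normr_ge0.
by near: n.
Unshelve. all: by end_near. Qed.

(** The bound must not grow with [K]. The induction proves
    [x ^+ K - t ^+ K <= 2 * p * (1 - x ^+ K)], whose right-hand side telescopes; one step is
    [x - t = p * (1 - t) <= 2 * p * (1 - x)], where [1 - x = (1 - t) * (1 - p)] and [p <= 1 / 2]. *)
Lemma resampled_power_dist (p t : R) (K : nat) : 0 <= p <= 2^-1 -> 0 <= t <= 1 ->
  `|(t + (1 - t) * p) ^+ K - t ^+ K| <= 2 * p.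
Proof.
move=> /andP[p0 p2] /andP[t0 t1]; set x := t + (1 - t) * p.
have tx : t <= x by rewrite lerDl mulr_ge0 // subr_ge0.
have x1 : x <= 1 by rewrite /x; nra.
have x0 : 0 <= x by apply: le_trans tx.
have xK : 0 <= x ^+ K by rewrite exprn_ge0.
suff H : 0 <= x ^+ K - t ^+ K <= 2 * p * (1 - x ^+ K).
  by case/andP: H => h0 h1; rewrite ger0_norm //; nra.
rewrite subr_ge0 lerXn2r ?nnegrE //=.
elim: K {xK} => [|K IH]; first by rewrite !expr0 subrr mulr0.
rewrite !exprS.
have tK0 : 0 <= t ^+ K by rewrite exprn_ge0.
have tK1 : t ^+ K <= 1 by rewrite exprn_ile1.
have -> : x * x ^+ K - t * t ^+ K = x * (x ^+ K - t ^+ K) + (x - t) * t ^+ K by ring.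
have h1 := ler_wpM2l x0 IH.
have h2 : (x - t) * t ^+ K <= (x - t) * 1 by apply: ler_wpM2l; rewrite ?subr_ge0.
have h3 : x - t <= 2 * p * (1 - x).
  have -> : x - t = p * (1 - t) by rewrite /x; ring.
  have -> : 2 * p * (1 - x) = p * (1 - t) * (2 * (1 - p)) by rewrite /x; ring.
  apply: ler_peMr; last by lra.
  by rewrite mulr_ge0 // subr_ge0.
lra.
Qed.

Lemma sqrt_cvg0 (u : nat -> R) : u n @[n --> \oo] --> 0 ->
  Num.sqrt (u n) @[n --> \oo] --> 0.
Proof.
move=> u0; rewrite -[X in _ --> X]sqrtr0.
by apply: continuous_cvg => //; exact: sqrt_continuous.
Qed.

Context (k : nat -> nat) (L gamma : R).
Hypothesis L_gt0 : 0 < L.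
Hypothesis gamma01 : 0 <= gamma <= 1.
Hypothesis regime : \forall n \near \oo,
  [/\ (2 < n)%N, 4 <= D n, 0 <= q n <= 1 & 0 <= rho n <= 1].
Hypothesis Dy : D n @[n --> \oo] --> +oo.
Hypothesis q0 : q n @[n --> \oo] --> 0.
Let z n := D n ^+ k n / n%:R.
Let y n := q n * D n ^+ k n.
Hypothesis z0 : z n @[n --> \oo] --> 0.
Hypothesis yL : y n @[n --> \oo] --> L.
Hypothesis rok : ro n ^+ (k n).+1 @[n --> \oo] --> gamma.

Let a := (1 - gamma) * L.
Let b := gamma * L.

Lemma Ex_overlap_cvg : exists2 bnd : nat -> R, bnd n @[n --> \oo] --> 0 &
  \forall n \near \oo, Ex (label_pmf (q n) (rho n))
    (fun g => `|Q n g - PE3 a a b (@overlap_stat R)|) <= bnd n.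
Proof.
have [g0 g1] : 0 <= gamma /\ gamma <= 1 by apply/andP.
have a0 : 0 <= a by rewrite mulr_ge0 ?subr_ge0 // ltW.
have b0 : 0 <= b by rewrite mulr_ge0 // ltW.
have abL : a + b = L by rewrite /a /b; ring.
have ab0 : 0 < a + b by rewrite abL.
have iD0 := cvgy_inv0 Dy.
pose s n := Num.sqrt (2 * (D n)^-1 + 40 * z n).
pose s' n := Num.sqrt (4 / gamma * (D n)^-1 + 40 * z n).
(* For [gamma > 0] the intersection graph has large mean degree [D * ro] and the sharp estimate
   applies; for [gamma = 0] the common layers are negligible by the upper bound. *)
pose c n := if 0 < gamma then 4 * z n + 2 * s' n + 8 * (D n)^-1
            else 2 * ro n ^+ (k n).+1 + 4 * z n.
pose lb n := link_error_bound n (q n) (rho n) (k n) a b (s n) (c n).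
pose kap n := 3 / n%:R + 4 * lb n + 24 * z n.
pose tau1 := 1 - expR (- (a + b)).
exists (fun n => Num.sqrt (kap n) + 12 * z n +
  2 * (4 / tau1 ^+ 2 * kap n + 36 / tau1 * (D n)^-1)); last first.
  have ro_half : \forall n \near \oo, 0 < gamma -> gamma / 2 <= ro n ^+ (k n).+1.
    have [gp|_] := ltP 0 gamma; last exact: nearW.
    have gh : gamma / 2 < gamma by lra.
    by near do (move=> _; apply: ltW); apply: (cvgr_gt _ rok).
  have D_large : \forall n \near \oo, 0 < gamma -> 8 / gamma <= D n.
    by near do move=> _; move/cvgryPge : Dy; apply.
  near=> n.
  have ro_n : 0 < gamma -> gamma / 2 <= ro n ^+ (k n).+1 by near: n.
  have D_n : 0 < gamma -> 8 / gamma <= D n by near: n.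
  have [n2 D4 q01 r01] : [/\ (2 < n)%N, 4 <= D n, 0 <= q n <= 1 & 0 <= rho n <= 1] by near: n.
  have D0 : 0 < D n by apply: lt_le_trans D4.
  have zn0 : 0 <= z n by rewrite divr_ge0 // exprn_ge0 // ltW.
  apply: (Ex_overlap_limit n2 q01 r01 D4 a0 b0 ab0 (sqrtr_ge0 _)).
    by rewrite sqr_sqrtr // addr_ge0 // mulr_ge0 // invr_ge0 ltW.
  move=> Z rZ Z3; rewrite /c; case: ifPn => [gp|_]; last exact: common_dist_small.
  have ro1 : ro n <= 1.
    case/andP: q01 => _ q1; case/andP: r01 => r0 r1.
    by rewrite /ro; have := ler_wpM2l (_ : 0 <= 1 - rho n) q1; rewrite subr_ge0; lra.
  have ro0 : 0 <= ro n.
    by case/andP: q01 => *; case/andP: r01 => *; rewrite addr_ge0 // mulr_ge0 // subr_ge0.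
  (* A power of [ro] bounded below bounds [ro] itself. With [8 / gamma <= D] this gives
     [4 <= D * ro], and [2 / (D * ro)] is at most the term [4 / gamma / D] of [s']. *)
  have ro2 : gamma / 2 <= ro n.
    apply: (@le_trans _ _ (ro n ^+ (k n).+1)); first exact: ro_n.
    by rewrite exprS ler_piMr // exprn_ile1.
  have gh0 : 0 < gamma / 2 by rewrite divr_gt0.
  have Dro : D n * (gamma / 2) <= D n * ro n by rewrite ler_pM2l.
  have Dro0 : 0 < D n * ro n by apply: lt_le_trans Dro; rewrite mulr_gt0.
  apply: common_dist_large => //.
  - apply: le_trans Dro; have := D_n gp.
    rewrite ler_pdivrMr //; lra.
  - exact: sqrtr_ge0.
  - have gi0 : 0 <= 4 / gamma * (D n)^-1.
      by rewrite mulr_ge0 ?divr_ge0 ?invr_ge0 ?ltW.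
    rewrite /s' sqr_sqrtr; last by apply: addr_ge0 => //; exact: mulr_ge0.
    apply: lerD => //; rewrite ler_pdivrMr //.
    apply: le_trans (ler_wpM2l gi0 Dro).
    rewrite le_eqVlt; apply/orP; left; apply/eqP; field.
    by rewrite !lt0r_neq0.
have s0 : s n @[n --> \oo] --> 0.
  apply: sqrt_cvg0; rewrite -[X in _ --> X](_ : 2 * 0 + 40 * 0 = 0); last by ring.
  by apply: cvgD; apply: cvgMr.
have s'0 : s' n @[n --> \oo] --> 0.
  apply: sqrt_cvg0; rewrite -[X in _ --> X](_ : 4 / gamma * 0 + 40 * 0 = 0); last by ring.
  by apply: cvgD; apply: cvgMr.
have c0 : c n @[n --> \oo] --> 0.
  rewrite /c; have [gp|gn] := ltP 0 gamma.
    rewrite -[X in _ --> X](_ : 4 * 0 + 2 * 0 + 8 * 0 = 0); last by ring.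
    by apply: cvgD; [apply: cvgD|]; apply: cvgMr.
  have gE : gamma = 0 by apply/eqP; rewrite eq_le g0 gn.
  rewrite -[X in _ --> X](_ : 2 * gamma + 4 * 0 = 0); last by rewrite gE; ring.
  by apply: cvgD; apply: cvgMr.
have lb0 : lb n @[n --> \oo] --> 0.
  have -> : lb = fun n => 32 * (q n * y n) + 4 * (`|y n - (a + b)| + y n * s n) +
      6 * (y n * c n + `|y n * ro n ^+ (k n).+1 - b|) by [].
  rewrite -[X in _ --> X](_ : 32 * (0 * L) + 4 * (`|L - (a + b)| + L * 0) +
      6 * (L * 0 + `|L * gamma - b|) = 0); last first.
    by rewrite abL /b [L * gamma]mulrC !subrr normr0; ring.
  apply: cvgD; first apply: cvgD; apply: cvgMr.
  - exact: cvgM.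
  - apply: cvgD; last exact: cvgM.
    by apply: cvg_norm; apply: cvgB => //; exact: cvg_cst.
  - apply: cvgD; first exact: cvgM.
    by apply: cvg_norm; apply: cvgB; [exact: cvgM|exact: cvg_cst].
have kap0 : kap n @[n --> \oo] --> 0.
  rewrite -[X in _ --> X](_ : 3 * 0 + 4 * 0 + 24 * 0 = 0); last by ring.
  apply: cvgD; first apply: cvgD; apply: cvgMr => //.
  exact: cvgy_inv0 cvgy_natr.
rewrite -[X in _ --> X](_ : 0 + 12 * 0 + 2 * (4 / tau1 ^+ 2 * 0 + 36 / tau1 * 0) = 0); last by ring.
apply: cvgD; first by apply: cvgD; [exact: sqrt_cvg0|exact: cvgMr].
by apply: cvgMr; apply: cvgD; apply: cvgMr.
Unshelve. all: by end_near. Qed.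

End Convergence.

Lemma Ex_overlap_cvg0 (R : realType) (q rho : nat -> R) (k : nat -> nat) :
  (\forall n \near \oo,
     [/\ (2 < n)%N, 4 <= n%:R * q n, 0 <= q n <= 1 & 0 <= rho n <= 1]) ->
  n%:R * q n @[n --> \oo] --> +oo ->
  (n%:R * q n) ^+ k n / n%:R @[n --> \oo] --> 0 ->
  n%:R / (n%:R * q n) ^+ (k n).+1 @[n --> \oo] --> 0 ->
  exists2 bnd : nat -> R, bnd n @[n --> \oo] --> 0 &
  \forall n \near \oo, Ex (label_pmf (q n) (rho n))
    (fun g : {ffun vpair n -> labels} =>
       `|overlap R (fun s => edge1 (g s)) (fun s => edge2 (g s)) - 0|) <= bnd n.
Proof.
move=> regime Dy z0 w0; have iD0 := cvgy_inv0 Dy.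
pose z n := (n%:R * q n) ^+ k n / n%:R; pose w n := n%:R / (n%:R * q n) ^+ (k n).+1.
exists (fun n => 6 * z n + 4 * (2 * (n%:R * q n)^-1 + 40 * z n) + 12 * w n).
  rewrite -[X in _ --> X](_ : 6 * 0 + 4 * (2 * 0 + 40 * 0) + 12 * 0 = 0); last by ring.
  apply: cvgD; last exact: cvgMr.
  apply: cvgD; first exact: cvgMr.
  by apply: cvgMr; apply: cvgD; apply: cvgMr.
near=> n.
have [n2 D4 q01 r01] : [/\ (2 < n)%N, 4 <= n%:R * q n, 0 <= q n <= 1 & 0 <= rho n <= 1] by near: n.
apply: le_trans (Ex_overlap_extreme n2 q01 r01 D4 (k n)).
rewrite le_eqVlt; apply/orP; left; apply/eqP; apply: eq_Ex => g.
rewrite subr0 ger0_norm // overlapE mulr_ge0 //.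
  by rewrite invr_ge0 subr_ge0 ler1n (ltn_trans _ n2).
by apply: sumr_ge0 => v _; apply: set_overlap_ge0.
Unshelve. all: by end_near. Qed.

Theorem theorem4p10 (R : realType)
  (alpha rho_ lambda_ : nat -> R) (lambda gamma rho : R)
  (d : nat -> measure_display) (T : forall n : nat, measurableType (d n))
  (P : forall n : nat, probability (T n) R)
  (G1 G2 : forall n : nat, vpair n -> {RV (P n) >-> bool})
  (alpha_gt0 : forall n : nat, 0 < alpha n)
  (alpha_inf : (0 < limn_einf (fun n : nat => (alpha n)%:E))%E)
  (alpha_sup : (limn_esup (fun n : nat => (alpha n)%:E) < +oo)%E)
  (rho_01 : forall n : nat, 0 < rho_ n < 1)
  (G12 : \forall n \near \oo,
     resampled_gnp (edge_prob alpha n) (rho_ n) (G1 n) (G2 n))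
  (lambda_def : \forall n \near \oo, 0 < lambda_ n < 1 /\
     ln (1 / lambda_ n) = (n%:R * edge_prob alpha n) ^ dstar alpha n / n%:R)
  (lambda_ge0le1 : 0 <= lambda <= 1)
  (gamma_ge0le1 : 0 <= gamma <= 1)
  (rho_ge0le1 : 0 <= rho <= 1)
  (lambda_cvg : lambda_ n @[n --> \oo] --> lambda)
  (gamma_cvg : rho_ n ^ dstar alpha n @[n --> \oo] --> gamma)
  (rho_cvg : rho_ n @[n --> \oo] --> rho) :
  cvg_in_probability P
    (fun n w => overlap R (fun s => G1 n s w) (fun s => G2 n s w))
    (if (0 < lambda < 1) && (0 < gamma) then
       h ((1 - gamma) * ln (1 / lambda)) (gamma * ln (1 / lambda)) *
       (1 - lambda `^ gamma)
     else 0).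
Proof.
pose q := edge_prob alpha; pose D := mean_degree alpha; pose K := depth alpha.
have reg := near_regime alpha_gt0 alpha_inf alpha_sup.
have Dy : D n @[n --> \oo] --> +oo := mean_degree_cvgy alpha_inf.
have q0 : q n @[n --> \oo] --> 0 := edge_prob_cvg0 alpha_gt0 alpha_sup.
have rho01 n : 0 <= rho_ n <= 1 by case/andP: (rho_01 n) => ? ?; rewrite !ltW.
have regime : \forall n \near \oo,
    [/\ (2 < n)%N, 4 <= n%:R * q n, 0 <= q n <= 1 & 0 <= rho_ n <= 1].
  by apply: filterS reg => n [n2 D4 q01 _].
have q01 : \forall n \near \oo, 0 <= q n <= 1 by apply: filterS regime => n [].
have z0 : D n ^+ (K n).-1 / n%:R @[n --> \oo] --> 0.
  apply: (@squeeze_cvgr _ _ _ _ (fun=> 0) (fun n => (lnln n ^+ 2)^-1)).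
  - apply: filterS reg => n [_ D4 _ [_ _ zle _]]; rewrite zle andbT.
    by rewrite divr_ge0 // exprn_ge0 // (le_trans _ D4).
  - exact: cvg_cst.
  - exact: inv_sqr_lnln_cvg0.
have Lnear : \forall n \near \oo, 0 < lambda_ n < 1 /\
    ln (1 / lambda_ n) = D n ^+ K n / n%:R.
  near=> n.
  have [lam ->] : 0 < lambda_ n < 1 /\
    ln (1 / lambda_ n) = (n%:R * edge_prob alpha n) ^ dstar alpha n / n%:R by near: n.
  have dE : dstar alpha n = (K n)%:Z by near: n; apply: filterS reg => n [_ _ _ []].
  by rewrite dE.
have Kpos : \forall n \near \oo, (0 < K n)%N by apply: filterS reg => n [_ _ _ []].
have [lam0 lam1] : 0 <= lambda /\ lambda <= 1 by apply/andP.
have Lcvg : 0 < lambda -> D n ^+ K n / n%:R @[n --> \oo] --> ln (1 / lambda).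
  move=> lp; have : ln (1 / lambda_ n) @[n --> \oo] --> ln (1 / lambda).
    apply: continuous_cvg; first by apply: continuous_ln; rewrite divr_gt0.
    by apply: cvgMr; apply: cvgV => //; rewrite gt_eqF.
  apply: cvg_trans; apply: near_eq_cvg.
  by apply: filterS Lnear => n [].
have [lp|ln0] := ltP 0 lambda; last first.
  have lE : lambda = 0 by apply/eqP; rewrite eq_le lam0 ln0.
  (* For [lambda = 0] the depth [K - 1] is already extreme: its ball is negligible and [D ^+ K / n]
     diverges. *)
  have Ly : D n ^+ K n / n%:R @[n --> \oo] --> +oo.
    apply/cvgryPge => A; near=> n.
    have [/andP[l0 _] <-] : 0 < lambda_ n < 1 /\ ln (1 / lambda_ n) = D n ^+ K n / n%:R.
      by near: n.
    have lA : lambda_ n < expR (- A).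
      by near: n; apply: (cvgr_lt _ lambda_cvg); rewrite lE expR_gt0.
    rewrite div1r lnV ?posrE // lerNr -[X in _ <= X]expRK ler_ln ?posrE ?expR_gt0 //.
    exact: ltW.
  have w0 : n%:R / D n ^+ (K n).-1.+1 @[n --> \oo] --> 0.
    apply: cvg_trans (cvgy_inv0 Ly); apply: near_eq_cvg.
    by apply: filterS Kpos => n K0; rewrite prednK // invf_div.
  have [bnd bnd0 Eb] := Ex_overlap_cvg0 regime Dy z0 w0.
  exact: cvg_overlap_in_probability G12 q01 rho01 Eb bnd0.
have [l1|l1] /= := ltP lambda 1; last first.
  have lE : lambda = 1 by apply/eqP; rewrite eq_le lam1 l1.
  (* For [lambda = 1] even the ball of radius [K] is negligible, so the extreme estimate is used at
     depth [K] instead of [K - 1]. *)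
  have L0 : D n ^+ K n / n%:R @[n --> \oo] --> 0.
    by have := Lcvg lp; rewrite lE divr1 ln1.
  have w0 : n%:R / D n ^+ (K n).+1 @[n --> \oo] --> 0.
    apply: (@squeeze_cvgr _ _ _ _ (fun=> 0) (fun n => lnln n ^+ 2 / D n)).
    - near=> n.
      have [n2 D4 _ [_ _ _ Lge]] : [/\ (2 < n)%N, 4 <= D n, 0 <= q n <= 1 &
        [/\ dstar alpha n = (K n)%:Z, (0 < K n)%N,
            D n ^+ (K n).-1 / n%:R <= (lnln n ^+ 2)^-1 &
            (lnln n ^+ 2)^-1 <= D n ^+ K n / n%:R]] by near: n.
      have D0 : 0 < D n by apply: lt_le_trans D4.
      have nR : 0 < n%:R :> R by rewrite ltr0n (ltn_trans _ n2).
      have ll0 : 0 < lnln n ^+ 2 :> R.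
        rewrite exprn_gt0 //; near: n; have := cvgy_ln (cvgy_ln (@cvgy_natr R)).
        by move/cvgryPgt; apply.
      rewrite divr_ge0 ?exprn_ge0 ?(ltW D0) //= exprS invfM mulrCA mulrC.
      apply: ler_wpM2r; first by rewrite invr_ge0 ltW.
      rewrite -[leLHS]invf_div -[leRHS]invrK lef_pV2 ?posrE ?divr_gt0 ?invr_gt0 //.
      by rewrite exprn_gt0.
    - exact: cvg_cst.
    - exact: sqr_lnln_mean_degree_cvg0.
  have [bnd bnd0 Eb] := Ex_overlap_cvg0 regime Dy L0 w0.
  exact: cvg_overlap_in_probability G12 q01 rho01 Eb bnd0.
set L := ln (1 / lambda).
have L_gt0 : 0 < L by rewrite ln_gt0 // div1r invf_gt1.
have yL : q n * D n ^+ (K n).-1 @[n --> \oo] --> L.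
  apply: cvg_trans (Lcvg lp); apply: near_eq_cvg; near=> n.
  have K0 : (0 < K n)%N by near: n.
  have n0 : n%:R != 0 :> R by rewrite pnatr_eq0 -lt0n; near: n; exact: nbhs_infty_gt.
  rewrite -[in LHS](prednK K0) exprS {1}/D /mean_degree -/(q n).
  by rewrite -[n%:R * q n * _]mulrA [LHS]mulrC mulKf.
(* The effective correlation exceeds [rho_ n] by at most [q n], and [resampled_power_dist] shows
   that this is harmless even for the growing power [K n]. *)
have rok : (rho_ n + (1 - rho_ n) * q n) ^+ (K n).-1.+1 @[n --> \oo] --> gamma.
  have rK : rho_ n ^+ K n @[n --> \oo] --> gamma.
    apply: cvg_trans gamma_cvg; apply: near_eq_cvg.
    by apply: filterS reg => n [_ _ _ [-> _ _ _]].
  have dif : (rho_ n + (1 - rho_ n) * q n) ^+ K n - rho_ n ^+ K n @[n --> \oo] --> 0.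
    apply: norm_cvg0.
    apply: (@squeeze_cvgr _ _ _ _ (fun=> 0) (fun n => 2 * q n)).
    - near=> n; rewrite normr_ge0 /=; apply: resampled_power_dist => //.
      have /andP[-> _] /= : 0 <= q n <= 1 by near: n.
      have : q n < 2^-1 by near: n; apply: (cvgr_lt _ q0).
      exact: ltW.
    - exact: cvg_cst.
    - by rewrite -[X in _ --> X](mulr0 2); apply: cvgMr.
  have sumc : (rho_ n + (1 - rho_ n) * q n) ^+ K n - rho_ n ^+ K n + rho_ n ^+ K n
      @[n --> \oo] --> 0 + gamma by apply: cvgD.
  rewrite add0r in sumc; apply: cvg_trans sumc; apply: near_eq_cvg.
  by apply: filterS Kpos => n K0; rewrite subrK prednK.
have [bnd bnd0 Eb] := Ex_overlap_cvg L_gt0 gamma_ge0le1 regime Dy q0 z0 yL rok.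
suff -> : (if 0 < gamma then h ((1 - gamma) * L) (gamma * L) * (1 - lambda `^ gamma)
   else 0) = PE3 ((1 - gamma) * L) ((1 - gamma) * L) (gamma * L) (@overlap_stat R).
  exact: cvg_overlap_in_probability G12 q01 rho01 Eb bnd0.
have [g0 g1] : 0 <= gamma /\ gamma <= 1 by apply/andP.
have a0 : 0 <= (1 - gamma) * L by rewrite mulr_ge0 ?subr_ge0 // ltW.
have [gp|gn] := ltP 0 gamma.
  rewrite -h_PE3 ?mulr_gt0 //; congr (_ * (1 - _)).
  by rewrite /powR gt_eqF // /L div1r lnV ?posrE // mulrN opprK.
(* The common rate is 0 here, so [Z = 0] and the statistic vanishes. *)
have -> : gamma = 0 by apply/eqP; rewrite eq_le g0 gn.
rewrite mul0r /PE3 -[LHS](PE_cst ((1 - 0) * L)); apply: eq_PE => x.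
rewrite -[LHS](PE_cst ((1 - 0) * L)); apply: eq_PE => y'.
rewrite PE0; last exact: overlap_stat_unit.
by rewrite /overlap_stat mul0r.
Unshelve. all: by end_near. Qed.
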